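(* Let $K \subset \mathbb{R}^2$ be any convex shape, and let $Q \subset \mathbb{R}^2$ be either an arbitrary (convex) quadrilateral or an affinely regular hexagon (the image of a regular hexagon under an invertible affine map). Then \[ \operatorname{area} K \cdot \operatorname{area} Q \ge \frac12\, c(K \times Q)^2 . \]
   Context: A convex shape is a compact convex subset of $\mathbb{R}^2$ with non-empty interior. For convex shapes $K,Q\subset\mathbb{R}^2$, $c(K\times Q)$ denotes the Ekeland--Hofer--Zehnder symplectic capacity of the lagrangian product $K\times Q\subset \mathbb{R}^2_q\times\mathbb{R}^2_p$ (with standard symplectic form $dq_1\wedge dp_1+dq_2\wedge dp_2$): the minimal action $\int p\,dq$ of a closed (generalized) characteristic on the boundary $\partial(K\times Q)$, where for non-smooth boundaries characteristics are defined via the differential inclusion $\dot\gamma(t)\in J\,N_{K\times Q}(\gamma(t))$ with $N$ the outward normal cone and $J(q,p)=(-p,q)$. Equivalently, $c(K\times Q)$ is the minimal $Q$-length of a closed generalized $Q$-Minkowski billiard orbit in the billiard table $K$, where the $Q$-length of a vector $x$ is $\|x\|_Q=\max_{y\in Q}\langle x,y\rangle$. *)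

(* Defs.v *)
From HB Require Import structures.
From mathcomp Require Import all_boot all_order all_algebra.
From mathcomp Require Import all_classical all_reals all_analysis.
Set Implicit Arguments. Unset Strict Implicit. Unset Printing Implicit Defensive.
Import Order.TTheory GRing.Theory Num.Theory.
Import numFieldNormedType.Exports.
Local Open Scope classical_set_scope.
Local Open Scope ring_scope.

Section Defs.
Variable R : realType.

(* The plane R^2 is modelled as R * R; phase space R^2_q x R^2_p as (R*R)*(R*R). *)
Definition pt := (R * R)%type.
Definition phase := (pt * pt)%type.

Definition dot2 (x y : pt) : R := x.1 * y.1 + x.2 * y.2.
Definition dot4 (z w : phase) : R := dot2 z.1 w.1 + dot2 z.2 w.2.
Definition sub2 (x y : pt) : pt := (x.1 - y.1, x.2 - y.2).
Definition sub4 (z w : phase) : phase := (sub2 z.1 w.1, sub2 z.2 w.2).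

Definition convex2 (K : set pt) : Prop :=
  forall x y, K x -> K y -> forall t : R, 0 <= t -> t <= 1 ->
    K (t * x.1 + (1 - t) * y.1, t * x.2 + (1 - t) * y.2).

Definition convex_shape (K : set pt) : Prop :=
  compact K /\ convex2 K /\ interior K !=set0.

Definition hull (s : seq pt) : set pt :=
  [set x | exists w : nat -> R,
     (forall i, 0 <= w i) /\ \sum_(i < size s) w i = 1 /\
     x = (\sum_(i < size s) w i * (nth (0, 0) s i).1,
          \sum_(i < size s) w i * (nth (0, 0) s i).2)].

Definition quadrilateral (Q : set pt) : Prop :=
  exists a b c d : pt,
    Q = hull [:: a; b; c; d] /\
    ~ hull [:: b; c; d] a /\ ~ hull [:: a; c; d] b /\
    ~ hull [:: a; b; d] c /\ ~ hull [:: a; b; c] d.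

Definition regular_hexagon : set pt :=
  hull [seq (cos (k%:R * pi / 3), sin (k%:R * pi / 3)) | k <- iota 0 6].

Definition affine_map (a11 a12 a21 a22 b1 b2 : R) (x : pt) : pt :=
  (a11 * x.1 + a12 * x.2 + b1, a21 * x.1 + a22 * x.2 + b2).

Definition affinely_regular_hexagon (Q : set pt) : Prop :=
  exists a11 a12 a21 a22 b1 b2 : R,
    a11 * a22 - a12 * a21 != 0 /\
    Q = affine_map a11 a12 a21 a22 b1 b2 @` regular_hexagon.

Definition area (K : set pt) : R :=
  fine (((@lebesgue_measure R) \x (@lebesgue_measure R))%E K).

Definition lagr_prod (K Q : set pt) : set phase := K `*` Q.

Definition bdry (C : set phase) : set phase := closure C `\` interior C.

Definition normal_cone (C : set phase) (z : phase) : set phase :=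
  [set n | forall y, C y -> dot4 n (sub4 y z) <= 0].

Definition Jmap (z : phase) : phase := ((- z.2.1, - z.2.2), (z.1.1, z.1.2)).

Definition leb := (@lebesgue_measure R).

Definition comp4 (i : 'I_4) (z : phase) : R :=
  match val i with 0 => z.1.1 | 1 => z.1.2 | 2 => z.2.1 | _ => z.2.2 end.

(* g : [0,T] -> boundary C is a closed generalized characteristic of period
   T > 0: g is absolutely continuous (g t = g 0 + int_0^t v with v integrable),
   closed (g 0 = g T), non-constant, stays on the boundary, and satisfies the
   differential inclusion v(t) in J N_C(g t) for almost every t in [0,T]. *)
Definition closed_characteristic (C : set phase) (T : R) (g v : R -> phase) : Prop :=
  0 < T /\
  g 0 = g T /\
  (forall t, 0 <= t <= T -> bdry C (g t)) /\
  (exists t, 0 <= t <= T /\ g t <> g 0) /\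
  (forall i : 'I_4, leb.-integrable `[0, T]%classic (EFin \o (fun s => comp4 i (v s)))) /\
  (forall i : 'I_4, forall t, 0 <= t <= T ->
      comp4 i (g t) = comp4 i (g 0) + \int[leb]_(s in `[0, t]%classic) comp4 i (v s)) /\
  {ae leb, forall t, `[0, T]%classic t ->
      exists n, normal_cone C (g t) n /\ v t = Jmap n}.

Definition action (T : R) (g v : R -> phase) : R :=
  \int[leb]_(t in `[0, T]%classic) ((g t).2.1 * (v t).1.1 + (g t).2.2 * (v t).1.2).

Definition EHZ (C : set phase) : R :=
  inf [set a | exists T g v, closed_characteristic C T g v /\ a = `|action T g v|].

Definition lagr_capacity (K Q : set pt) : R := EHZ (lagr_prod K Q).

End Defs.

(* Main.v *)
Require Import Defs.
From HB Require Import structures.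
From mathcomp Require Import all_boot all_order all_algebra.
From mathcomp Require Import all_classical all_reals all_analysis.
From mathcomp Require Import measurable_realfun ring lra.
Set Implicit Arguments. Unset Strict Implicit. Unset Printing Implicit Defensive.
Import Order.TTheory GRing.Theory Num.Theory.
Import numFieldNormedType.Exports.
Local Open Scope classical_set_scope.
Local Open Scope ring_scope.

(* Let c be the capacity, and call a triangle with vertices w_i admissible if
   <y1, w3 - w1> + <y2, w1 - w2> + <y3, w2 - w3> <= 1 for all y_i in Q.  Suppose that a
   finite family of admissible triangles decides which triangles fit into Q up to
   translation.  Enlarge the members of the family and their negatives until one of them
   stops fitting into K, say at scale mu.  Outward normals at its contact points with K
   add up to zero, so they are the sides of a triangle; this triangle fits into Q, since
   the other members still fit into K at scale mu, and the two triangles together span a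
   closed characteristic of action mu.  Hence mu >= c, i.e. K contains translates of
   c T and - c T for every T in the family, and it remains to bound area K from below.

   A quadrilateral is affinely {0, (1, 0), (x, y), (0, 1)} with x, y <= 1 < x + y, and two
   triangles suffice.  Moving the two centres of symmetry of the pairs +-T onto each other
   does not increase the area and makes K centrally symmetric; the bound 1 / (x + y) then
   follows from inscribed centrally symmetric polygons with at most ten vertices.

   For the regular hexagon two opposite triangles and three segments suffice.  The bound
   2/3 on the area comes from the monotonicity of mixed areas or from inscribed hexagons
   and nonagons, depending on the position of the segments. *)

(** * Area in the plane *)

(** The capacity enters only through upper bounds: one explicit closed characteristic of action
    below [c] gives the contradiction. The translates that end up inside [K] are independent of each
    other. Their relative position is therefore unknown and their corners need not be in convex
    position, which is the main obstacle to an area bound. For this reason the polygon estimates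
    speak of signed areas under weak ordering hypotheses, and positions violating these are handled
    by other inscribed figures. The constants come from normalizing [c] to 1: the quadrilateral has
    area (x + y) / 2, so 1 / (x + y) is exactly what [K] has to provide. The hexagon in its integral
    coordinates has area 3, which asks for 1 / 6; doubling all lengths turns this into 2 / 3. *)

Section PlaneMeasure.
Variable R : realType.
Notation lam := (@lebesgue_measure R).
Notation mu2 := ((@lebesgue_measure R) \x (@lebesgue_measure R))%E.
Notation mR := (measurableTypeR R).
Implicit Types (A K : set (mR * mR)).

Lemma measurable_affine1 (k m : R) :
  measurable_fun setT ((fun y => k * y + m) : mR -> mR).
Proof. by apply: measurable_funD => //; apply: measurable_funM. Qed.

(** As functions of [A] both sides are measures, and they agree on half-open intervals; uniqueness
    of Lebesgue measure concludes. *)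
Lemma lebesgue_affine_pos (k m : R) (A : set R) : 0 < k -> measurable (A : set mR) ->
  (k%:E * lam ((fun y : R => (k * y + m)%R) @^-1` A) = lam A)%E.
Proof.
move=> k0 mA; apply/esym.
have mf := measurable_affine1 k m.
pose nu := measure_function_pushforward__canonical__measure_function_Measure
  lam mf.
pose nu' := measure_function_mscale__canonical__measure_function_Measure
  (NngNum (ltW k0)) nu.
rewrite -[RHS]/(nu' A).
apply: lebesgue_measure_unique => // _ [[a b]] _ <-.
rewrite /nu' /= /mscale/= /pushforward.
have -> : (fun y : R => k * y + m) @^-1` `]a, b] = `](a - m) / k, (b - m) / k]%classic.
  apply/seteqP; split => y /=; rewrite !in_itv/= ltr_pdivrMr// ler_pdivlMr//;
    move=> /andP[? ?]; apply/andP; split; lra.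
rewrite !lebesgue_measure_itv/= !lte_fin ltr_pM2r ?invr_gt0// ltrD2r.
case: ifP => _; last by rewrite mule0.
rewrite -!EFinB -EFinM; congr EFin; field; lra.
Qed.

Lemma lebesgue_affine (k m : R) (A : set R) : k != 0 -> measurable (A : set mR) ->
  (`|k|%:E * lam ((fun y : R => (k * y + m)%R) @^-1` A) = lam A)%E.
Proof.
move=> kn0 mA; have [k0|k0] := ltP 0 k.
  by rewrite gtr0_norm//; exact: lebesgue_affine_pos.
have nk0 : 0 < - k by rewrite oppr_gt0 lt_neqAle kn0.
rewrite -(lebesgue_affine_pos m nk0 mA) ler0_norm//; congr (_ * _)%E.
rewrite -[RHS]lebesgue_measureN; last first.
  by rewrite -[X in measurable X]setTI; exact: measurable_affine1.
rewrite /pushforward; congr (lam _).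
by apply/seteqP; split => y /=; rewrite mulrNN.
Qed.

Definition aff (a b c d e f : R) (z : mR * mR) : mR * mR :=
  (a * z.1 + b * z.2 + e, c * z.1 + d * z.2 + f).

Lemma measurable_aff a b c d e f : measurable_fun setT (aff a b c d e f).
Proof.
apply: measurable_fun_pair => /=; apply: measurable_funD => //;
  apply: measurable_funD; apply: measurable_funM => //;
  (exact: measurable_fst || exact: measurable_snd).
Qed.

Lemma measurable_preaff a b c d e f A :
  measurable A -> measurable (aff a b c d e f @^-1` A).
Proof.
by move=> mA; rewrite -[X in measurable X]setTI; exact: measurable_aff.
Qed.

Lemma mu2_shear (k m n : R) A : k != 0 -> measurable A ->
  (`|k|%:E * mu2 (aff 1 0 m k 0 n @^-1` A) = mu2 A)%E.
Proof.
move=> k0 mA.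
have affE (x y : R) : aff 1 0 m k 0 n (x, y) = (x, k * y + (m * x + n)).
  by rewrite /aff/=; congr pair; ring.
rewrite /product_measure1 -ge0_integralZl//; last first.
  by apply: (measurable_fun_xsection lam); exact: measurable_preaff.
apply: eq_integral => x _ /=.
have mx : measurable (xsection A x : set mR) by exact: measurable_xsection.
rewrite -(lebesgue_affine (m * x + n) k0 mx).
congr (_ * lam _)%E.
by apply/seteqP; split => y; rewrite /xsection /= !inE/= affE.
Qed.

Let flip (z : mR * mR) : mR * mR := (z.2, z.1).

Let measurable_flip : measurable_fun setT flip.
Proof. by apply: measurable_fun_pair. Qed.

Let measurable_preflip A : measurable A -> measurable (flip @^-1` A).
Proof. by move=> mA; rewrite -[X in measurable X]setTI; exact: measurable_flip. Qed.

Let mu2_flip A : measurable A -> mu2 (flip @^-1` A) = mu2 A.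
Proof.
move=> mA; apply/esym.
pose nu := measure_function_pushforward__canonical__measure_function_Measure
  mu2 measurable_flip.
rewrite -[RHS]/(nu A); apply: product_measure_unique => // X Y mX mY.
rewrite /nu /= /pushforward.
rewrite [X in mu2 X](_ : _ = Y `*` X); first by rewrite product_measure1E// muleC.
by apply/seteqP; split => -[x y] [] /=.
Qed.

(** For [d != 0] the map factors as shear, flip, shear, flip, where the shears scale by [d] and by
    the determinant divided by [d]: a triangular factorization. If [d = 0], exchanging the columns
    leads back to this case. *)
Lemma mu2_aff a b c d e f A : a * d - b * c != 0 -> measurable A ->
  (`|a * d - b * c|%:E * mu2 (aff a b c d e f @^-1` A) = mu2 A)%E.
Proof.
wlog d0 : a b c d / d != 0.
  move=> H D0 mA; have [d0|] := eqVneq d 0; last by move=> /H; apply.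
  have c0 : c != 0 by apply: contra D0 => /eqP ->; rewrite d0 !mulr0 subrr.
  have D0' : b * c - a * d != 0 by rewrite -oppr_eq0 opprB.
  rewrite distrC -[RHS](H b a d c c0 D0' mA).
  rewrite -(@mu2_flip (aff a b c d e f @^-1` A)); last exact: measurable_preaff.
  congr (_ * mu2 _)%E.
  by apply/seteqP; split => -[x y]; rewrite /flip /aff/= (addrC (b * x)) (addrC (d * x)).
move=> D0 mA.
set k := (a * d - b * c) / d.
have k0 : k != 0 by rewrite mulf_neq0// invr_neq0.
have mfA := measurable_preflip mA.
rewrite -[RHS]mu2_flip// -(mu2_shear (b / d) (e - b * f / d) k0 mfA).
set B := aff 1 0 (b / d) k 0 (e - b * f / d) @^-1` (flip @^-1` A).
have mB : measurable B by exact: measurable_preaff.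
rewrite -[in RHS](@mu2_flip B)// -(@mu2_shear d c f (flip @^-1` B))//; last first.
  exact: measurable_preflip.
rewrite muleA -EFinM -normrM divfK//; congr (_ * mu2 _)%E.
have affE (x y : R) : flip (aff 1 0 (b / d) k 0 (e - b * f / d)
    (flip (aff 1 0 c d 0 f (x, y)))) = aff a b c d e f (x, y).
  by rewrite /flip /aff/= /k; congr pair; field.
by apply/seteqP; split => -[x y] /=; rewrite /B/= affE.
Qed.

End PlaneMeasure.

Lemma continuous_mkpair (T U V : topologicalType) (f : T -> U) (g : T -> V) :
  continuous f -> continuous g -> continuous (fun x => (f x, g x)).
Proof. by move=> cf cg x; apply: cvg_pair; [exact: cf|exact: cg]. Qed.

(** * Measurability and finite measure of compact plane sets *)

Section PlaneArea.
Variable R : realType.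
Notation mR := (measurableTypeR R).
Notation mu2 := ((@lebesgue_measure R) \x (@lebesgue_measure R))%E.
Implicit Types (A K : set (R * R)).

Definition pmeasurable A := measurable (A : set (mR * mR)).

(** Measurability refers to the product sigma-algebra, so the open set is written as a countable
    union of the rational boxes contained in it. *)
Lemma open_pmeasurable A : open A -> pmeasurable A.
Proof.
move=> oA.
pose box (a b c d : rat) : set (mR * mR) :=
  `]ratr a, ratr b[%classic `*` `]ratr c, ratr d[%classic.
pose F a b c d := [set z | box a b c d z /\ (box a b c d `<=` (A : set (mR * mR)))].
have -> : A = \bigcup_a \bigcup_b \bigcup_c \bigcup_d F a b c d.
  apply/seteqP; split => [[x y] Axy|z [a _ [b _ [c _ [d _ [bz sA]]]]]]; last exact: sA.
  have /nbhs_ballP[e /= e0 eA] : nbhs (x, y) A by exact: open_nbhs_nbhs.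
  have [a] : exists q : rat, ratr q \in `]x - e, x[ by apply: rat_in_itvoo; lra.
  have [b] : exists q : rat, ratr q \in `]x, x + e[ by apply: rat_in_itvoo; lra.
  have [c] : exists q : rat, ratr q \in `]y - e, y[ by apply: rat_in_itvoo; lra.
  have [d] : exists q : rat, ratr q \in `]y, y + e[ by apply: rat_in_itvoo; lra.
  rewrite !in_itv/= => /andP[d1 d2] /andP[c1 c2] /andP[b1 b2] /andP[a1 a2].
  exists a => //; exists b => //; exists c => //; exists d => //; split.
    by split => /=; rewrite in_itv/=; apply/andP; split.
  move=> [u v] [/=]; rewrite !in_itv/= => /andP[u1 u2] /andP[v1 v2].
  apply: eA; split; rewrite /ball/= ltr_norml; apply/andP; split; lra.
apply: bigcupT_measurable_rat => a; apply: bigcupT_measurable_rat => b.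
apply: bigcupT_measurable_rat => c; apply: bigcupT_measurable_rat => d.
rewrite /F; have [sA|nA] := pselect (box a b c d `<=` (A : set (mR * mR))).
  rewrite (_ : [set z | _] = box a b c d); first by apply: measurableX.
  by apply/seteqP; split => [z []|z].
by rewrite (_ : [set z | _] = set0)//; apply/seteqP; split => [z []|z].
Qed.

Lemma compact_pmeasurable A : compact A -> pmeasurable A.
Proof.
move=> cA; rewrite /pmeasurable -[X in measurable X]setCK; apply: measurableC.
apply: open_pmeasurable; apply: closed_openC; apply: compact_closed => //.
Qed.

Lemma compact_box A : compact A -> exists2 M : R, 0 < M &
  forall z, A z -> `|z.1| <= M /\ `|z.2| <= M.
Proof.
move=> cA.
have b1 : compact (fst @` A).
  by apply: continuous_compact => //; apply: continuous_subspaceT => z; exact: cvg_fst.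
have b2 : compact (snd @` A).
  by apply: continuous_compact => //; apply: continuous_subspaceT => z; exact: cvg_snd.
have [M1 [_ h1]] := compact_bounded b1; have [M2 [_ h2]] := compact_bounded b2.
exists (`|M1| + `|M2| + 1); first by rewrite ltr_wpDl// addr_ge0.
have := ler_norm M1; have := ler_norm M2; have := normr_ge0 M1; have := normr_ge0 M2.
move=> ? ? ? ? z Az; split; [apply: h1|apply: h2] => //; try lra; by exists z.
Qed.

Lemma compact_mu2_fin A : compact A -> mu2 A \is a fin_num.
Proof.
move=> cA; have [M M0 AM] := compact_box cA.
rewrite ge0_fin_numE//.
pose I : set mR := `[- M, M]%classic.
have LI : (lebesgue_measure I < +oo)%E.
  by rewrite /I lebesgue_measure_itv/= lte_fin gtrN// -EFinB ltry.
apply: (@le_lt_trans _ _ (mu2 (I `*` I))).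
  apply: le_measure; rewrite ?inE; first exact: compact_pmeasurable.
    by apply: measurableX; exact: measurable_itv.
  by move=> z /AM[]; rewrite !ler_norml => ? ?; split; rewrite /I set_itvcc.
have mI : measurable I by exact: measurable_itv.
by rewrite product_measure1E// lte_mul_pinfty// ge0_fin_numE.
Qed.

End PlaneArea.

(** * Areas of affine preimages and of triangles *)

Section PlaneTriangles.
Variable R : realType.
Notation mR := (measurableTypeR R).
Notation mu2 := ((@lebesgue_measure R) \x (@lebesgue_measure R))%E.
Implicit Types (A B K : set (R * R)) (a b c z : R * R).

(** [area] passes through [fine], which sends an infinite measure to 0; with finiteness recorded,
    [area] is monotone and additive. *)
Definition finarea A := pmeasurable A /\ mu2 A \is a fin_num.

Lemma compact_finarea A : compact A -> finarea A.
Proof. by move=> cA; split; [exact: compact_pmeasurable|exact: compact_mu2_fin]. Qed.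

Lemma finareaS A B : finarea B -> pmeasurable A -> A `<=` B -> finarea A.
Proof.
move=> [mB fB] mA sAB; split => //.
rewrite ge0_fin_numE//; apply: (@le_lt_trans _ _ (mu2 B)).
  by apply: le_measure; rewrite ?inE.
by rewrite -ge0_fin_numE.
Qed.

Lemma area_ge0 A : 0 <= area A.
Proof. exact: fine_ge0. Qed.

Lemma area_le A B : pmeasurable A -> finarea B -> A `<=` B -> area A <= area B.
Proof.
move=> mA fB sAB; have [_ fA] := finareaS fB mA sAB; case: fB => mB fB.
by apply: fine_le => //; apply: le_measure; rewrite ?inE.
Qed.

Lemma area_le2 A B K : pmeasurable A -> pmeasurable B -> finarea K ->
  A `<=` K -> B `<=` K -> (forall z, A z -> B z -> False) ->
  area A + area B <= area K.
Proof.
move=> mA mB fK sA sB dAB.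
have [_ fA] := finareaS fK mA sA; have [_ fB] := finareaS fK mB sB.
have mAB : pmeasurable (A `|` B) by apply: measurableU.
rewrite /area -fineD//; apply: fine_le; [by rewrite fin_numD fA|by case: fK|].
rewrite -measureU//.
  apply: le_measure; rewrite ?inE//; first by case: fK.
  by move=> z [/sA|/sB].
by apply/seteqP; split => z // [/dAB h /h].
Qed.

Lemma area_aff (p q r s e f : R) A : p * s - q * r != 0 -> finarea A ->
  finarea (aff p q r s e f @^-1` A) /\
  `|p * s - q * r| * area (aff p q r s e f @^-1` A) = area A.
Proof.
move=> D0 [mA fA].
have := mu2_aff e f D0 mA; set B := aff _ _ _ _ _ _ @^-1` A => E.
have mB : pmeasurable B by exact: measurable_preaff.
have nD : 0 < `|p * s - q * r| by rewrite normr_gt0.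
have fB : mu2 B \is a fin_num.
  rewrite ge0_fin_numE// ltey; apply: contraTN fA => /eqP BE.
  by rewrite -E [X in (_ * X)%E]BE mulry gtr0_sg// mul1e.
by split=> //; rewrite /area -E fineM.
Qed.

Lemma compact_preaff (p q r s e f : R) K : p * s - q * r != 0 -> compact K ->
  compact (aff p q r s e f @^-1` K).
Proof.
move=> D0 kK; pose D := p * s - q * r.
pose N (z : R * R) : R * R := ((s * z.1 - q * z.2 + (q * f - s * e)) / D,
  (- r * z.1 + p * z.2 + (r * e - p * f)) / D).
have cN : continuous N.
  rewrite /N; apply: continuous_mkpair => z; (apply: cvgM; last exact: cvg_cst);
    (apply: cvgD; last exact: cvg_cst).
    by apply: cvgB; apply: cvgM; (exact: cvg_cst || exact: cvg_fst || exact: cvg_snd).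
  by apply: cvgD; apply: cvgM; (exact: cvg_cst || exact: cvg_fst || exact: cvg_snd).
have := continuous_compact (continuous_subspaceT cN) kK; congr compact.
apply/seteqP; split => z.
  move=> [w Kw <-] /=; rewrite (_ : aff _ _ _ _ _ _ _ = w)//.
  by rewrite /aff/= [RHS]surjective_pairing; congr pair; rewrite /D; field.
move=> Kz; exists (aff p q r s e f z) => //.
by rewrite /N/= [RHS]surjective_pairing; congr pair; rewrite /D; field.
Qed.

Lemma convex_preaff (p q r s e f : R) K : convex2 K -> convex2 (aff p q r s e f @^-1` K).
Proof.
move=> cK z w Kz Kw t t0 tl; have := cK _ _ Kz Kw t t0 tl; rewrite /aff/=.
by congr K; congr pair; ring.
Qed.

Lemma open_halfplane (p q r : R) : open [set z : R * R | 0 < p * z.1 + q * z.2 + r].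
Proof.
apply: (@open_comp _ _ (fun z : R * R => p * z.1 + q * z.2 + r) [set x | 0 < x]).
  move=> z _; apply: cvgD; last exact: cvg_cst.
  apply: cvgD; apply: cvgM; try exact: cvg_cst.
    exact: cvg_fst.
  exact: cvg_snd.
exact: open_gt.
Qed.

(** Open, so that triangles with a common side are disjoint. *)
Definition std_tri : set (R * R) := [set z | [/\ 0 < z.1, 0 < z.2 & z.1 + z.2 < 1]].

Lemma std_tri_pmeasurable : pmeasurable std_tri.
Proof.
apply: open_pmeasurable.
have -> : std_tri = [set z | 0 < 1 * z.1 + 0 * z.2 + 0] `&`
    [set z | 0 < 0 * z.1 + 1 * z.2 + 0] `&` [set z | 0 < -1 * z.1 + -1 * z.2 + 1].
  by apply/seteqP; split => z; rewrite /std_tri/=;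
    [move=> [? ? ?]|move=> [[? ?] ?]]; repeat split; lra.
by apply: openI; [apply: openI; exact: open_halfplane|exact: open_halfplane].
Qed.

Lemma std_tri_finarea : finarea std_tri.
Proof.
have cB : compact ((`[0, 1]%classic : set R) `*` (`[0, 1]%classic : set R)).
  by apply: compact_setX; exact: segment_compact.
apply: (finareaS (compact_finarea cB)); first exact: std_tri_pmeasurable.
move=> z [z1 z2 z3]; split => /=; rewrite in_itv/=; apply/andP; split; lra.
Qed.

Lemma mu2_antidiagonal : mu2 [set z : mR * mR | z.1 + z.2 = 1] = 0%E.
Proof.
have E (x y : R) : (x + y = 1) = (y = 1 - x) by apply/propext; split; lra.
rewrite /product_measure1; apply: integral0_eq => x _ /=.
rewrite [X in lebesgue_measure X](_ : _ = [set (1 - x : R)]).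
  exact: lebesgue_measure_set1.
by apply/seteqP; split => y; rewrite /xsection/= !inE/= E.
Qed.

(* The open unit square is covered by two copies of the triangle and a null diagonal. *)
Lemma area_std_tri : 1 / 2 <= area std_tri.
Proof.
pose I : set mR := `]0, 1[%classic.
pose L := [set z : mR * mR | z.1 + z.2 = 1].
pose T' := aff (-1) 0 0 (-1) 1 1 @^-1` std_tri.
have D0 : -1 * -1 - 0 * 0 != 0 :> R by rewrite mulr0 subr0 mulrNN mulr1 oner_neq0.
have [[mT' fT'] aT'] := area_aff 1 1 D0 std_tri_finarea.
have [mT fT] := std_tri_finarea.
have {}aT' : area T' = area std_tri.
  by rewrite -aT' mulrNN mulr1 mulr0 subr0 normr1 mul1r.
have mI : measurable I by exact: measurable_itv.
have S1 : mu2 (I `*` I) = 1%E.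
  have LI : lebesgue_measure I = 1%E.
    by rewrite /I lebesgue_measure_itv/= lte01 sube0.
  transitivity (lebesgue_measure I * lebesgue_measure I)%E.
    exact: product_measure1E.
  by rewrite LI mule1.
have mL : measurable L.
  rewrite (_ : L = ~` ([set z | 0 < 1 * z.1 + 1 * z.2 + -1] `|`
                      [set z | 0 < -1 * z.1 + -1 * z.2 + 1])).
    by apply: measurableC; apply: measurableU; apply: open_pmeasurable;
       exact: open_halfplane.
  rewrite /L; clear; apply/seteqP; split => z /=; [move=> h [] ?|move=> /not_orP[]]; lra.
have : (mu2 (I `*` I) <= mu2 (std_tri `|` T' `|` L))%E.
  apply: le_measure; rewrite ?inE; first exact: measurableX.
    by apply: measurableU => //; exact: measurableU.
  move=> [x y] [/=]; rewrite /I/= !in_itv/= => /andP[x0 x1] /andP[y0 y1].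
  have [h|h|h] := ltgtP (x + y) 1; [left; left|left; right|by right].
    by [].
  by clear -x1 y1 h; rewrite /T'/aff/std_tri/=; split; lra.
have m2 := measurableU _ _ mT mT'.
have L0 : mu2 L = 0%E := mu2_antidiagonal.
have h2 : (mu2 (std_tri `|` T' `|` L) <= mu2 std_tri + mu2 T' + mu2 L)%E.
  apply: (le_trans (measureU2 _ m2 mL)); apply: leeD => //; exact: measureU2.
move=> /le_trans /(_ h2); rewrite S1 L0 adde0.
rewrite -(fineK fT) -(fineK fT') -EFinD lee_fin -/(area std_tri) -/(area T') aT'.
by move: (area std_tri) => a; clear; lra.
Qed.

Definition cross (u v : R * R) : R := u.1 * v.2 - u.2 * v.1.
Definition area2 a b c : R := (b.1 - a.1) * (c.2 - a.2) - (b.2 - a.2) * (c.1 - a.1).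

Definition tri a b c : set (R * R) := [set z | exists s t : R,
  [/\ 0 < s, 0 < t, s + t < 1 &
   z = ((1 - s - t) * a.1 + s * b.1 + t * c.1, (1 - s - t) * a.2 + s * b.2 + t * c.2)]].

Lemma tri_preimage a b c : area2 a b c != 0 ->
  aff (b.1 - a.1) (c.1 - a.1) (b.2 - a.2) (c.2 - a.2) a.1 a.2 @^-1` tri a b c = std_tri.
Proof.
move=> D0; apply/seteqP; split => -[x y]; rewrite /std_tri /aff/=; last first.
  by move=> [x0 y0 xy]; exists x, y; split => //; congr pair; ring.
move=> [s [t [s0 t0 st [E1 E2]]]].
have Ex : x = s.
  apply: (mulIf D0); rewrite /area2.
  transitivity (((b.1 - a.1) * x + (c.1 - a.1) * y + a.1) * (c.2 - a.2) - a.1 * (c.2 - a.2)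
   - (((b.2 - a.2) * x + (c.2 - a.2) * y + a.2) * (c.1 - a.1) - a.2 * (c.1 - a.1))).
    ring.
  rewrite E1 E2; ring.
have Ey : y = t.
  apply: (mulIf D0); rewrite /area2.
  transitivity ((b.1 - a.1) * (((b.2 - a.2) * x + (c.2 - a.2) * y + a.2) - a.2)
   - (b.2 - a.2) * (((b.1 - a.1) * x + (c.1 - a.1) * y + a.1) - a.1)).
    ring.
  rewrite E1 E2; ring.
by rewrite Ex Ey.
Qed.

(** [A1] is the inverse of the barycentric chart and pulls the standard triangle back to
    [tri a b c]. A lower bound is the right direction, because triangles are used to fill bodies
    from inside. *)
Lemma tri_finarea a b c : area2 a b c != 0 ->
  pmeasurable (tri a b c) /\ `|area2 a b c| / 2 <= area (tri a b c).
Proof.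
move=> D0.
pose D := area2 a b c.
pose A1 := aff ((c.2 - a.2) / D) (- (c.1 - a.1) / D) (- (b.2 - a.2) / D) ((b.1 - a.1) / D)
  ((- a.1 * (c.2 - a.2) + a.2 * (c.1 - a.1)) / D) ((a.1 * (b.2 - a.2) - a.2 * (b.1 - a.1)) / D).
have E : tri a b c = A1 @^-1` std_tri.
  rewrite -(tri_preimage D0); apply/seteqP; split => -[x y] /=.
    rewrite (_ : aff _ _ _ _ _ _ _ = (x, y))//.
    by rewrite /A1/aff/=; congr pair; move: D0; rewrite /D/area2 => D0; field.
  rewrite (_ : aff _ _ _ _ _ _ _ = (x, y))//.
  by rewrite /A1/aff/=; congr pair; move: D0; rewrite /D/area2 => D0; field.
have mT : pmeasurable (tri a b c).
  by rewrite E; apply: measurable_preaff; exact: std_tri_pmeasurable.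
have D1 : (c.2 - a.2) / D * ((b.1 - a.1) / D) - (- (c.1 - a.1) / D) * (- (b.2 - a.2) / D) = D^-1.
  by move: D0; rewrite /D/area2 => D0; field.
have D1n : (c.2 - a.2) / D * ((b.1 - a.1) / D) - (- (c.1 - a.1) / D) * (- (b.2 - a.2) / D) != 0.
  by rewrite D1 invr_neq0.
have [_] := area_aff ((- a.1 * (c.2 - a.2) + a.2 * (c.1 - a.1)) / D)
  ((a.1 * (b.2 - a.2) - a.2 * (b.1 - a.1)) / D) D1n std_tri_finarea.
rewrite -/A1 -E D1 normfV => aE; split => //.
have nD : 0 < `|D| by rewrite normr_gt0.
have := area_std_tri; rewrite -aE ler_pdivlMl// => h; rewrite -/D; lra.
Qed.

Lemma convex3 K a b c (r s t : R) : convex2 K -> K a -> K b -> K c ->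
  0 <= r -> 0 <= s -> 0 <= t -> r + s + t = 1 ->
  K (r * a.1 + s * b.1 + t * c.1, r * a.2 + s * b.2 + t * c.2).
Proof.
move=> cK Ka Kb Kc r0 s0 t0 rst.
have [t1|t1] := eqVneq t 1.
  have -> : r = 0 by lra. have -> : s = 0 by lra.
  by rewrite t1 !mul0r !add0r !mul1r -surjective_pairing.
have tl : 0 < 1 - t by rewrite subr_gt0 lt_neqAle t1/=; lra.
have Kab := cK _ _ Ka Kb (r / (1 - t)) (divr_ge0 r0 (ltW tl)).
have r1 : r / (1 - t) <= 1 by rewrite ler_pdivrMr// mul1r; lra.
have := cK _ _ (Kab r1) Kc (1 - t) (ltW tl).
have -> : 1 - t <= 1 by lra.
move=> /(_ isT) /=.
have sE : s = (1 - t) - r by lra.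
have tn : 1 - t != 0 by rewrite gt_eqF.
rewrite [X in K X -> _](_ : _ = (r * a.1 + s * b.1 + t * c.1, r * a.2 + s * b.2 + t * c.2))//.
by rewrite sE; congr pair; field.
Qed.

Lemma tri_sub K a b c : convex2 K -> K a -> K b -> K c -> tri a b c `<=` K.
Proof.
move=> cK Ka Kb Kc _ [s [t [s0 t0 st ->]]]; apply: convex3 => //; lra.
Qed.

End PlaneTriangles.

(** * Area bounds from inscribed polygons *)

Section Ladder.
Variable R : realType.
Local Notation pt := (R * R)%type.
Variables (K : set pt) (f1 f2 : R).
Hypotheses (cK : convex2 K) (fK : finarea K) (f0 : (f1 != 0) || (f2 != 0)).
Implicit Types (p q r z : pt) (s : seq pt) (c : R).

Let f z := f1 * z.1 + f2 * z.2.

Let pmeasurable_slab c : pmeasurable [set z | c < f z].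
Proof.
apply: open_pmeasurable.
rewrite (_ : [set z | _] = [set z | 0 < f1 * z.1 + f2 * z.2 + - c]).
  exact: open_halfplane.
by apply/seteqP; split=> z; rewrite /f/=; lra.
Qed.

Let pmeasurable_slab' c : pmeasurable [set z | f z < c].
Proof.
apply: open_pmeasurable.
rewrite (_ : [set z | _] = [set z | 0 < - f1 * z.1 + - f2 * z.2 + c]).
  exact: open_halfplane.
by apply/seteqP; split=> z; rewrite /f/=; lra.
Qed.

Let level_cross p q r z : f p = f q -> f r = f z ->
  (q.1 - p.1) * (z.2 - r.2) = (q.2 - p.2) * (z.1 - r.1).
Proof.
rewrite /f => e1 e2; apply/eqP; rewrite -subr_eq0.
set C := (X in X == 0).
have C1 : f1 * C = 0.
  have h1 : f1 * (q.1 - p.1) = - f2 * (q.2 - p.2) by lra.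
  have h2 : f1 * (z.1 - r.1) = - f2 * (z.2 - r.2) by lra.
  transitivity (f1 * (q.1 - p.1) * (z.2 - r.2) - (q.2 - p.2) * (f1 * (z.1 - r.1))).
    by rewrite /C; ring.
  rewrite h1 h2; ring.
have C2 : f2 * C = 0.
  have h1 : f2 * (q.2 - p.2) = - f1 * (q.1 - p.1) by lra.
  have h2 : f2 * (z.2 - r.2) = - f1 * (z.1 - r.1) by lra.
  transitivity ((q.1 - p.1) * (f2 * (z.2 - r.2)) - (f2 * (q.2 - p.2)) * (z.1 - r.1)).
    by rewrite /C; ring.
  rewrite h1 h2; ring.
by case/orP: f0 => /mulfI h; apply/eqP/h; rewrite mulr0.
Qed.

Let area2_level p q r z : f p = f q -> f r = f z -> area2 p q r = area2 p q z.
Proof.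
move=> e1 e2; have := level_cross e1 e2; rewrite /area2 => h; apply/eqP.
rewrite -subr_eq0; apply/eqP.
transitivity ((q.2 - p.2) * (z.1 - r.1) - (q.1 - p.1) * (z.2 - r.2)); first ring.
by rewrite h subrr.
Qed.

(** The strict inequalities keep a slab disjoint from the part of [K] above it. *)
Let U c : set pt := K `&` [set z | c < f z].
Let S c c' : set pt := K `&` [set z | c < f z] `&` [set z | f z < c'].

Let mU c : pmeasurable (U c).
Proof. by apply: measurableI; [case: fK|exact: pmeasurable_slab]. Qed.

Let mS c c' : pmeasurable (S c c').
Proof. by apply: measurableI; [exact: mU|exact: pmeasurable_slab']. Qed.

Let fU c : finarea (U c).
Proof. by apply: finareaS fK _ _ => // z []. Qed.

Let fS c c' : finarea (S c c').
Proof. by apply: finareaS fK _ _ => // z [[]]. Qed.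

Let tri_S p q r c c' : c < c' -> K p -> K q -> K r ->
  (f p = c \/ f p = c') -> (f q = c \/ f q = c') -> (f r = c \/ f r = c') ->
  area2 p q r != 0 -> tri p q r `<=` S c c'.
Proof.
move=> cc' Kp Kq Kr hp hq hr A0 z tz; split; first split.
- exact: tri_sub tz.
- have np : ~ (f p = f q /\ f q = f r).
    move=> [e1 e2]; move/eqP: A0; apply; rewrite (area2_level e1 (esym e2)) /area2; ring.
  case: tz => s [t [s0 t0 st ->]] /=.
  have -> : f ((1 - s - t) * p.1 + s * q.1 + t * r.1, (1 - s - t) * p.2 + s * q.2 + t * r.2)
    = (1 - s - t) * f p + s * f q + t * f r by rewrite /f/=; ring.
  have r0 : 0 < 1 - s - t by lra.
  have d0 : 0 < c' - c by lra.
  have := mulr_gt0 s0 d0; have := mulr_gt0 t0 d0; have := mulr_gt0 r0 d0.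
  case: hp np => ->; case: hq => ->; case: hr => -> np; try nra; by case: np.
- have np : ~ (f p = f q /\ f q = f r).
    move=> [e1 e2]; move/eqP: A0; apply; rewrite (area2_level e1 (esym e2)) /area2; ring.
  case: tz => s [t [s0 t0 st ->]] /=.
  have -> : f ((1 - s - t) * p.1 + s * q.1 + t * r.1, (1 - s - t) * p.2 + s * q.2 + t * r.2)
    = (1 - s - t) * f p + s * f q + t * f r by rewrite /f/=; ring.
  have r0 : 0 < 1 - s - t by lra.
  have d0 : 0 < c' - c by lra.
  have := mulr_gt0 s0 d0; have := mulr_gt0 t0 d0; have := mulr_gt0 r0 d0.
  case: hp np => ->; case: hq => ->; case: hr => -> np; try nra; by case: np.
Qed.

Let tri_S_area p q r c c' : c < c' -> K p -> K q -> K r ->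
  (f p = c \/ f p = c') -> (f q = c \/ f q = c') -> (f r = c \/ f r = c') ->
  area2 p q r <= 2 * area (S c c').
Proof.
move=> cc' Kp Kq Kr hp hq hr.
have [->|A0] := eqVneq (area2 p q r) 0; first by rewrite mulr_ge0// area_ge0.
have [mT aT] := tri_finarea A0.
have := area_le mT (fS c c') (tri_S cc' Kp Kq Kr hp hq hr A0).
have := ler_norm (area2 p q r); lra.
Qed.

(** The two triangles are the halves of a trapezoid with parallel sides on two levels. If both are
    positively oriented, they lie on different sides of the diagonal; otherwise one term alone
    bounds the sum, so crossing chains are covered too. *)
Let slab p q p' q' c c' : c < c' -> K p -> K q -> K p' -> K q' ->
  f p = c -> f q = c -> f p' = c' -> f q' = c' ->
  area2 p q q' + area2 p q' p' <= 2 * area (S c c').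
Proof.
move=> cc' Kp Kq Kp' Kq' fp fq fp' fq'.
have h1 : area2 p q q' <= 2 * area (S c c') by apply: tri_S_area => //; auto.
have h2 : area2 p q' p' <= 2 * area (S c c') by apply: tri_S_area => //; auto.
have [A0|A0] := leP (area2 p q q') 0; first lra.
have [B0|B0] := leP (area2 p q' p') 0; first lra.
have An : area2 p q q' != 0 by rewrite gt_eqF.
have Bn : area2 p q' p' != 0 by rewrite gt_eqF.
have [mT aT] := tri_finarea An; have [mT' aT'] := tri_finarea Bn.
have sT : tri p q q' `<=` S c c' by apply: tri_S => //; auto.
have sT' : tri p q' p' `<=` S c c' by apply: tri_S => //; auto.
have := area_le2 mT mT' (fS c c') sT sT'.
rewrite (gtr0_norm A0) in aT; rewrite (gtr0_norm B0) in aT'.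
have dT z : tri p q q' z -> tri p q' p' z -> False.
  move=> [s [t [s0 t0 st ez]]] [s' [t' [s0' t0' st' ez']]].
  have E1 : area2 p q' z = - s * area2 p q q' by rewrite ez /area2/=; ring.
  have E2 : area2 p q' z = t' * area2 p q' p' by rewrite ez' /area2/=; ring.
  by have := mulr_gt0 s0 A0; have := mulr_gt0 t0' B0; lra.
move=> /(_ dT); move: aT aT'; move: (area _) (area (tri _ _ _)) (area _) => a b d; lra.
Qed.

(** The contribution of one chain of edges to the shoelace formula. *)
Fixpoint chain p s : R := if s is r :: s' then cross p r + chain r s' else 0.

Let lef := [rel p q | f p <= f q].

Let path_last p s : path lef p s -> f p <= f (last p s).
Proof.
elim: s p => //= r s IH p /andP[h] /IH; exact: le_trans.
Qed.

Let all_in s := forall z, z \in s -> K z.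

Let quad_step p q p' q' : K p -> K q -> K p' -> K q' -> f p = f q -> f p' = f q' ->
  f p <= f p' ->
  area2 p q q' + area2 p q' p' + 2 * area (U (f p')) <= 2 * area (U (f p)).
Proof.
move=> Kp Kq Kp' Kq' e e'; rewrite le_eqVlt => /orP[/eqP ep|lp].
  have A1 : area2 p q q' = 0.
    by rewrite (@area2_level p q q' p)// -?e' ?ep// /area2; ring.
  have A2 : area2 p q' p' = 0.
    by rewrite (@area2_level p q' p' p)// -?e' ?ep// /area2; ring.
  by rewrite A1 A2 !add0r ep.
have h1 := slab lp Kp Kq Kp' Kq' erefl (esym e) erefl (esym e').
suff : area (S (f p) (f p')) + area (U (f p')) <= area (U (f p)).
  by move: h1; move: (area _) (area _) (area _) => a b d; lra.
apply: area_le2; [exact: mS|exact: mU|exact: fU| | |].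
- by move=> z [].
- by move=> z [Kz h]; split => //; exact: lt_trans lp _.
- by move=> z [_ /= h] [_ /= h']; move: (lt_trans h h'); rewrite ltxx.
Qed.

Let seg_level p l c : K p -> K l -> f p <= c -> c <= f l ->
  exists z, [/\ K z, f z = c & cross p z + cross z l = cross p l].
Proof.
move=> Kp Kl h1 h2; have [e|e] := eqVneq (f p) (f l).
  by exists p; split => //; [lra|rewrite /cross; ring].
have d0 : 0 < f l - f p by rewrite subr_gt0 lt_neqAle e/=; lra.
pose s := (c - f p) / (f l - f p).
have s0 : 0 <= s by rewrite /s divr_ge0//; lra.
have s1 : s <= 1 by rewrite /s ler_pdivrMr//; lra.
have es : s * (f l - f p) = c - f p by rewrite /s divfK// gt_eqF.
exists (s * l.1 + (1 - s) * p.1, s * l.2 + (1 - s) * p.2); split.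
- exact: cK.
- transitivity (f p + s * (f l - f p)); first by rewrite /f/=; ring.
  by rewrite es; lra.
- by rewrite /cross/=; ring.
Qed.

(** The lower of the two next vertices determines the next rung: the edge of the other chain is cut
    at that level, which leaves the shoelace sum unchanged, and the trapezoid in between is paid for
    by a slab of [K]. Once one chain is exhausted, the rest of the other stays on one level. *)
Let ladder_ind n p q L Rr : (size L + size Rr <= n)%N ->
  K p -> K q -> all_in L -> all_in Rr -> f p = f q ->
  path lef p L -> path lef q Rr -> last p L = last q Rr ->
  cross p q + chain q Rr - chain p L <= 2 * area (U (f p)).
Proof.
elim: n p q L Rr => [|n IH] p q L Rr sz Kp Kq KL KR fpq pL pR lE.
  move: sz lE; rewrite leqn0 addn_eq0 => /andP[/nilP -> /nilP ->] /= ->.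
  by rewrite /cross mulrC subrr subr0 addr0 mulr_ge0// area_ge0.
case: Rr KR pR lE sz => [|r Rr] KR pR lE sz; case: L KL pL lE sz => [|l L] KL pL lE sz.
- move: lE => /= ->.
  by rewrite /cross mulrC subrr subr0 addr0 mulr_ge0// area_ge0.
- have Kl : K l by apply: KL; rewrite mem_head.
  have KL' : all_in L by move=> z zL; apply: KL; rewrite inE zL orbT.
  move: pL => /= /andP[pl pL].
  have fl : f l = f p.
    by apply/eqP; rewrite eq_le pl andbT fpq -[q]lE; exact: path_last.
  have := IH l q L [::] sz Kl Kq KL' KR (etrans fl fpq) pL pR lE.
  have := quad_step Kp Kq Kl Kq fpq (etrans fl fpq) pl.
  by rewrite /= /cross /area2; lra.
- have Kr : K r by apply: KR; rewrite mem_head.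
  have KR' : all_in Rr by move=> z zL; apply: KR; rewrite inE zL orbT.
  move: pR => /= /andP[qr pR].
  have fr : f r = f q.
    by apply/eqP; rewrite eq_le qr andbT -fpq [X in _ <= f X]lE; exact: path_last.
  have := IH p r [::] Rr sz Kp Kr KL KR' (etrans fpq (esym fr)) pL pR lE.
  have := quad_step Kp Kq Kp Kr fpq (etrans fpq (esym fr)) (lexx _).
  by rewrite /= /cross /area2; lra.
have Kl : K l by apply: KL; rewrite mem_head.
have KL' : all_in L by move=> z zL; apply: KL; rewrite inE zL orbT.
have Kr : K r by apply: KR; rewrite mem_head.
have KR' : all_in Rr by move=> z zL; apply: KR; rewrite inE zL orbT.
move: pL pR => /= /andP[pl pL] /andP[qr pR]; rewrite /= in lE.
have [rl|lr] := leP (f r) (f l).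
  have [p' [Kp' fp' cp']] : exists z, [/\ K z, f z = f r & cross p z + cross z l = cross p l].
    by apply: seg_level => //; rewrite fpq.
  have KL2 : all_in (l :: L) by [].
  have pL2 : path lef p' (l :: L) by rewrite /= fp' rl.
  have sz2 : (size (l :: L) + size Rr <= n)%N by move: sz; rewrite /= addnS ltnS.
  have := IH p' r (l :: L) Rr sz2 Kp' Kr KL2 KR' fp' pL2 pR lE.
  have := quad_step Kp Kq Kp' Kr fpq fp' _; rewrite fp' => /(_ _).
  rewrite {1}fpq => /(_ qr) /=.
  move: cp'; rewrite /cross /area2; lra.
have [q' [Kq' fq' cq']] : exists z, [/\ K z, f z = f l & cross q z + cross z r = cross q r].
  by apply: seg_level => //; [rewrite -fpq|exact: ltW].
have KR2 : all_in (r :: Rr) by [].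
have pR2 : path lef q' (r :: Rr) by rewrite /= fq' (ltW lr).
have sz2 : (size L + size (r :: Rr) <= n)%N by move: sz; rewrite /= addSn ltnS.
have := IH l q' L (r :: Rr) sz2 Kl Kq' KL' KR2 (esym fq') pL pR2 lE.
have := quad_step Kp Kq Kl Kq' fpq (esym fq') pl => /=.
move: cq'; rewrite /cross /area2; lra.
Qed.

(* A closed polygon whose [f]-levels go up once and down once, given as two
   [f]-monotone chains with common endpoints. *)
Lemma unimodal_shoelace_le b L Rr : K b ->
  (forall z, z \in L -> K z) -> (forall z, z \in Rr -> K z) ->
  path lef b L -> path lef b Rr -> last b L = last b Rr ->
  chain b Rr - chain b L <= 2 * area K.
Proof.
move=> Kb KL KR pL pR lE.
have := ladder_ind (leqnn _) Kb Kb KL KR erefl pL pR lE.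
have -> : cross b b = 0 by rewrite /cross; ring.
have : area (U (f b)) <= area K by apply: area_le => // z [].
by lra.
Qed.

End Ladder.

(** * Packings by triangles and mixed areas *)

Section Packing.
Variable R : realType.
Local Notation pt := (R * R)%type.
Implicit Types (K : set pt) (p q z : pt).

Lemma area_packing K n (F : nat -> set pt) : finarea K ->
  (forall i, (i < n)%N -> pmeasurable (F i) /\ F i `<=` K) ->
  (forall i j, (i < j < n)%N -> forall z, F i z -> F j z -> False) ->
  \sum_(i < n) area (F i) <= area K.
Proof.
move=> fK FP dF.
suff [] : let V := [set z | exists2 i, (i < n)%N & F i z] in
    pmeasurable V /\ \sum_(i < n) area (F i) <= area V.
  set V := (X in pmeasurable X) => mV /le_trans; apply; apply: area_le => //.
  by move=> z [i /FP[_]]; exact.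
elim: n FP dF => [|n IH] FP dF /=.
  split; last by rewrite big_ord0 area_ge0.
  rewrite (_ : [set z | _] = set0); first exact: measurable0.
  by apply/seteqP; split => // z [].
have [||mV aV] := IH; first by move=> i /ltnW; exact: FP.
  by move=> i j /andP[ij jn]; apply: dF; rewrite ij ltnW.
have [mF sF] := FP n (ltnSn n).
set V := (X in pmeasurable X) in mV; rewrite -/V in aV.
pose W : set pt := [set z | exists2 i, (i < n.+1)%N & F i z].
have WE : W = V `|` F n.
  apply/seteqP; split=> z /=.
    move=> [i]; rewrite ltnS leq_eqVlt => /predU1P[->|il Fi]; [by right|by left; exists i].
  by case=> [[i il Fi]|Fn]; [exists i => //; exact: ltnW|exists n].
have mW : pmeasurable (V `|` F n) by exact: measurableU.
change (pmeasurable W /\ \sum_(i < n.+1) area (F i) <= area W); rewrite WE.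
split => //; rewrite big_ord_recr/=.
apply: (@le_trans _ _ (area V + area (F n))); first by rewrite lerD2r.
have fVF : finarea (V `|` F n).
  apply: (finareaS fK mW) => z [[i il]|]; last exact: sF.
  by have [_ sFi] := FP i (ltnW il); exact: sFi.
apply: (area_le2 mV mF fVF).
- by move=> z ?; left.
- by move=> z ?; right.
- by move=> z [i il Fi] Fn; apply: (dF i n _ z Fi Fn); rewrite il ltnSn.
Qed.

Lemma tri_packing K n (a b c : nat -> pt) : convex2 K -> finarea K ->
  (forall i, (i < n)%N -> [/\ K (a i), K (b i), K (c i) & 0 <= area2 (a i) (b i) (c i)]) ->
  (forall i j, (i < j < n)%N -> 0 < area2 (a i) (b i) (c i) ->
     0 < area2 (a j) (b j) (c j) ->
     forall z, tri (a i) (b i) (c i) z -> tri (a j) (b j) (c j) z -> False) ->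
  \sum_(i < n) area2 (a i) (b i) (c i) <= 2 * area K.
Proof.
move=> cK fK abcK dT.
(* Degenerate triangles carry no area and no disjointness hypothesis; they are replaced by the empty
   set. *)
pose F i : set pt := if area2 (a i) (b i) (c i) == 0 then set0 else tri (a i) (b i) (c i).
have m0 : pmeasurable (set0 : set pt) by exact: measurable0.
have FK : \sum_(i < n) area (F i) <= area K.
  apply: area_packing => // [i il|i j ijn z].
    have [Ka Kb Kc A0] := abcK i il; rewrite /F; case: ifPn => [_|An]; first by split.
    have [mT _] := tri_finarea An; split => //; exact: tri_sub.
  have jn : (j < n)%N by case/andP: ijn.
  have il : (i < n)%N by case/andP: ijn => ij _; exact: ltn_trans ij jn.
  have [_ _ _ Ai] := abcK i il; have [_ _ _ Aj] := abcK j jn.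
  rewrite /F; case: ifPn => // hi; case: ifPn => // hj.
  by apply: dT => //; rewrite lt_neqAle eq_sym ?hi ?hj.
apply: (@le_trans _ _ (2 * \sum_(i < n) area (F i))); last by rewrite ler_pM2l.
rewrite mulr_sumr; apply: ler_sum => -[i il] _ /=.
have [_ _ _ Ai] := abcK i il; rewrite /F; case: ifPn => [/eqP ->|An].
  by rewrite mulr_ge0// area_ge0.
have [_] := tri_finarea An; rewrite ger0_norm//; lra.
Qed.

Lemma compact_linear_max K (p q : R) : compact K -> K !=set0 ->
  exists2 m, K m & forall z, K z -> p * z.1 + q * z.2 <= p * m.1 + q * m.2.
Proof.
move=> cK K0.
have cf : {within K, continuous (fun z : pt => p * z.1 + q * z.2)}.
  apply: continuous_subspaceT => z.
  apply: cvgD; apply: cvgM; try exact: cvg_cst.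
    exact: cvg_fst.
  exact: cvg_snd.
have [m Km hm] := compact_EVT_max K0 cK cf.
by exists m; rewrite inE in Km => // z Kz; apply: hm; rewrite inE.
Qed.

(* Monotonicity of mixed areas, [V(abc, K) <= V(K, K)].  The triangles erected
   over the sides with apex at a farthest point of [K] do not overlap: the
   barycentric weight of the apex would have to increase strictly in both
   directions. *)
Lemma triangle_mixed_area_le K a b c x y z : compact K -> convex2 K ->
  K a -> K b -> K c -> K x -> K y -> K z -> 0 < area2 a b c ->
  area2 a b c - area2 a b z - area2 b c x - area2 c a y <= 2 * area K.
Proof.
move=> kK cK Ka Kb Kc Kx Ky Kz D0.
have K0 : K !=set0 by exists a.
have far u v w : K w -> K u -> exists2 m, K m & (forall t, K t -> area2 u v m <= area2 u v t).
  move=> Kw Ku.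
  have [m Km hm] := compact_linear_max (v.2 - u.2) (- (v.1 - u.1)) kK K0.
  by exists m => // t /hm; rewrite /area2; lra.
have [Z KZ hZ] := far a b z Kz Ka; have [X KX hX] := far b c x Kx Kb.
have [Y KY hY] := far c a y Ky Kc.
(* Moving the apexes to farthest points only increases the left-hand side, and it is what makes the
   triangles disjoint. *)
suff : area2 a b c - area2 a b Z - area2 b c X - area2 c a Y <= 2 * area K.
  by have := hZ _ Kz; have := hX _ Kx; have := hY _ Ky; lra.
pose A i : pt := match i with 0 => a | 1 => b | 2 => c | _ => a end.
pose B i : pt := match i with 0 => b | 1 => a | 2 => b | _ => c end.
pose C i : pt := match i with 0 => c | 1 => Z | 2 => X | _ => Y end.
have := @tri_packing K 4 A B C cK (compact_finarea kK).
have aZ : area2 a b Z <= 0 by have := hZ _ Ka; rewrite /area2; lra.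
have bX : area2 b c X <= 0 by have := hX _ Kb; rewrite /area2; lra.
have cY : area2 c a Y <= 0 by have := hY _ Kc; rewrite /area2; lra.
rewrite !big_ord_recr big_ord0 /=.
have e1 : area2 b a Z = - area2 a b Z by rewrite /area2; ring.
have e2 : area2 c b X = - area2 b c X by rewrite /area2; ring.
have e3 : area2 a c Y = - area2 c a Y by rewrite /area2; ring.
rewrite e1 e2 e3 => H.
suff : 0 + area2 a b c + - area2 a b Z + - area2 b c X + - area2 c a Y <= 2 * area K by lra.
have inner (u v w t : pt) : tri u v w t -> 0 < area2 u v w ->
    [/\ 0 < area2 u v t, 0 < area2 v w t & 0 < area2 w u t].
  move=> [s [r [s0 r0 sr ->]]] P0.
  have k0 : 0 < 1 - s - r by lra.
  rewrite (_ : area2 u v _ = r * area2 u v w); last by rewrite /area2/=; ring.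
  rewrite (_ : area2 v w _ = (1 - s - r) * area2 u v w); last by rewrite /area2/=; ring.
  rewrite (_ : area2 w u _ = s * area2 u v w); last by rewrite /area2/=; ring.
  by split; apply: mulr_gt0.
have outer (u v w t : pt) : tri v u w t -> 0 < area2 v u w -> area2 u v t < 0.
  by move=> /inner h /h[h1 _ _]; move: h1; rewrite /area2; lra.
have key u v w P Q t : area2 u v w = area2 a b c ->
    (forall t, K t -> area2 u v P <= area2 u v t) ->
    (forall t, K t -> area2 v w Q <= area2 v w t) -> K P -> K Q ->
    area2 u v P < 0 -> area2 v w Q < 0 ->
    tri v u P t -> tri w v Q t -> False.
  move=> E hP hQ KP KQ P0 Q0 [s [r [s0 r0 sr et]]] [s' [r' [s0' r0' sr' et']]].
  have k0 : 0 < 1 - s - r by lra.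
  have k0' : 0 < 1 - s' - r' by lra.
  have a1 : area2 u v t = r * area2 u v P by rewrite et /area2/=; ring.
  have a2 : area2 u v t = (1 - s' - r') * area2 u v w + r' * area2 u v Q.
    by rewrite et' /area2/=; ring.
  have a3 : area2 v w t = r' * area2 v w Q by rewrite et' /area2/=; ring.
  have a4 : area2 v w t = s * area2 u v w + r * area2 v w P.
    by rewrite et /area2/=; ring.
  have i1 := mulr_gt0 k0' D0; have i2 := mulr_gt0 s0 D0; rewrite E in a2 a4.
  have i3 : 0 <= r' * (area2 u v Q - area2 u v P).
    by apply: mulr_ge0; [exact: ltW|rewrite subr_ge0; exact: hP].
  have i4 : 0 <= r * (area2 v w P - area2 v w Q).
    by apply: mulr_ge0; [exact: ltW|rewrite subr_ge0; exact: hQ].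
  have [rr|rr] := leP r r'.
    have : 0 <= (r' - r) * - area2 v w Q by apply: mulr_ge0; lra.
    by lra.
  have : 0 <= (r - r') * - area2 u v P by apply: mulr_ge0; lra.
  by lra.
apply: H.
  by case=> [|[|[|[|i]]]] // _; split => //=; rewrite ?e1 ?e2 ?e3; lra.
have E2 : area2 b c a = area2 a b c by rewrite /area2; ring.
have E3 : area2 c a b = area2 a b c by rewrite /area2; ring.
case=> [|[|[|[|i]]]] [|[|[|[|j]]]] //=; rewrite ?andbF// => _ Ai Aj t ti tj.
- have [h _ _] := inner _ _ _ _ ti Ai; have := outer _ _ _ _ tj Aj; lra.
- have [_ h _] := inner _ _ _ _ ti Ai; have := outer _ _ _ _ tj Aj; lra.
- have [_ _ h] := inner _ _ _ _ ti Ai; have := outer _ _ _ _ tj Aj; lra.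
- by apply: (@key a b c Z X t) => //; lra.
- by apply: (@key c a b Y Z t) => //; lra.
- by apply: (@key b c a X Y t) => //; lra.
Qed.

End Packing.

(** * Two pairs of opposite triangles *)

Section SymmetricFans.
Variable R : realType.
Local Notation pt := (R * R)%type.
Implicit Types (p q u v w z : pt).

Definition opp2 z : pt := (- z.1, - z.2).

Lemma crossC u v : cross u v = - cross v u.
Proof. by rewrite /cross; ring. Qed.

Lemma cross_oppl u v : cross (opp2 u) v = - cross u v.
Proof. by rewrite /cross /=; ring. Qed.

Lemma cross_oppr u v : cross u (opp2 v) = - cross u v.
Proof. by rewrite /cross /=; ring. Qed.

Lemma tri_originP p q z : tri (0, 0) p q z -> exists s t : R,
  [/\ 0 < s, 0 < t & forall w, cross w z = s * cross w p + t * cross w q].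
Proof.
move=> [s [t [s0 t0 _ ->]]]; exists s, t; split => // w.
by rewrite /cross/=; ring.
Qed.

Definition symmetric2 (K : set pt) := forall z, K z -> K (opp2 z).

Variables (K : set pt).
Hypotheses (cK : convex2 K) (fK : finarea K) (sK : symmetric2 K) (K0 : K !=set0).

Let K00 : K (0, 0).
Proof.
case: K0 => z Kz; have := cK Kz (sK Kz) (_ : 0 <= 1 / 2) (_ : 1 / 2 <= 1).
rewrite [X in K X](_ : _ = (0, 0)); first by apply; lra.
by rewrite /=; congr pair; lra.
Qed.

(** The triangles spanned by the origin and two successive vectors, together with their negatives,
    fill a centrally symmetric polygon; hence the sum bounds the area and not its double. Any two
    triangles of the fan are separated by the line through some [u k]. *)
Lemma symmetric_fan_le (n : nat) (u : nat -> pt) :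
  (forall i, (i < n)%N -> K (u i)) -> u n = opp2 (u 0%N) ->
  (forall i j, (i <= j <= n)%N -> 0 <= cross (u i) (u j)) ->
  (forall i, (i < n)%N -> 0 < cross (u i) (u i.+1)) ->
  \sum_(i < n) cross (u i) (u i.+1) <= area K.
Proof.
move=> Ku un u0 u1.
have KSu i : (i < n)%N -> K (u i.+1).
  move=> il; have [e|ne] := eqVneq i.+1 n; last by apply: Ku; rewrite ltn_neqAle ne.
  by rewrite e un; apply/sK/Ku; case: n il {Ku un u0 u1 e}.
pose A (i : nat) : pt := (0, 0).
pose B i := if (i < n)%N then u i else opp2 (u (i - n)%N).
pose C i := if (i < n)%N then u i.+1 else opp2 (u (i - n).+1).
have a2 (p q : pt) : area2 (0, 0) p q = cross p q by rewrite /area2 /cross/=; ring.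
have cO (p q : pt) : cross (opp2 p) (opp2 q) = cross p q by rewrite cross_oppl cross_oppr opprK.
have abc i : (i < n + n)%N ->
    [/\ K (A i), K (B i), K (C i) & 0 < area2 (A i) (B i) (C i)].
  rewrite /A /B /C => il; have [i_n|n_i] := ltnP i n.
    by split=> //; [exact: Ku|exact: KSu|rewrite a2; exact: u1].
  have li : (i - n < n)%N by rewrite ltn_subLR.
  by split=> //; [exact/sK/Ku|exact/sK/KSu|rewrite a2 cO; exact: u1].
have := @tri_packing R K (n + n) A B C cK fK.
have -> : \sum_(i < n + n) area2 (A i) (B i) (C i) =
    2 * \sum_(i < n) cross (u i) (u i.+1).
  rewrite big_split_ord/= (_ : 2 = 1 + 1)// mulrDl !mul1r.
  congr (_ + _); apply: eq_bigr => i _; rewrite /A /B /C a2.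
    by rewrite ltn_ord.
  by rewrite ltnNge leq_addr/= addKn cO.
rewrite ler_pM2l//; apply.
  by move=> i /abc[? ? ? /ltW].
move=> i j /andP[ij jn] _ _ z.
have inn k (p q : pt) (s t : R) : 0 < s -> 0 < t -> 0 <= cross (u k) p -> 0 <= cross (u k) q ->
    0 <= s * cross (u k) p + t * cross (u k) q.
  by move=> s0 t0 h h'; rewrite addr_ge0// mulr_ge0// ltW.
have cc (p : pt) : cross p p = 0 by rewrite /cross; ring.
rewrite /A /B /C => /tri_originP[s [t [s0 t0 ez]]] /tri_originP[s' [t' [s0' t0' ez']]].
have [j_n|n_j] := ltnP j n.
  have i_n := ltn_trans ij j_n; rewrite i_n /= in ez; rewrite j_n /= in ez'.
  have e1 : cross (u i.+1) z = - s * cross (u i) (u i.+1).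
    by rewrite ez cc (crossC (u i.+1)); ring.
  have e2 : 0 <= cross (u i.+1) z.
    by rewrite ez'; apply: inn => //; apply: u0; [rewrite ij ltnW|rewrite j_n ltnW].
  by have := mulr_gt0 s0 (u1 _ i_n); lra.
have lj : (j - n < n)%N by rewrite ltn_subLR.
rewrite ltnNge n_j/= in ez'.
have [i_n|n_i] := ltnP i n.
  rewrite i_n /= in ez.
  have [le_ij|lt_ji] := leqP i (j - n).
    have e1 : cross (u i) z = t * cross (u i) (u i.+1) by rewrite ez cc; ring.
    have e2 : 0 <= - cross (u i) z.
      rewrite ez' !cross_oppr !mulrN -opprD opprK; apply: inn => //; apply: u0.
        by rewrite le_ij ltnW.
      by rewrite (leq_trans le_ij).
    by have := mulr_gt0 t0 (u1 _ i_n); lra.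
  have e1 : cross (u (j - n)%N) z = - (t' * cross (u (j - n)%N) (u (j - n).+1)).
    by rewrite ez' !cross_oppr cc; ring.
  have e2 : 0 <= cross (u (j - n)%N) z.
    rewrite ez; apply: inn => //; apply: u0; first by rewrite (ltnW lt_ji) ltnW.
    by rewrite i_n andbT ltnW// ltnW.
  by have := mulr_gt0 t0' (u1 _ lj); lra.
rewrite ltnNge n_i/= in ez.
have ijn : (i - n < j - n)%N by rewrite ltn_sub2r// (leq_ltn_trans n_i).
have li := ltn_trans ijn lj.
have e1 : cross (u (i - n).+1) z = s * cross (u (i - n)%N) (u (i - n).+1).
  by rewrite ez !cross_oppr cc (crossC (u (i - n).+1)); ring.
have e2 : 0 <= - cross (u (i - n).+1) z.
  rewrite ez' !cross_oppr !mulrN -opprD opprK; apply: inn => //; apply: u0.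
    by rewrite ijn ltnW.
  by rewrite lj andbT (leq_trans ijn).
by have := mulr_gt0 s0 (u1 _ li); lra.
Qed.

Let fan2 u v : K u -> K v -> cross u v + cross u v <= area K.
Proof.
move=> Ku Kv; have [h|h] := leP (cross u v) 0.
  by have := area_ge0 K; lra.
pose f i := match i with 0 => u | 1 => v | _ => opp2 u end.
have := @symmetric_fan_le 2 f; rewrite !big_ord_recr big_ord0/= cross_oppr (crossC v).
rewrite opprK add0r; apply => //.
- by case=> [|[|]].
- case=> [|[|[|i]]] [|[|[|j]]] //=; rewrite ?andbF// => _;
    first [exact: ltW | by rewrite cross_oppr (crossC v) opprK ltW | by rewrite /cross/=; lra].
- by case=> [|[|]]//= _; rewrite ?cross_oppr ?(crossC v u) ?opprK.
Qed.

(** If one of the three terms is not positive, each of the other two is at most half of [area K];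
    otherwise the vectors are in angular order and form a fan. *)
Lemma symmetric_hexagon_le u v w : K u -> K v -> K w ->
  cross u v + cross v w + cross u w <= area K.
Proof.
move=> Ku Kv Kw.
have := fan2 Ku Kv; have := fan2 Kv Kw; have := fan2 Ku Kw => h1 h2 h3.
have [h|uv] := leP (cross u v) 0.
  by have [|] := leP (cross v w) (cross u w); lra.
have [h|vw] := leP (cross v w) 0.
  by have [|] := leP (cross u v) (cross u w); lra.
have [h|uw] := leP (cross u w) 0.
  by have [|] := leP (cross u v) (cross v w); lra.
pose f i := match i with 0 => u | 1 => v | 2 => w | _ => opp2 u end.
have := @symmetric_fan_le 3 f; rewrite !big_ord_recr big_ord0/= cross_oppr (crossC w).
rewrite opprK add0r; apply => //.
- by case=> [|[|[|]]].
- case=> [|[|[|[|i]]]] [|[|[|[|j]]]] //=; rewrite ?andbF// => _;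
    first [exact: ltW | by rewrite cross_oppr (crossC v u) opprK ltW
      | by rewrite cross_oppr (crossC w u) opprK ltW
      | by rewrite /cross/=; lra].
- by case=> [|[|[|]]]//= _; rewrite ?cross_oppr ?(crossC w u) ?opprK.
Qed.

(* If the angular order of [u] and [v] is reversed in a fan [.., w, u, v, z, ..],
   dropping [u], [v] or both does not decrease the signed area: this follows from the
   Pluecker relation [pq = ab + Wk]. *)
Let drop (p q a b k W : R) : 0 <= a -> 0 <= b -> 0 <= k -> p * q = a * b + W * k ->
  [\/ p <= a + k, q <= b + k | p + q - k <= W].
Proof.
move=> a0 b0 k0 e.
have [|h1] := leP p (a + k); first by constructor 1.
have [|h2] := leP q (b + k); first by constructor 2.
have i1 : a * b <= (p - k) * (q - k) by apply: ler_pM => //; lra.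
have [kz|kn] := eqVneq k 0.
  have : a * b < p * q by apply: ltr_pM => //; lra.
  by rewrite e kz mulr0 addr0 ltxx.
constructor 3; have kp : 0 < k by rewrite lt_neqAle eq_sym kn.
rewrite -(ler_pM2r kp); lra.
Qed.

Let plucker (w u v z : pt) :
  cross w u * cross v z = cross w v * cross u z + cross w z * - cross u v.
Proof. by rewrite /cross; ring. Qed.

Let octagon_aux u1 u2 u3 u4 : K u1 -> K u2 -> K u3 -> K u4 ->
  0 <= cross u1 u3 -> 0 <= cross u2 u4 -> cross u1 u2 <= 0 ->
  cross u1 u2 + cross u2 u3 + cross u3 u4 + cross u1 u4 <= area K.
Proof.
move=> K1 K2 K3 K4 h13 h24 h12.
have := plucker (opp2 u4) u1 u2 u3; rewrite !cross_oppl !(crossC u4) !opprK => e.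
have k0 : 0 <= - cross u1 u2 by lra.
have [h|h|h] := drop h24 h13 k0 e.
- by have := symmetric_hexagon_le K2 K3 K4; lra.
- by have := symmetric_hexagon_le K1 K3 K4; lra.
- by have := fan2 K3 K4; lra.
Qed.

(** Passing from [(u1, u2, u3, u4)] to [(u2, u3, u4, - u1)] preserves the sum and the hypotheses, so
    a pair of neighbours out of order can be brought to the front, where [octagon_aux] applies.
    Without such a pair the vectors form a fan. *)
Lemma symmetric_octagon_le u1 u2 u3 u4 : K u1 -> K u2 -> K u3 -> K u4 ->
  0 <= cross u1 u3 -> 0 <= cross u2 u4 ->
  cross u1 u2 + cross u2 u3 + cross u3 u4 + cross u1 u4 <= area K.
Proof.
move=> K1 K2 K3 K4 h13 h24.
have K1' := sK K1; have K2' := sK K2; have K3' := sK K3.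
have [h|h12] := leP (cross u1 u2) 0; first exact: octagon_aux.
have [h|h23] := leP (cross u2 u3) 0.
  have := @octagon_aux u2 u3 u4 (opp2 u1) K2 K3 K4 K1' h24.
  by rewrite !cross_oppr !(crossC _ u1) !opprK => /(_ h13 h); lra.
have [h|h34] := leP (cross u3 u4) 0.
  have := @octagon_aux u3 u4 (opp2 u1) (opp2 u2) K3 K4 K1' K2'.
  rewrite !cross_oppl !cross_oppr !(crossC _ u1) !(crossC _ u2) (crossC u2 u1) !opprK.
  by move=> /(_ h13 h24 h); lra.
have [h|h14] := leP (cross u1 u4) 0.
  have := @octagon_aux u4 (opp2 u1) (opp2 u2) (opp2 u3) K4 K1' K2' K3'.
  rewrite !cross_oppl !cross_oppr !(crossC u4) !opprK => /(_ h24 h13 h); lra.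
pose f i := match i with 0 => u1 | 1 => u2 | 2 => u3 | 3 => u4 | _ => opp2 u1 end.
have := @symmetric_fan_le 4 f; rewrite !big_ord_recr big_ord0/= cross_oppr (crossC u4).
rewrite opprK add0r; apply => //.
- by case=> [|[|[|[|]]]].
- case=> [|[|[|[|[|i]]]]] [|[|[|[|[|j]]]]] //=; rewrite ?andbF// => _;
    first [exact: ltW | by rewrite cross_oppr (crossC _ u1) opprK ltW
      | by rewrite cross_oppr (crossC _ u1) opprK
      | by rewrite /cross/=; lra].
- by case=> [|[|[|[|]]]]//= _; rewrite ?cross_oppr ?(crossC u4 u1) ?opprK.
Qed.

Let decagon_aux u1 u2 u3 u4 u5 : K u1 -> K u2 -> K u3 -> K u4 -> K u5 ->
  0 <= cross u1 u3 -> 0 <= cross u1 u4 -> 0 <= cross u2 u4 -> 0 <= cross u2 u5 ->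
  0 <= cross u3 u5 -> cross u1 u2 <= 0 ->
  cross u1 u2 + cross u2 u3 + cross u3 u4 + cross u4 u5 + cross u1 u5 <= area K.
Proof.
move=> K1 K2 K3 K4 K5 h13 h14 h24 h25 h35 h12.
have := plucker (opp2 u5) u1 u2 u3; rewrite !cross_oppl !(crossC u5) !opprK => e.
have k0 : 0 <= - cross u1 u2 by lra.
have [h|h|h] := drop h25 h13 k0 e.
- by have := symmetric_octagon_le K2 K3 K4 K5 h24 h35; lra.
- by have := symmetric_octagon_le K1 K3 K4 K5 h14 h35; lra.
- by have := symmetric_hexagon_le K3 K4 K5; lra.
Qed.

(* Only non-neighbouring vertices have to be in the right angular order. *)
Lemma symmetric_decagon_le u1 u2 u3 u4 u5 : K u1 -> K u2 -> K u3 -> K u4 -> K u5 ->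
  0 <= cross u1 u3 -> 0 <= cross u1 u4 -> 0 <= cross u2 u4 -> 0 <= cross u2 u5 ->
  0 <= cross u3 u5 ->
  cross u1 u2 + cross u2 u3 + cross u3 u4 + cross u4 u5 + cross u1 u5 <= area K.
Proof.
move=> K1 K2 K3 K4 K5 h13 h14 h24 h25 h35.
have K1' := sK K1; have K2' := sK K2; have K3' := sK K3; have K4' := sK K4.
have [h|h12] := leP (cross u1 u2) 0; first exact: decagon_aux.
have [h|h23] := leP (cross u2 u3) 0.
  have := @decagon_aux u2 u3 u4 u5 (opp2 u1) K2 K3 K4 K5 K1'.
  by rewrite !cross_oppr !(crossC _ u1) !opprK => /(_ h24 h25 h35 h13 h14 h); lra.
have [h|h34] := leP (cross u3 u4) 0.
  have := @decagon_aux u3 u4 u5 (opp2 u1) (opp2 u2) K3 K4 K5 K1' K2'.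
  rewrite !cross_oppl !cross_oppr !(crossC _ u1) !(crossC _ u2) (crossC u2 u1) !opprK.
  by move=> /(_ h35 h13 h14 h24 h25 h); lra.
have [h|h45] := leP (cross u4 u5) 0.
  have := @decagon_aux u4 u5 (opp2 u1) (opp2 u2) (opp2 u3) K4 K5 K1' K2' K3'.
  rewrite !cross_oppl !cross_oppr !(crossC u4) !(crossC u5) !opprK.
  by move=> /(_ h14 h24 h25 h35 h13 h); lra.
have [h|h15] := leP (cross u1 u5) 0.
  have := @decagon_aux u5 (opp2 u1) (opp2 u2) (opp2 u3) (opp2 u4) K5 K1' K2' K3' K4'.
  rewrite !cross_oppl !cross_oppr !(crossC u5) !opprK.
  by move=> /(_ h25 h35 h13 h14 h24 h); lra.
pose f i := match i with 0 => u1 | 1 => u2 | 2 => u3 | 3 => u4 | 4 => u5 | _ => opp2 u1 end.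
have := @symmetric_fan_le 5 f; rewrite !big_ord_recr big_ord0/= cross_oppr (crossC u5).
rewrite opprK add0r; apply => //.
- by case=> [|[|[|[|[|]]]]].
- case=> [|[|[|[|[|[|i]]]]]] [|[|[|[|[|[|j]]]]]] //=; rewrite ?andbF// => _;
    first [exact: ltW | by rewrite cross_oppr (crossC _ u1) opprK ltW
      | by rewrite cross_oppr (crossC _ u1) opprK
      | by rewrite /cross/=; lra].
- by case=> [|[|[|[|[|]]]]]//= _; rewrite ?cross_oppr ?(crossC u5 u1) ?opprK.
Qed.

End SymmetricFans.

(** * Symmetrization along a segment of centres *)

Section Symmetrization.
Variable R : realType.
Local Notation pt := (R * R)%type.
Notation mR := (measurableTypeR R).
Notation lam := (@lebesgue_measure R).
Implicit Types (p q u v w z : pt) (K : set pt).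

(* Two centrally symmetric parts of [K], with centres [p] and [q], are moved
   along the segment [p, q] onto a common centre; [symmetrize K p q] is the
   convex body swept by their convex combinations. *)
Definition symmetrize K p q : set pt := [set z | exists k : R, [/\ 0 <= k, k <= 1,
  K (z.1 + (k * p.1 + (1 - k) * q.1), z.2 + (k * p.2 + (1 - k) * q.2)) &
  K (- z.1 + (k * p.1 + (1 - k) * q.1), - z.2 + (k * p.2 + (1 - k) * q.2))]].

Lemma symmetrize_convex K p q : convex2 K -> convex2 (symmetrize K p q).
Proof.
move=> cK z w [k [k0 k1 Kz Kz']] [l [l0 l1 Kw Kw']] t t0 t1.
have i1 := mulr_ge0 t0 k0; have t1' : 0 <= 1 - t by lra.
have i2 := mulr_ge0 t1' l0.
have i3 : 0 <= t * (1 - k) by rewrite mulr_ge0//; lra.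
have i4 : 0 <= (1 - t) * (1 - l) by rewrite mulr_ge0//; lra.
exists (t * k + (1 - t) * l); split; [lra|lra| |].
- have := cK _ _ Kz Kw t t0 t1; rewrite /=.
  by congr K; congr pair; ring.
- have := cK _ _ Kz' Kw' t t0 t1; rewrite /=.
  by congr K; congr pair; ring.
Qed.

Lemma symmetrize_sym K p q : symmetric2 (symmetrize K p q).
Proof. by move=> z [k [k0 k1 Kz Kz']]; exists k; split => //=; rewrite !opprK. Qed.

(** It is the image under [psi] of the compact set of pairs [(w, k)] such that [w] and its
    reflection [phi] in the centre with parameter [k] both lie in [K]. *)
Lemma symmetrize_compact K p q : compact K -> compact (symmetrize K p q).
Proof.
move=> kK.
pose phi (x : pt * R) : pt := (- x.1.1 + 2 * (x.2 * p.1 + (1 - x.2) * q.1),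
  - x.1.2 + 2 * (x.2 * p.2 + (1 - x.2) * q.2)).
pose psi (x : pt * R) : pt := (x.1.1 - (x.2 * p.1 + (1 - x.2) * q.1),
  x.1.2 - (x.2 * p.2 + (1 - x.2) * q.2)).
have c11 (x : pt * R) : (fun y : pt * R => y.1.1) @ x --> x.1.1.
  by apply: (@cvg_comp _ _ _ fst fst _ (nbhs x.1)); [exact: cvg_fst|exact: cvg_fst].
have c12 (x : pt * R) : (fun y : pt * R => y.1.2) @ x --> x.1.2.
  by apply: (@cvg_comp _ _ _ fst snd _ (nbhs x.1)); [exact: cvg_fst|exact: cvg_snd].
have c2 (x : pt * R) : (fun y : pt * R => y.2) @ x --> x.2 by exact: cvg_snd.
have cc (a b : R) (x : pt * R) :
    (fun y : pt * R => y.2 * a + (1 - y.2) * b) @ x --> x.2 * a + (1 - x.2) * b.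
  apply: cvgD; first by apply: cvgM; [exact: c2|exact: cvg_cst].
  by apply: cvgM; [apply: cvgB; [exact: cvg_cst|exact: c2]|exact: cvg_cst].
have cphi : continuous phi.
  rewrite /phi; apply: continuous_mkpair => x.
    by apply: cvgD; [apply: cvgN; exact: c11|apply: cvgM; [exact: cvg_cst|exact: cc]].
  by apply: cvgD; [apply: cvgN; exact: c12|apply: cvgM; [exact: cvg_cst|exact: cc]].
have cpsi : continuous psi.
  rewrite /psi; apply: continuous_mkpair => x.
    by apply: cvgB; [exact: c11|exact: cc].
  by apply: cvgB; [exact: c12|exact: cc].
have k1 : compact ((K `*` `[0, 1]%classic) `&` phi @^-1` K).
  apply: compact_closedI; first by apply: compact_setX => //; exact: segment_compact.
  have clK : closed K by apply: compact_closed => //; exact: norm_hausdorff.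
  by apply: preimage_closed => // x _; exact: cphi.
have := continuous_compact (continuous_subspaceT cpsi) k1.
congr compact; apply/seteqP; split => z.
  move=> [[w k] [[Kw /=]]]; rewrite in_itv/= => /andP[k0 kl] Kphi <-.
  exists k; split => //; rewrite /psi/=.
    by move: Kw; congr K; rewrite [LHS]surjective_pairing; congr pair; ring.
  by move: Kphi; congr K; rewrite /phi/=; congr pair; ring.
move=> [k [k0 kl Kz Kz']].
exists ((z.1 + (k * p.1 + (1 - k) * q.1), z.2 + (k * p.2 + (1 - k) * q.2)), k).
  split; first by split => //=; rewrite in_itv/= k0.
  by move: Kz'; congr K; rewrite /phi/=; congr pair; ring.
by rewrite /psi/= [RHS]surjective_pairing; congr pair; ring.
Qed.

Lemma lebesgue_convex_ge (I : set R) (u v : R) : measurable (I : set mR) ->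
  (forall t, u <= t -> t <= v -> I t) -> ((v - u)%:E <= lam I)%E.
Proof.
move=> mI uvI; have [uv|vu] := leP u v; last first.
  by apply: (@le_trans _ _ 0%E) => //; rewrite lee_fin subr_le0 ltW.
apply: (@le_trans _ _ (lam `[u, v]%classic)).
  rewrite lebesgue_measure_itv/= lte_fin; case: ifPn => [_|]; first by rewrite EFinB.
  by rewrite -leNgt lee_fin => vu; lra.
have mi : measurable (`[u, v]%classic : set mR) by exact: measurable_itv.
apply: le_measure; rewrite ?inE//.
by move=> t /=; rewrite in_itv/= => /andP[? ?]; exact: uvI.
Qed.

(** All centres have abscissa [p.1], so the section of the symmetrized body over [x] is controlled
    by the sections of [K] over [p.1 + x] and [p.1 - x], which are those of [K1] and [K2]. The ends
    [za] and [zb] of the former yield intervals in the latter whose lengths add up to twice its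
    length; integration over [x] concludes. *)
Lemma symmetrize_area_vertical K p q : compact K -> convex2 K -> p.1 = q.1 ->
  area (symmetrize K p q) <= area K.
Proof.
move=> kK cK pq; set P := symmetrize K p q.
have kP : compact P by exact: symmetrize_compact.
have fP := compact_finarea kP; have fK := compact_finarea kK.
pose K1 := aff 1 0 0 1 p.1 0 @^-1` K; pose K2 := aff (-1) 0 0 1 p.1 0 @^-1` K.
have D1 : 1 * 1 - 0 * 0 != 0 :> R by rewrite mulr0 subr0 mulr1 oner_neq0.
have D2 : -1 * 1 - 0 * 0 != 0 :> R by rewrite mulr0 subr0 mulr1 oppr_eq0 oner_neq0.
have [fK1 aK1] := area_aff p.1 0 D1 fK; have [fK2 aK2] := area_aff p.1 0 D2 fK.
rewrite mulr0 subr0 mulr1 normr1 mul1r -/K1 in aK1.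
rewrite mulr0 subr0 mulr1 normrN1 mul1r -/K2 in aK2.
suff : 2 * area P <= area K1 + area K2.
  by rewrite aK1 aK2; move: (area P) (area K) => x y; clear; lra.
have areaE A : finarea A -> (area A)%:E = (lam \x lam)%E A by case=> _ nA; rewrite /area fineK.
rewrite -lee_fin EFinM [X in (_ <= X)%E]EFinD (areaE _ fP) (areaE _ fK1) (areaE _ fK2).
case: fP => mP _; case: fK1 => mK1 _; case: fK2 => mK2 _.
rewrite /product_measure1.
rewrite -ge0_integralD//; last 2 first.
- exact: (measurable_fun_xsection lam).
- exact: (measurable_fun_xsection lam).
rewrite -ge0_integralZl//; last exact: (measurable_fun_xsection lam).
apply: ge0_le_integral => //.
- by move=> x _; rewrite mule_ge0.
- apply: measurable_funeM; exact: (measurable_fun_xsection lam).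
- apply: emeasurable_funD; exact: (measurable_fun_xsection lam).
move=> x _ /=.
have mxP : measurable (xsection P x : set mR) by exact: measurable_xsection.
have mx1 : measurable (xsection K1 x : set mR) by exact: measurable_xsection.
have mx2 : measurable (xsection K2 x : set mR) by exact: measurable_xsection.
have [e|/set0P[y0]] := eqVneq (xsection P x) set0.
  by rewrite [X in lam X]e measure0 mule0 adde_ge0.
rewrite /xsection/= inE => Py0.
pose Px := P `&` [set z | z.1 = x].
have kPx : compact Px.
  apply: compact_closedI => //.
  have cl : closed [set t : R | t = x] by exact: closed_eq.
  have cf : {in ~` (fst : pt -> R) @^-1` [set t : R | t = x], continuous (fst : pt -> R)}.
    by move=> z _; exact: cvg_fst.
  exact: preimage_closed cf cl.
have Px0 : Px !=set0 by exists (x, y0).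
have [zb [Pzb zbx] hb] := compact_linear_max 0 1 kPx Px0.
have [za [Pza zax] ha] := compact_linear_max 0 (-1) kPx Px0.
have aP : (lam (xsection P x) <= (zb.2 - za.2)%:E)%E.
  apply: (@le_trans _ _ (lam `[za.2, zb.2]%classic)).
    have mi : measurable (`[za.2, zb.2]%classic : set mR) by exact: measurable_itv.
    apply: le_measure; rewrite ?inE//.
    move=> y; rewrite /xsection/= inE => Pxy; rewrite in_itv/=.
    have hy : Px (x, y) by split.
    by move: (hb _ hy) (ha _ hy); clear; rewrite /= => ? ?; apply/andP; split; lra.
  rewrite lebesgue_measure_itv/= lte_fin; case: ifPn => [_|]; first by rewrite EFinB.
  move=> _; rewrite lee_fin.
  by move: (hb _ (conj Pza zax)); clear; rewrite /=; lra.
case: Pzb => kb [kb0 kb1 b1 b2]; case: Pza => ka [ka0 ka1 a1 a2].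
rewrite zbx in b1 b2; rewrite zax in a1 a2.
have ek (k : R) : k * p.1 + (1 - k) * q.1 = p.1 by rewrite -pq; ring.
rewrite !ek in a1 a2 b1 b2.
set rb := kb * p.2 + (1 - kb) * q.2 in b1 b2; set ra := ka * p.2 + (1 - ka) * q.2 in a1 a2.
have between (s c d t : R) : K (s, c) -> K (s, d) -> c <= t -> t <= d -> K (s, t).
  move=> Kc Kd ct td; clear -cK Kc Kd ct td; have [cd|cd] := eqVneq c d; first by have -> : t = c by lra.
  have cd0 : 0 < d - c by rewrite subr_gt0 lt_neqAle cd; lra.
  have i0 : 0 <= (t - c) / (d - c) by rewrite divr_ge0//; lra.
  have i1 : (t - c) / (d - c) <= 1 by rewrite ler_pdivrMr//; lra.
  have := cK _ _ Kd Kc _ i0 i1; rewrite /=; congr K; congr pair; first by ring.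
  by field; rewrite gt_eqF.
have A1 : (((zb.2 + rb) - (za.2 + ra))%:E <= lam (xsection K1 x))%E.
  apply: lebesgue_convex_ge => // t t1 t2; rewrite /xsection/= inE /K1 /aff/=.
  have := between _ _ _ _ a1 b1 t1 t2; congr K; congr pair; ring.
have A2 : (((- za.2 + ra) - (- zb.2 + rb))%:E <= lam (xsection K2 x))%E.
  apply: lebesgue_convex_ge => // t t1 t2; rewrite /xsection/= inE /K2 /aff/=.
  have := between _ _ _ _ b2 a2 t1 t2; congr K; congr pair; ring.
have := leeD A1 A2; apply: le_trans.
rewrite -EFinD; apply: (@le_trans _ _ (2%:E * (zb.2 - za.2)%:E)%E).
  by apply: lee_pmul.
by rewrite -EFinM lee_fin; clear; lra.
Qed.

(** A similarity, scaling lengths by the distance of [p] and [q], makes the segment vertical;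
    symmetrization commutes with it. *)
Lemma symmetrize_area K p q : compact K -> convex2 K ->
  area (symmetrize K p q) <= area K.
Proof.
move=> kK cK; have [e|ne] := eqVneq p.1 q.1; first exact: symmetrize_area_vertical.
pose t1 := p.1 - q.1; pose t2 := p.2 - q.2.
have t10 : t1 != 0 by rewrite subr_eq0.
have n0 : 0 < t2 * t2 + t1 * t1.
  have : 0 < t1 ^+ 2 by rewrite exprn_even_gt0.
  by have := sqr_ge0 t2; rewrite !expr2; lra.
have nn : t2 * t2 + t1 * t1 != 0 by rewrite gt_eqF.
pose n := t2 * t2 + t1 * t1.
have D0 : t2 * t2 - t1 * - t1 != 0 by rewrite mulrN opprK.
pose M := aff t2 t1 (- t1) t2 0 0.
pose N (z : pt) : pt := ((t2 * z.1 - t1 * z.2) / n, (t1 * z.1 + t2 * z.2) / n).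
have MN z : M (N z) = z.
  by rewrite /M /N /aff /= [RHS]surjective_pairing; congr pair; rewrite /n; field.
pose K' := M @^-1` K.
have kK' : compact K' by exact: compact_preaff.
have cK' : convex2 K' by exact: convex_preaff.
have fK := compact_finarea kK.
have fP := compact_finarea (@symmetrize_compact K p q kK).
have [_ aK] := area_aff 0 0 D0 fK; have [_ aP] := area_aff 0 0 D0 fP.
rewrite -aK -aP ler_pM2l ?normr_gt0//.
have Npq : (N p).1 = (N q).1 by rewrite /N /=; congr (_ / _); rewrite /t1 /t2; ring.
rewrite (_ : aff t2 t1 (- t1) t2 0 0 @^-1` _ = symmetrize K' (N p) (N q)).
  exact: symmetrize_area_vertical.
apply/esym/seteqP; split => z [k [k0 kl h1 h2]]; exists k; split => //.
- move: h1; rewrite /K' /= -[in X in _ -> X](MN p) -[in X in _ -> X](MN q) /M /aff/=.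
  by congr K; congr pair; ring.
- move: h2; rewrite /K' /= -[in X in _ -> X](MN p) -[in X in _ -> X](MN q) /M /aff/=.
  by congr K; congr pair; ring.
- move: h1; rewrite /K' /= -[in X in X -> _](MN p) -[in X in X -> _](MN q) /M /aff/=.
  by congr K; congr pair; ring.
- move: h2; rewrite /K' /= -[in X in X -> _](MN p) -[in X in X -> _](MN q) /M /aff/=.
  by congr K; congr pair; ring.
Qed.

End Symmetrization.

(** * Area of a body containing two pairs of opposite triangles *)

Section FourTriangles.
Variable R : realType.
Local Notation pt := (R * R)%type.

(** The expressions are doubled cross products of the decagon used below, in the coordinates [tau],
    [De], [g], [z]. Each is a nonnegative combination of products of the given inequalities, after a
    distinction of the sign of [De]. *)
Let strip_signs (m tau De g z : R) : m <= 1 -> 0 < tau -> 1 - m < z -> 1 - m + De < z ->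
  z < m -> - m < g -> g < m - 1 - tau -> z - De < m ->
  [/\ 0 <= (1 + g) * (1 - De) + tau * (1 - z) /\
       0 <= (1 - z) * (1 - tau) + De * (1 + g),
     0 <= - z * tau - g * (1 + De), 0 <= z * (1 + tau) + g * De,
     0 <= (1 + g) * (1 + De) + tau + z * tau & 0 <= z * tau - g * (1 - De)].
Proof.
move=> m1 t0 z1 z2 z3 g1 g2 z4.
have q1 : 0 <= (1 + g) * (1 - De) by apply: mulr_ge0; lra.
have q2 : 0 <= tau * (1 - z) by apply: mulr_ge0; lra.
have q3 : 0 <= (1 + g) * (1 + De) by apply: mulr_ge0; lra.
have q4 : 0 <= z * tau by apply: mulr_ge0; lra.
have q5 : 0 <= - g * (1 - De) by apply: mulr_ge0; lra.
split; [split; first by apply: addr_ge0| | |lra|lra].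
- have [De0|De0] := leP 0 De.
    have : 0 <= De * (1 + g) by apply: mulr_ge0; lra.
    have : 0 <= (1 - z) * (1 - tau) by apply: mulr_ge0; lra.
    by lra.
  have i1 : 0 <= (m - z + De) * (1 + g) by apply: mulr_ge0; lra.
  have i2 : 0 <= (m - z) * (m - 1 - tau - g) by apply: mulr_ge0; lra.
  have i3 : 0 <= (1 - m) * (1 - tau) by apply: mulr_ge0; lra.
  have i4 : 0 <= (m - z) * (1 - m) by apply: mulr_ge0; lra.
  by lra.
- have [De0|De0] := leP 0 De.
    have : 0 <= - g * De by apply: mulr_ge0; lra.
    by lra.
  have i1 : 0 <= (- g - 1 - tau + m) * (1 + De) by apply: mulr_ge0; lra.
  have i2 : 0 <= (1 + tau - m) * (De + m - z) by apply: mulr_ge0; lra.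
  have i3 : 0 <= (1 - m) * (1 - m + z) by apply: mulr_ge0; lra.
  have i4 : 0 <= (1 - m) * tau by apply: mulr_ge0; lra.
  by lra.
- have [De0|De0] := leP 0 De.
    have : 0 <= (m + g) * De by apply: mulr_ge0; lra.
    have : 0 <= (1 - m) * De by apply: mulr_ge0; lra.
    by lra.
  have : 0 <= - g * - De by apply: mulr_ge0; lra.
  by lra.
Qed.

(* The height functional is [z.1 + z.2]; [Sd] and [Se] measure how far the
   pairs of triangles are from spanning one common strip of width [1]. *)
Lemma symmetric_four_triangles (K : set pt) (al be x y Sd Se : R) :
  convex2 K -> finarea K -> symmetric2 K ->
  0 <= al -> al < 1 -> 0 <= be -> be < 1 ->
  K (x, - Sd - x) -> K (x + 1, - Sd - x) -> K (x, - Sd - x + al) ->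
  K (y, - Se - y) -> K (y + be, - Se - y) -> K (y, - Se - y + 1) ->
  (1 - al * be) / (2 - al - be) <= area K.
Proof.
move=> cK fK sK al0 al1 be0 be1 Kd Kd1 Ka Ke Kb Ke1.
have K0 : K !=set0 by exists (x, - Sd - x).
have n0 : 0 < 2 - al - be by lra.
have nn : 2 - al - be != 0 by rewrite gt_eqF.
set m := (1 - al * be) / (2 - al - be).
(* With these weights the sum for the hexagon on [C1], [C2] and [M] becomes [m * (2 - Sd - Se)],
   independent of [x] and [y]. *)
pose phi := (1 - be) / (2 - al - be); pose psi := (1 - al) / (2 - al - be).
have phi0 : 0 <= phi by rewrite divr_ge0//; lra.
have psi0 : 0 <= psi by rewrite divr_ge0//; lra.
have pp : phi + psi = 1 by rewrite /phi /psi; field.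
have h1 : phi * al = m - psi by rewrite /phi /psi /m; field.
have h2 : psi * be = m - phi by rewrite /phi /psi /m; field.
have m1 : m <= 1.
  have : 0 <= phi * (1 - al) by rewrite mulr_ge0//; lra.
  by lra.
have m0 : 0 < m.
  rewrite /m divr_gt0//; have : al * be < 1 * 1 by apply: ltr_pM.
  by lra.
(* From here on every inscribed hexagon is smaller than [m]; the resulting inequalities force the
   angular order required for a decagon. *)
have [//|Am] := leP m (area K).
pose d : pt := (x, - Sd - x); pose e : pt := (y, - Se - y).
pose C1 := opp2 (x + 1, - Sd - x); pose C2 := opp2 (y, - Se - y + 1).
pose Ma := opp2 (x, - Sd - x + al); pose Mb : pt := (y + be, - Se - y).
pose M : pt := (phi * Ma.1 + (1 - phi) * Mb.1, phi * Ma.2 + (1 - phi) * Mb.2).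
have KC1 : K C1 by exact: sK.
have KC2 : K C2 by exact: sK.
have phi1 : phi <= 1 by lra.
have KM : K M by apply: cK => //; exact: sK.
have eM z : cross z M = phi * cross z Ma + psi * cross z Mb.
  by rewrite (_ : psi = 1 - phi) /cross/=; [ring|lra].
pose D := x * (- Se - y) - (- Sd - x) * y.
have E1 : cross C1 C2 = D + x - y + 1 - Se by rewrite /cross/=/D; ring.
have E2 : cross C2 M = phi * (- D - x) + (phi * al) * y + psi * y + psi * be * (1 - Se - y).
  by rewrite eM /cross/=/D; ring.
have E3 : cross C1 M = phi * (- Sd - x) + (phi * al) * (1 + x) + psi * (Se + y - D)
    - psi * be * (Sd + x).
  by rewrite eM /cross/=/D; ring.
rewrite h1 h2 in E2 E3.
have pE : phi = 1 - psi by lra.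
have H1 := symmetric_hexagon_le cK fK sK K0 KC1 KC2 KM.
have eH1 : cross C1 C2 + cross C2 M + cross C1 M = m * (2 - Sd - Se).
  by rewrite E1 E2 E3 pE; ring.
have E4 : cross d e = D by rewrite /cross/=/D; ring.
have E5 : cross e C2 = - y by rewrite /cross/=; ring.
have E6 : cross d C2 = - D - x by rewrite /cross/=/D; ring.
have E7 : cross C1 d = Sd + x by rewrite /cross/=; ring.
have E8 : cross C1 e = - D + Se + y by rewrite /cross/=/D; ring.
have E9 : cross C2 e = y by rewrite /cross/=; ring.
have E10 : cross d C1 = - Sd - x by rewrite /cross/=; ring.
have H3 := symmetric_hexagon_le cK fK sK K0 Kd Ke KC2.
have H4 := symmetric_hexagon_le cK fK sK K0 Kd KC2 Ke.
have H5 := symmetric_hexagon_le cK fK sK K0 KC1 Kd Ke.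
have H6 := symmetric_hexagon_le cK fK sK K0 Kd KC1 Ke.
have H7 := symmetric_hexagon_le cK fK sK K0 KC1 Kd KC2.
have H8 := symmetric_hexagon_le cK fK sK K0 KC1 Ke KC2.
rewrite -/d -/e in H3 H4 H5 H6 H7 H8.
rewrite ?E1 ?E4 ?E5 ?E6 ?E7 ?E8 ?E9 ?E10 in H3 H4 H5 H6 H7 H8.
(* For [tau <= 0] the hexagon on [C1], [C2] and [M] would already reach [m]. *)
pose tau := Sd + Se - 1; pose De := Sd - Se; pose g := x + y; pose z := y - x.
have t0 : 0 < tau.
  have : m * (2 - Sd - Se) < m * 1 by rewrite mulr1; lra.
  by rewrite ltr_pM2l// /tau; lra.
have z1 : 1 - m < z by rewrite /z; lra.
have z2 : 1 - m + De < z by rewrite /z /De; lra.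
have z3 : z < m by rewrite /z; lra.
have g1 : - m < g by rewrite /g; lra.
have g2 : g < m - 1 - tau by rewrite /g /tau; lra.
have z4 : z - De < m by rewrite /z /De; lra.
have d2 : 2 * D = z * (1 + tau) + g * De by rewrite /D /z /tau /g /De; ring.
have Se0 : 0 <= Se + y by rewrite /z /De /g /tau in z2 g1 t0; lra.
have x0 : 0 <= - x by rewrite /z /g in z1 g2; lra.
clear H1 H3 H4 H5 H6 H7 H8.
have [[q1 q2] q3 q4 q5 q6] := strip_signs m1 t0 z1 z2 z3 g1 g2 z4.
have s1 : 0 <= cross C1 e.
  suff : 2 * cross C1 e = (1 + g) * (1 - De) + tau * (1 - z) by lra.
  transitivity (- (2 * D) + 2 * (Se + y)); first by rewrite E8; ring.
  by rewrite d2 /z /tau /g /De; ring.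
have s2 : 0 <= cross C1 C2.
  suff : 2 * cross C1 C2 = (1 - z) * (1 - tau) + De * (1 + g) by lra.
  transitivity (2 * D + 2 * (x - y + 1 - Se)); first by rewrite E1; ring.
  by rewrite d2 /z /tau /g /De; ring.
have s3 : 0 <= cross d C2.
  suff : 2 * cross d C2 = - z * tau - g * (1 + De) by lra.
  transitivity (- (2 * D) - 2 * x); first by rewrite E6; ring.
  by rewrite d2 /z /tau /g /De; ring.
have D0 : 0 <= D by lra.
have Sd0 : 0 <= D + Sd + x.
  suff : 2 * (D + Sd + x) = (1 + g) * (1 + De) + tau + z * tau by lra.
  transitivity (2 * D + 2 * (Sd + x)); first by ring.
  by rewrite d2 /z /tau /g /De; ring.
have Dy0 : 0 <= D - y.
  suff : 2 * (D - y) = z * tau - g * (1 - De) by lra.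
  transitivity (2 * D - 2 * y); first by ring.
  by rewrite d2 /z /tau /g /De; ring.
clear q1 q2 q3 q4 q5 q6 d2 z1 z2 z3 z4 g1 g2.
have s4 : 0 <= cross d M.
  rewrite eM; apply: addr_ge0; apply: mulr_ge0 => //.
    by rewrite (_ : cross d Ma = al * - x) ?mulr_ge0// /cross/=; ring.
  rewrite (_ : cross d Mb = (1 - be) * D + be * (D + Sd + x)).
    by apply: addr_ge0; apply: mulr_ge0 => //; lra.
  by rewrite /cross/=/D; ring.
have s5 : 0 <= cross e M.
  rewrite eM; apply: addr_ge0; apply: mulr_ge0 => //.
    rewrite (_ : cross e Ma = (1 - al) * D + al * (D - y)).
      by apply: addr_ge0; apply: mulr_ge0 => //; lra.
    by rewrite /cross/=/D; ring.
  by rewrite (_ : cross e Mb = be * (Se + y)) ?mulr_ge0// /cross/=; ring.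
(* Inserting [d] and [e] between [C1] and [C2] adds [tau] to the hexagon, and
   [m * (1 - tau) + tau >= m] because [m <= 1]. *)
have := symmetric_decagon_le cK fK sK K0 KC1 Kd Ke KC2 KM s1 s2 s3 s4 s5.
rewrite -/d -/e E4 E5 E7.
have : 0 <= (1 - m) * tau by apply: mulr_ge0; lra.
have : D + Sd + x - y + cross C2 M + cross C1 M = m + (1 - m) * tau.
  have -> : D + Sd + x - y + cross C2 M + cross C1 M =
    cross C1 C2 + cross C2 M + cross C1 M + (Sd + Se - 1) by rewrite E1; ring.
  by rewrite eH1 /tau; ring.
by lra.
Qed.

(** [p] and [q] are the centres of symmetry of the two pairs. After symmetrization the triangles of
    a pair are opposite with respect to the origin, so the centred coordinates of one describe
    both. *)
Lemma four_triangles_area (K : set pt) (al be : R) (t1 t2 t3 t4 : pt) :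
  compact K -> convex2 K -> 0 <= al -> al < 1 -> 0 <= be -> be < 1 ->
  [/\ K t1, K (t1.1 + 1, t1.2) & K (t1.1, t1.2 + al)] ->
  [/\ K t2, K (t2.1 - 1, t2.2) & K (t2.1, t2.2 - al)] ->
  [/\ K t3, K (t3.1 + be, t3.2) & K (t3.1, t3.2 + 1)] ->
  [/\ K t4, K (t4.1 - be, t4.2) & K (t4.1, t4.2 - 1)] ->
  (1 - al * be) / (2 - al - be) <= area K.
Proof.
move=> kK cK al0 al1 be0 be1 [a1 a2 a3] [b1 b2 b3] [c1 c2 c3] [d1 d2 d3].
pose p : pt := ((t1.1 + t2.1) / 2, (t1.2 + t2.2) / 2).
pose q : pt := ((t3.1 + t4.1) / 2, (t3.2 + t4.2) / 2).
apply: le_trans (symmetrize_area p q kK cK).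
pose x := (t1.1 - t2.1) / 2; pose Sd := - (t1.2 - t2.2) / 2 - x.
pose y := (t3.1 - t4.1) / 2; pose Se := - (t3.2 - t4.2) / 2 - y.
have Pp u v (z w : pt) : K z -> K w -> z = (u + p.1, v + p.2) -> w = (- u + p.1, - v + p.2) ->
    symmetrize K p q (u, v).
  move=> Kz Kw ez ew; exists 1; split; [lra|lra| |].
    by move: Kz; congr K; rewrite ez/=; congr pair; ring.
  by move: Kw; congr K; rewrite ew/=; congr pair; ring.
have Pq u v (z w : pt) : K z -> K w -> z = (u + q.1, v + q.2) -> w = (- u + q.1, - v + q.2) ->
    symmetrize K p q (u, v).
  move=> Kz Kw ez ew; exists 0; split; [lra|lra| |].
    by move: Kz; congr K; rewrite ez/=; congr pair; ring.
  by move: Kw; congr K; rewrite ew/=; congr pair; ring.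
have sp (z : pt) (u v : R) : u = z.1 -> v = z.2 -> z = (u, v).
  by move=> -> ->; exact: surjective_pairing.
apply: (@symmetric_four_triangles _ _ _ x y Sd Se) => //.
- exact: symmetrize_convex.
- exact/compact_finarea/symmetrize_compact.
- exact: symmetrize_sym.
- by apply: (Pp _ _ _ _ a1 b1); apply: sp; rewrite /= /Sd /x; lra.
- by apply: (Pp _ _ _ _ a2 b2); apply: sp; rewrite /= /Sd /x; lra.
- by apply: (Pp _ _ _ _ a3 b3); apply: sp; rewrite /= /Sd /x; lra.
- by apply: (Pq _ _ _ _ c1 d1); apply: sp; rewrite /= /Se /y; lra.
- by apply: (Pq _ _ _ _ c2 d2); apply: sp; rewrite /= /Se /y; lra.
- by apply: (Pq _ _ _ _ c3 d3); apply: sp; rewrite /= /Se /y; lra.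
Qed.

End FourTriangles.

(** * Two triangles and three segments *)

Section ThreeChords.
Variable R : realType.
Local Notation pt := (R * R)%type.

(* Three unit chords lie on the lines [y = 0], [x + y = 2h] and [x = 0], directed
   cyclically around the triangle cut out by these lines; [a1], [a2], [a3] locate
   them relative to the midpoints of its sides. *)
Definition three_chords (K : set pt) (h a1 a2 a3 t1 t2 : R) : Prop :=
  [/\ compact K, convex2 K,
   [/\ K (h - a1, 0), K (h + 1 - a1, 0), K (h + a2, h - a2) & K (h - 1 + a2, h + 1 - a2)],
   K (0, h + a3) /\ K (0, h - 1 + a3) &
   [/\ K (t1, t2), K (t1 - 2 / 3, t2) & K (t1, t2 - 2 / 3)]].

(** An area-preserving affine map of order three permutes the three lines cyclically, and with them
    the chords and the corners of the triangle. It provides two further height functions. *)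
Lemma three_chords_rot K h a1 a2 a3 t1 t2 : three_chords K h a1 a2 a3 t1 t2 ->
  exists K', area K' = area K /\
    three_chords K' h a3 a1 a2 (2 * h - t1 - t2 + 2 / 3) t1.
Proof.
move=> [kK cK [c1 c2 c3 c4] [c5 c6] [c7 c8 c9]].
have D0 : 0 * -1 - 1 * -1 != 0 :> R by rewrite mul0r mul1r sub0r opprK oner_neq0.
exists (aff 0 1 (-1) (-1) 0 (2 * h) @^-1` K); split.
  have [_ <-] := area_aff 0 (2 * h) D0 (compact_finarea kK).
  by rewrite mul0r mul1r sub0r opprK normr1 mul1r.
have mem (u v : R) (z : pt) : K z -> z.1 = v -> z.2 = 2 * h - u - v ->
    (aff 0 1 (-1) (-1) 0 (2 * h) @^-1` K) (u, v).
  move=> Kz e1 e2; move: Kz; rewrite /aff/= [z]surjective_pairing e1 e2.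
  by congr K; congr pair; ring.
split; [exact: compact_preaff|exact: convex_preaff| | |].
- split; [apply: mem c5 _ _|apply: mem c6 _ _|apply: mem c1 _ _|apply: mem c2 _ _];
    rewrite /=; ring.
- split; [apply: mem c3 _ _|apply: mem c4 _ _]; rewrite /=; ring.
- split; [apply: mem c9 _ _|apply: mem c7 _ _|apply: mem c8 _ _]; rewrite /=; ring.
Qed.

Section Fixed.
Variables (K : set pt) (h a1 a2 a3 t1 t2 : R).
Hypothesis C : three_chords K h a1 a2 a3 t1 t2.

Let kK : compact K. Proof. by case: C. Qed.
Let cK : convex2 K. Proof. by case: C. Qed.
Let fK : finarea K. Proof. exact: compact_finarea. Qed.

Let U1 : pt := (h - a1, 0).
Let V1 : pt := (h + 1 - a1, 0).
Let U2 : pt := (h + a2, h - a2).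
Let V2 : pt := (h - 1 + a2, h + 1 - a2).
Let U3 : pt := (0, h + a3).
Let V3 : pt := (0, h - 1 + a3).
Let T0 : pt := (t1, t2).
Let Tl : pt := (t1 - 2 / 3, t2).
Let Tb : pt := (t1, t2 - 2 / 3).

Let KU1 : K U1. Proof. by case: C => _ _ []. Qed.
Let KV1 : K V1. Proof. by case: C => _ _ []. Qed.
Let KU2 : K U2. Proof. by case: C => _ _ []. Qed.
Let KV2 : K V2. Proof. by case: C => _ _ []. Qed.
Let KU3 : K U3. Proof. by case: C => _ _ _ []. Qed.
Let KV3 : K V3. Proof. by case: C => _ _ _ []. Qed.
Let KT0 : K T0. Proof. by case: C => _ _ _ _ []. Qed.
Let KTl : K Tl. Proof. by case: C => _ _ _ _ []. Qed.
Let KTb : K Tb. Proof. by case: C => _ _ _ _ []. Qed.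

(** A lower estimate of the mixed area with the inscribed triangle, whose outward normals are
    [(1, 0)], [(0, 1)] and [(- 1, - 1)]; the position of the triangle cancels. *)
Let mixed (r u l : pt) : K r -> K u -> K l ->
  (r.1 + u.2 - l.1 - l.2) / 3 <= area K.
Proof.
move=> Kr Ku Kl.
have D0 : 0 < area2 T0 Tl Tb by rewrite /area2 /T0 /Tl /Tb /=; lra.
have := triangle_mixed_area_le kK cK KT0 KTl KTb Kl Kr Ku D0.
by rewrite /area2 /T0 /Tl /Tb /=; lra.
Qed.

Let poly (b : pt) (L Rr : seq pt) : K b ->
  (forall z, z \in L -> K z) -> (forall z, z \in Rr -> K z) ->
  path (fun p q : pt => p.2 <= q.2) b L -> path (fun p q : pt => p.2 <= q.2) b Rr ->
  last b L = last b Rr -> chain b Rr - chain b L <= 2 * area K.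
Proof.
move=> Kb KL KR pL pR lE.
have f0 : (0 != 0 :> R) || (1 != 0 :> R) by rewrite oner_neq0 orbT.
apply: (unimodal_shoelace_le cK fK f0) => //.
- by apply: sub_path pL => p q /= pq; rewrite !mul0r !mul1r !add0r.
- by apply: sub_path pR => p q /= pq; rewrite !mul0r !mul1r !add0r.
Qed.

Ltac in_seq := let z := fresh in move=> z; rewrite !inE;
  repeat (move=> /orP[/eqP -> //|]); move=> /eqP -> //.
Ltac path_solve := rewrite /=; repeat (apply/andP; split); first [done | lra].
Ltac ladder := first [assumption | in_seq | done | path_solve].

Local Notation e1 := (a1 + a2 + a3).
Local Notation e2 := (a1 * a2 + a2 * a3 + a3 * a1).

(** [e2 <= e1 ^+ 2 / 3], and [e1 - e1 ^+ 2 / 3] is concave in [e1] with equal values at [1 + h] and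
    [2 - h]. *)
Let e12 : 1 + h <= e1 -> e1 <= 2 - h -> (1 + h) * (2 - h) / 3 <= e1 - e2.
Proof.
move=> E1 E2.
have : 0 <= (e1 - 1 - h) * (2 - h - e1) by apply: mulr_ge0; lra.
have : 3 * e2 <= e1 * e1.
  have := sqr_ge0 (a1 - a2); have := sqr_ge0 (a2 - a3); have := sqr_ge0 (a3 - a1).
  by rewrite !expr2; lra.
by lra.
Qed.

(** Every chord covers the whole side, on its line, of the triangle cut out by the three lines. *)
Let middle := [/\ 0 <= h <= 1 / 2, h <= a1 <= 1 - h, h <= a2 <= 1 - h &
  h <= a3 <= 1 - h].

(** The cyclic order of the chord ends is [V3], [U2], [V1], [U3], [V2], [U1]; it only remains open
    which of [V3], [U2] is lowest and which of [U3], [V2] is highest. *)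
Let hexagon : middle -> e1 - e2 - h * h <= area K.
Proof.
move=> [/andP[h0 h2] /andP[A1 A1'] /andP[A2 A2'] /andP[A3 A3']].
rewrite -(@ler_pM2l _ 2)//.
have bottom : V3.2 <= U2.2 \/ U2.2 <= V3.2 by apply/orP; exact: le_total.
have top : V2.2 <= U3.2 \/ U3.2 <= V2.2 by apply/orP; exact: le_total.
case: bottom; case: top; rewrite /V3 /V2 /U3 /U2 /= => ht hb.
- have := @poly V3 [:: U1; V2; U3] [:: U2; V1; U3].
  rewrite /chain /cross /U1 /U2 /U3 /V1 /V2 /V3/= => X.
  apply: le_trans (X _ _ _ _ _ _); [lra|ladder..].
- have := @poly V3 [:: U1; V2] [:: U2; V1; U3; V2].
  rewrite /chain /cross /U1 /U2 /U3 /V1 /V2 /V3/= => X.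
  apply: le_trans (X _ _ _ _ _ _); [lra|ladder..].
- have := @poly U2 [:: V3; U1; V2; U3] [:: V1; U3].
  rewrite /chain /cross /U1 /U2 /U3 /V1 /V2 /V3/= => X.
  apply: le_trans (X _ _ _ _ _ _); [lra|ladder..].
- have := @poly U2 [:: V3; U1; V2] [:: V1; U3; V2].
  rewrite /chain /cross /U1 /U2 /U3 /V1 /V2 /V3/= => X.
  apply: le_trans (X _ _ _ _ _ _); [lra|ladder..].
Qed.

(** The corners [Tb], [T0] and [Tl] of the triangle are inserted into the hexagon after [V3], [V1]
    and [V2]. The conditions on [t2] say that the heights still go up once and down once. *)
Let nonagon : middle -> 0 <= t2 -> t2 <= h + a3 -> t2 <= h + 1 - a2 ->
  (t2 - 2 / 3 <= h - 1 + a3) || (t2 - 2 / 3 <= h - a2) ->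
  e1 - e2 + 2 / 3 + h / 3 - h * h <= 2 * area K.
Proof.
move=> [/andP[h0 h2] /andP[A1 A1'] /andP[A2 A2'] /andP[A3 A3']] B1 B2 B3 B4.
have top : V2.2 <= U3.2 \/ U3.2 <= V2.2 by apply/orP; exact: le_total.
have bottom : [\/ V3.2 <= Tb.2 /\ Tb.2 <= U2.2, Tb.2 <= V3.2 /\ Tb.2 <= U2.2 |
    U2.2 <= Tb.2 /\ Tb.2 <= V3.2].
  rewrite /V3 /Tb /U2/=; case: (leP (t2 - 2 / 3) (h - 1 + a3)) B4;
    case: (leP (t2 - 2 / 3) (h - a2)) => // c1 c2 _.
  - by constructor 2.
  - by constructor 3; split => //; exact: ltW.
  - by constructor 1; split => //; exact: ltW.
case: bottom => -[]; case: top; rewrite /V3 /V2 /U3 /U2 /Tb /= => ht hb hb'.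
- have := @poly V3 [:: U1; Tl; V2; U3] [:: Tb; U2; V1; T0; U3].
  rewrite /chain /cross /U1 /U2 /U3 /V1 /V2 /V3 /T0 /Tl /Tb /= => X.
  apply: le_trans (X _ _ _ _ _ _); [lra|ladder..].
- have := @poly V3 [:: U1; Tl; V2] [:: Tb; U2; V1; T0; U3; V2].
  rewrite /chain /cross /U1 /U2 /U3 /V1 /V2 /V3 /T0 /Tl /Tb /= => X.
  apply: le_trans (X _ _ _ _ _ _); [lra|ladder..].
- have := @poly Tb [:: V3; U1; Tl; V2; U3] [:: U2; V1; T0; U3].
  rewrite /chain /cross /U1 /U2 /U3 /V1 /V2 /V3 /T0 /Tl /Tb /= => X.
  apply: le_trans (X _ _ _ _ _ _); [lra|ladder..].
- have := @poly Tb [:: V3; U1; Tl; V2] [:: U2; V1; T0; U3; V2].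
  rewrite /chain /cross /U1 /U2 /U3 /V1 /V2 /V3 /T0 /Tl /Tb /= => X.
  apply: le_trans (X _ _ _ _ _ _); [lra|ladder..].
- have := @poly U2 [:: Tb; V3; U1; Tl; V2; U3] [:: V1; T0; U3].
  rewrite /chain /cross /U1 /U2 /U3 /V1 /V2 /V3 /T0 /Tl /Tb /= => X.
  apply: le_trans (X _ _ _ _ _ _); [lra|ladder..].
- have := @poly U2 [:: Tb; V3; U1; Tl; V2] [:: V1; T0; U3; V2].
  rewrite /chain /cross /U1 /U2 /U3 /V1 /V2 /V3 /T0 /Tl /Tb /= => X.
  apply: le_trans (X _ _ _ _ _ _); [lra|ladder..].
Qed.

Lemma three_chords_unimodal : middle -> 1 + h <= e1 -> e1 <= 2 - h ->
  0 <= t2 -> t2 <= h + a3 -> t2 <= h + 1 - a2 ->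
  (t2 - 2 / 3 <= h - 1 + a3) || (t2 - 2 / 3 <= h - a2) -> 2 / 3 <= area K.
Proof.
move=> mid E1 E2 B1 B2 B3 B4; have := nonagon mid B1 B2 B3 B4; have := e12 E1 E2.
case: mid => /andP[h0 h2] _ _ _.
have : 0 <= h * (1 - 2 * h) by apply: mulr_ge0; lra.
by lra.
Qed.

Lemma three_chords_small : middle -> 1 + h <= e1 -> e1 <= 2 - h -> h <= 1 / 4 ->
  2 / 3 <= area K.
Proof.
move=> mid E1 E2 h4; have := hexagon mid; have := e12 E1 E2.
case: mid => /andP[h0 _] _ _ _.
have : 0 <= h * (1 - 4 * h) by apply: mulr_ge0; lra.
by lra.
Qed.

(** The unit chord on [y = 0] is a horizontal diagonal of the quadrilateral [Tb], [V1], [u],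
    [U1]. *)
Let kite (u : pt) : K u -> 0 <= u.2 -> t2 <= 0 -> (u.2 - t2 + 2 / 3) / 2 <= area K.
Proof.
move=> Ku u0 B1.
have := @poly Tb [:: U1; u] [:: V1; u].
rewrite /chain /cross /U1 /V1 /Tb /= => X.
rewrite -(@ler_pM2l _ 2)//; apply: le_trans (X _ _ _ _ _ _); [lra|ladder..].
Qed.

Let affine_ge0 (A B l u x : R) : l <= x -> x <= u ->
  0 <= A + B * l -> 0 <= A + B * u -> 0 <= A + B * x.
Proof.
move=> lx xu hl hu; have [B0|B0] := leP 0 B.
  have : 0 <= B * (x - l) by apply: mulr_ge0; lra.
  by lra.
have : 0 <= - B * (u - x) by apply: mulr_ge0; lra.
by lra.
Qed.

(* [e1 - e2] is affine in each of [a1], [a2], [a3]; it is minimized at a vertex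
   of the box of admissible parameters. *)
Let hexagon_value : h <= 1 / 3 -> 1 / 4 <= h -> h <= a1 <= 1 - h ->
  1 / 3 + h <= a2 <= 1 - h -> h <= a3 <= 2 / 3 - h ->
  2 / 3 <= e1 - e2 - h * h.
Proof.
move=> h3 h4 /andP[A1 A1'] /andP[A2 A2'] /andP[A3 A3'].
have p1 : 0 <= (1 - 3 * h) * (4 * h - 1) by apply: mulr_ge0; lra.
have step3 (x y : R) : x = h \/ x = 1 - h -> y = 1 / 3 + h \/ y = 1 - h ->
    0 <= (x + y - x * y - h * h - 2 / 3) + (1 - x - y) * a3.
  move=> hx hy; apply: (affine_ge0 A3 A3').
    by case: hx => ->; case: hy => ->; lra.
  by case: hx => ->; case: hy => ->; lra.
have step2 (x : R) : x = h \/ x = 1 - h ->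
    0 <= (x + a3 - x * a3 - h * h - 2 / 3) + (1 - x - a3) * a2.
  move=> hx; apply: (affine_ge0 A2 A2').
    by have := step3 x _ hx (or_introl erefl); lra.
  by have := step3 x _ hx (or_intror erefl); lra.
have : 0 <= (a2 + a3 - a2 * a3 - h * h - 2 / 3) + (1 - a2 - a3) * a1.
  apply: (affine_ge0 A1 A1').
    by have := step2 _ (or_introl erefl); lra.
  by have := step2 _ (or_intror erefl); lra.
by lra.
Qed.

(** If [U3] or [V2] has height at least [2 / 3], the kite is large enough; otherwise [a2] and [a3]
    are restricted so much that the hexagon is. *)
Lemma three_chords_below : middle -> 1 / 4 <= h -> t2 <= 0 -> 2 / 3 <= area K.
Proof.
move=> mid h4 B1; have := hexagon mid.
case: mid => /andP[h0 h2] mA1 /andP[A2 A2'] /andP[A3 A3'].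
have := @kite U3 KU3; have := @kite V2 KV2; rewrite /U3 /V2/= => k1 k2 hx.
have [c1|c1] := leP (2 / 3) (h + a3).
  by have := k2 _ B1; rewrite addr_ge0//; [move=> /(_ isT); lra|lra].
have [c2|c2] := leP (2 / 3) (h + 1 - a2).
  by have := k1 _ B1; rewrite (_ : 0 <= h + 1 - a2); [move=> /(_ isT); lra|lra].
apply: le_trans hx; apply: hexagon_value => //; try lra; apply/andP; split; lra.
Qed.

(** Each of the eight alternatives makes the mixed area estimate large enough for one choice of
    three chord ends. *)
Lemma three_chords_extreme :
  [\/ 2 - h <= e1 \/ e1 <= 1 + h, 1 <= h + a1 \/ a1 <= h, 1 <= h + a2 \/ a2 <= h |
   1 <= h + a3 \/ a3 <= h] -> 2 / 3 <= area K.
Proof.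
have m1 := mixed KV1 KV2 KV3; have m2 := mixed KU2 KU3 KU1.
have m3 := mixed KU2 KV2 KU1; have m4 := mixed KV1 KU3 KV3.
have m5 := mixed KU2 KU3 KV3; have m6 := mixed KV1 KV2 KU1.
have m7 := mixed KV1 KU3 KU1; have m8 := mixed KU2 KV2 KV3.
rewrite /U1 /U2 /U3 /V1 /V2 /V3 /= in m1 m2 m3 m4 m5 m6 m7 m8.
by case=> -[] c; lra.
Qed.

End Fixed.

(** After the extreme positions, small [h] and the positions treated by [three_chords_below], it
    remains to find one among three height functions for which the nonagon is unimodal. The corner
    has heights [t2], [t1] and [w] with sum [2 * h + 2 / 3], which is incompatible with failure of
    all three. *)
Lemma three_chords_area K h a1 a2 a3 t1 t2 : 0 <= h ->
  three_chords K h a1 a2 a3 t1 t2 -> 2 / 3 <= area K.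
Proof.
move=> h0 C.
have ext := three_chords_extreme C.
have [c|c1] := leP (2 - h) (a1 + a2 + a3); first by apply: ext; constructor 1; left.
have [c|c2] := leP (a1 + a2 + a3) (1 + h); first by apply: ext; constructor 1; right.
have [c|c3] := leP 1 (h + a1); first by apply: ext; constructor 2; left.
have [c|c4] := leP a1 h; first by apply: ext; constructor 2; right.
have [c|c5] := leP 1 (h + a2); first by apply: ext; constructor 3; left.
have [c|c6] := leP a2 h; first by apply: ext; constructor 3; right.
have [c|c7] := leP 1 (h + a3); first by apply: ext; constructor 4; left.
have [c|c8] := leP a3 h; first by apply: ext; constructor 4; right.
have mid b1 b2 b3 : h < b1 -> h + b1 < 1 -> h < b2 -> h + b2 < 1 -> h < b3 -> h + b3 < 1 ->
    [/\ 0 <= h <= 1 / 2, h <= b1 <= 1 - h, h <= b2 <= 1 - h & h <= b3 <= 1 - h].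
  by move=> *; split; apply/andP; split; lra.
have [h4|h4] := leP h (1 / 4).
  by apply: (three_chords_small C) => //; [exact: mid|lra|lra].
have [K1 [aK1 C1]] := three_chords_rot C; have [K2 [aK2 C2]] := three_chords_rot C1.
have [b1|b1] := leP t2 0; first by apply: (three_chords_below C); [exact: mid|exact: ltW|].
have [b2|b2] := leP t1 0.
  by rewrite -aK1; apply: (three_chords_below C1); [exact: mid|exact: ltW|].
set w := 2 * h - t1 - t2 + 2 / 3 in C1 C2.
have [b3|b3] := leP w 0.
  by rewrite -aK1 -aK2; apply: (three_chords_below C2); [exact: mid|exact: ltW|].
have uni K' b1' b2' b3' s t : three_chords K' h b1' b2' b3' s t -> area K' = area K ->
    h < b1' -> h + b1' < 1 -> h < b2' -> h + b2' < 1 -> h < b3' -> h + b3' < 1 ->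
    1 + h <= b1' + b2' + b3' -> b1' + b2' + b3' <= 2 - h -> 0 < t ->
    2 / 3 <= area K \/ [\/ h + b3' < t, h + 1 - b2' < t |
      h - 1 + b3' < t - 2 / 3 /\ h - b2' < t - 2 / 3].
  move=> C' aK' *; have [d1|d1] := leP t (h + b3'); last by right; constructor 1.
  have [d2|d2] := leP t (h + 1 - b2'); last by right; constructor 2.
  have [d3|d3] := boolP ((t - 2 / 3 <= h - 1 + b3') || (t - 2 / 3 <= h - b2')).
    by left; rewrite -aK'; apply: (three_chords_unimodal C') => //; [exact: mid|exact: ltW].
  by right; constructor 3; move: d3; rewrite negb_or -!ltNge => /andP[].
have [//|u1] := uni _ _ _ _ _ _ C erefl c4 c3 c6 c5 c8 c7 (ltW c2) (ltW c1) b1.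
have s1 : 1 + h <= a3 + a1 + a2 by clear -c2; lra.
have s1' : a3 + a1 + a2 <= 2 - h by clear -c1; lra.
have [//|u2] := uni _ _ _ _ _ _ C1 aK1 c8 c7 c4 c3 c6 c5 s1 s1' b2.
have s2 : 1 + h <= a2 + a3 + a1 by clear -c2; lra.
have s2' : a2 + a3 + a1 <= 2 - h by clear -c1; lra.
have [//|u3] := uni _ _ _ _ _ _ C2 (etrans aK2 aK1) c6 c5 c8 c7 c4 c3 s2 s2' b3.
rewrite /w in u3 b3.
clear ext mid uni C C1 C2 aK1 aK2 w.
case: u1 => [u1|u1|[u1 u1']]; case: u2 => [u2|u2|[u2 u2']];
  case: u3 => [u3|u3|[u3 u3']]; lra.
Qed.

End ThreeChords.

(** * Reduction of the hexagonal case to three chords *)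

Section SixBodies.
Variable R : realType.
Local Notation pt := (R * R)%type.

(** The lines of the chords bound a right isosceles triangle with legs [2 * |h|]. For [h < 0] a
    point reflection restores the orientation and exchanges the roles of the two opposite
    triangles. *)
Lemma triangles_and_chords_area (K : set pt) (p q s1 s2 s3 : pt) :
  compact K -> convex2 K ->
  [/\ K p, K (p.1 + 2 / 3, p.2) & K (p.1, p.2 + 2 / 3)] ->
  [/\ K q, K (q.1 - 2 / 3, q.2) & K (q.1, q.2 - 2 / 3)] ->
  K s1 /\ K (s1.1 + 1, s1.2) -> K s2 /\ K (s2.1 - 1, s2.2 + 1) ->
  K s3 /\ K (s3.1, s3.2 + 1) -> 2 / 3 <= area K.
Proof.
move=> kK cK [Kp1 Kp2 Kp3] [Kq1 Kq2 Kq3] [K11 K12] [K21 K22] [K31 K32].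
pose h := (s2.1 - s3.1 + s2.2 - s1.2) / 2.
pose a1 := h - s1.1 + s3.1; pose a2 := s2.1 - s3.1 - h.
pose a3 := s3.2 - s1.2 + 1 - h.
have memK (z w : pt) : K z -> w.1 = z.1 -> w.2 = z.2 -> K w.
  by move=> Kz e1 e2; rewrite (surjective_pairing w) e1 e2 -surjective_pairing.
have [h0|h0] := leP 0 h.
  have D0 : 1 * 1 - 0 * 0 != 0 :> R by rewrite mulr0 subr0 mulr1 oner_neq0.
  have [_ E] := area_aff s3.1 s1.2 D0 (compact_finarea kK).
  rewrite mulr0 subr0 mulr1 normr1 mul1r in E; rewrite -E.
  apply: (@three_chords_area R _ h a1 a2 a3 (q.1 - s3.1) (q.2 - s1.2) h0).
  split; [exact: compact_preaff|exact: convex_preaff| | | ]; rewrite /aff/=.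
  - split; [apply: memK K11 _ _|apply: memK K12 _ _|apply: memK K21 _ _|apply: memK K22 _ _];
      rewrite /= /a1 /a2 /h; by field.
  - split; [apply: memK K32 _ _|apply: memK K31 _ _]; rewrite /= /a3; ring.
  - split; [apply: memK Kq1 _ _|apply: memK Kq2 _ _|apply: memK Kq3 _ _]; rewrite /=; ring.
have D0 : -1 * -1 - 0 * 0 != 0 :> R by rewrite mulr0 subr0 mulN1r opprK oner_neq0.
have [_ E] := area_aff s3.1 s1.2 D0 (compact_finarea kK).
rewrite mulr0 subr0 mulN1r opprK normr1 mul1r in E; rewrite -E.
have h0' : 0 <= - h by lra.
apply: (@three_chords_area R _ (- h) (1 - a1) (1 - a2) (1 - a3)
  (s3.1 - p.1) (s1.2 - p.2) h0').
split; [exact: compact_preaff|exact: convex_preaff| | | ]; rewrite /aff/=.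
- split; [apply: memK K12 _ _|apply: memK K11 _ _|apply: memK K22 _ _|apply: memK K21 _ _];
    rewrite /= /a1 /a2 /h; by field.
- split; [apply: memK K31 _ _|apply: memK K32 _ _]; rewrite /= /a3; ring.
- split; [apply: memK Kp1 _ _|apply: memK Kp2 _ _|apply: memK Kp3 _ _]; rewrite /=; ring.
Qed.

End SixBodies.

(** * Closed characteristics and inscribed triangles *)

Section PolygonalCharacteristics.
Variable R : realType.
Local Notation leb := (@lebesgue_measure R).
Local Notation pt := (R * R)%type.
Local Notation phase := ((R * R) * (R * R))%type.

(** A polygonal path takes one unit of time per edge: [step] is a coordinate of its velocity, [ramp]
    the corresponding displacement, [clamp] the integral of a single bump. Half-open intervals make
    the bumps disjoint. *)
Definition unit_bump (i : nat) : R -> R := \1_(`[i%:R, i.+1%:R[%classic).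
Definition clamp (u : R) : R := Num.min 1 (Num.max 0 u).
Definition step n (c : nat -> R) (t : R) : R := \sum_(i < n) c i * unit_bump i t.
Definition ramp n (c : nat -> R) (t : R) : R := \sum_(i < n) c i * clamp (t - i%:R).

Lemma unit_bump_eq i j (t : R) : i%:R <= t < i.+1%:R -> unit_bump j t = (j == i)%:R.
Proof.
move=> /andP[it ti]; rewrite /unit_bump indicE mem_setE in_itv/=; congr (_%:R); congr nat_of_bool.
have [ji|ij|->] := ltngtP j i; last by rewrite it ti.
- apply/negbTE; rewrite negb_and -!leNgt; apply/orP; right.
  by apply: le_trans it; rewrite ler_nat.
- apply/negbTE; rewrite negb_and -!ltNge; apply/orP; left.
  by apply: lt_le_trans ti _; rewrite ler_nat.
Qed.

Lemma clamp_eq1 u : 1 <= u -> clamp u = 1.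
Proof. by move=> h; rewrite /clamp max_r ?min_l //; apply: le_trans h; exact: ler01. Qed.

Lemma clamp_eq0 u : u <= 0 -> clamp u = 0.
Proof. by move=> h; rewrite /clamp max_l ?min_r //; exact: ler01. Qed.

Lemma clamp_id u : 0 <= u -> u <= 1 -> clamp u = u.
Proof. by move=> h h'; rewrite /clamp max_r ?min_r //. Qed.

Lemma step_eq n c i (t : R) : (i < n)%N -> i%:R <= t < i.+1%:R -> step n c t = c i.
Proof.
move=> il it; rewrite /step (bigD1 (Ordinal il))//= (unit_bump_eq _ it) eqxx mulr1.
by rewrite big1 ?addr0// => j; rewrite (unit_bump_eq _ it) -val_eqE/= => /negbTE ->; rewrite mulr0.
Qed.

(** The final time lies in none of the half-open intervals; the zero normal matches the zero
    velocity there. *)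
Lemma step_last n c : step n c n%:R = 0.
Proof.
have nn : ((n%:R : R) <= n%:R) && ((n%:R : R) < n.+1%:R) by rewrite lexx ltr_nat/=.
by rewrite /step big1// => j _; rewrite (unit_bump_eq _ nn) ltn_eqF ?mulr0.
Qed.

Lemma ramp_eq n (x : nat -> R) i (t : R) : (i < n)%N -> i%:R <= t <= i.+1%:R ->
  x 0%N + ramp n (fun j => x j.+1 - x j) t = x i + (t - i%:R) * (x i.+1 - x i).
Proof.
move=> il /andP[it ti]; rewrite /ramp.
rewrite -(big_mkord xpredT (fun j => (x j.+1 - x j) * clamp (t - j%:R))).
rewrite (big_cat_nat (n := i))//=; last exact: ltnW.
rewrite (big_ltn il).
have -> : \sum_(i.+1 <= j < n) (x j.+1 - x j) * clamp (t - j%:R) = 0.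
  rewrite big_nat big1// => j /andP[ij _]; rewrite clamp_eq0 ?mulr0// subr_le0.
  by apply: (le_trans ti); rewrite ler_nat.
rewrite clamp_id ?subr_ge0//; last by rewrite lerBlDl natr1.
have -> : \sum_(0 <= j < i) (x j.+1 - x j) * clamp (t - j%:R) = x i - x 0%N.
  rewrite -telescope_sumr//; apply: eq_big_nat => j /andP[_ ji].
  rewrite clamp_eq1 ?mulr1// lerBrDl natr1.
  by apply: le_trans it; rewrite ler_nat.
by ring.
Qed.

Lemma ramp_nat n (x : nat -> R) i : (0 < n)%N -> (i <= n)%N ->
  x 0%N + ramp n (fun j => x j.+1 - x j) i%:R = x i.
Proof.
move=> n0; rewrite leq_eqVlt => /predU1P[->|il]; last first.
  by rewrite (ramp_eq _ il) ?subrr ?mul0r ?addr0//; rewrite lexx ler_nat/=.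
case: n n0 => // n _; rewrite (ramp_eq _ (ltnSn n)); first by rewrite -natr1; ring.
by rewrite lexx ler_nat leqnSn.
Qed.

Lemma ramp0 n c : ramp n c 0 = 0.
Proof.
by rewrite /ramp big1// => j _; rewrite clamp_eq0 ?mulr0// sub0r oppr_le0 ler0n.
Qed.

Lemma integrable_step D n c : measurable D -> leb.-integrable D (EFin \o step n c).
Proof.
move=> mD; apply: (@integrableS _ _ _ _ setT) => //.
rewrite (_ : _ \o _ = fun t => \sum_(i < n) ((c i)%:E * (unit_bump i t)%:E))%E; last first.
  by apply/funext => t/=; rewrite /step -sumEFin; apply: eq_bigr => i _.
apply: integrable_sum => // i _; apply: integrableZl => //.
exact: integrable_indic_itv.
Qed.

Lemma integral_unit_bump i (t : R) : 0 <= t ->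
  \int[leb]_(s in `[0, t]%classic) unit_bump i s = clamp (t - i%:R).
Proof.
move=> t0; rewrite /Rintegral integral_indic//.
have i0 : 0 <= i%:R :> R by rewrite ler0n.
have [ti|it] := leP t i%:R; last have [ti|ti] := leP i.+1%:R t.
- rewrite clamp_eq0 ?subr_le0//.
  have E : lebesgue_measure (if t == i%:R then [set t] else set0) = 0%E.
    by case: ifP => _; [exact: lebesgue_measure_set1|exact: measure0].
  rewrite (_ : _ `&` _ = if t == i%:R then [set t] else set0).
    by rewrite [X in fine X]E.
  apply/seteqP; split => s; rewrite /= ?in_itv/=.
    move=> [/andP[s1 s2] /andP[s3 s4]].
    have ts : t = i%:R by apply/eqP; rewrite eq_le ti (le_trans s1 s4).
    by rewrite ts eqxx /=; apply/eqP; rewrite eq_le s1 -ts s4.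
  have [ti'|//] := eqVneq t i%:R => /= ->.
  by rewrite ti' lexx i0 ltr_nat ltnSn.
- rewrite clamp_eq1; last by rewrite lerBrDl natr1.
  rewrite (_ : _ `&` _ = `[i%:R, i.+1%:R[%classic).
    have E : lebesgue_measure (`[i%:R, i.+1%:R[%classic : set R) = 1%E.
      rewrite lebesgue_measure_itv/= lte_fin ltr_nat ltnSn -EFinB.
      by rewrite -natr1 addrAC subrr add0r.
    by rewrite [X in fine X]E.
  apply/seteqP; split => s; rewrite /= !in_itv/=; first by case.
  move=> /andP[s1 s2]; split; first by rewrite s1 s2.
  by rewrite (le_trans i0 s1)/= (le_trans (ltW s2) ti).
- rewrite clamp_id; [|by rewrite subr_ge0 ltW|by rewrite lerBlDl natr1 ltW].
  rewrite (_ : _ `&` _ = `[i%:R, t]%classic).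
    have E : lebesgue_measure (`[i%:R, t]%classic : set R) = (t - i%:R)%:E.
      by rewrite lebesgue_measure_itv/= lte_fin it -EFinB.
    by rewrite [X in fine X]E.
  apply/seteqP; split => s; rewrite /= !in_itv/=.
    by move=> [/andP[-> _] /andP[_ ->]].
  move=> /andP[s1 s2]; rewrite s1 s2 (le_lt_trans s2 ti) (le_trans i0 s1).
  by split.
Qed.

Lemma integral_step n c (t : R) : 0 <= t ->
  \int[leb]_(s in `[0, t]%classic) step n c s = ramp n c t.
Proof.
move=> t0; have mD : measurable (`[0, t]%classic : set R) by [].
elim: n => [|n IH].
  rewrite /ramp big_ord0; under eq_Rintegral do rewrite /step big_ord0.
  by rewrite Rintegral_cst// mul0r.
rewrite /ramp big_ord_recr/= -/(ramp n c t) -IH -integral_unit_bump//.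
have ib : leb.-integrable `[0, t]%classic (EFin \o unit_bump n).
  by apply: (@integrableS _ _ _ _ setT) => //; exact: integrable_indic_itv.
rewrite -RintegralZl// -RintegralD//; first last.
- rewrite (_ : _ \o _ = fun s => (c n)%:E * (unit_bump n s)%:E)%E; last by apply/funext.
  exact: integrableZl.
- exact: integrable_step.
by apply: eq_Rintegral => s _; rewrite /step big_ord_recr.
Qed.

(** From an interior point one could move a little in the direction [nu] within [C], which would
    increase the pairing with [nu]. *)
Lemma bdry_of_normal (C : set phase) z (nu : phase) : C z -> normal_cone C z nu ->
  nu != ((0, 0), (0, 0)) -> bdry C z.
Proof.
move=> Cz Nz nu0; split; first exact: subset_closure.
rewrite /interior /= => Cn.
pose ray (e : R) : phase := ((z.1.1 + e * nu.1.1, z.1.2 + e * nu.1.2),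
  (z.2.1 + e * nu.2.1, z.2.2 + e * nu.2.2)).
have ray0 : ray 0 = z.
  by case: z {Cz Nz Cn} @ray => [[a b] [a' b']]; rewrite /= !mul0r !addr0.
have cray : continuous ray.
  have L (a b : R) : continuous (fun e : R => a + e * b).
    move=> e; apply: cvgD; first exact: cvg_cst.
    by apply: cvgM; [exact: cvg_id|exact: cvg_cst].
  by apply: continuous_mkpair; apply: continuous_mkpair; exact: L.
have : \forall e \near (0 : R), C (ray e).
  by have := cray 0; rewrite /continuous_at ray0; apply.
move=> /nbhs_ballP[d /= d0 Cd].
have e0 : 0 < d / 2 by lra.
have /Nz : C (ray (d / 2)).
  by apply: Cd; rewrite /ball/= sub0r normrN gtr0_norm//; lra.
rewrite /dot4 /sub4 /dot2 /sub2 /ray/= => h.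
have {}h : d / 2 * (nu.1.1 ^+ 2 + nu.1.2 ^+ 2 + nu.2.1 ^+ 2 + nu.2.2 ^+ 2) <= 0 by lra.
move: h; rewrite pmulr_rle0// => h.
have q1 := sqr_ge0 nu.1.1; have q2 := sqr_ge0 nu.1.2.
have q3 := sqr_ge0 nu.2.1; have q4 := sqr_ge0 nu.2.2.
move/negP: nu0; apply; rewrite [nu]surjective_pairing [nu.1]surjective_pairing [nu.2]surjective_pairing.
have z1 (a : R) : a ^+ 2 <= 0 -> a = 0.
  by move=> a0; apply/eqP; rewrite -sqrf_eq0 eq_le a0 sqr_ge0.
have -> : nu.1.1 = 0 by apply: z1; clear -h q2 q3 q4; lra.
have -> : nu.1.2 = 0 by apply: z1; clear -h q1 q3 q4; lra.
have -> : nu.2.1 = 0 by apply: z1; clear -h q1 q2 q4; lra.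
by have -> : nu.2.2 = 0 by apply: z1; clear -h q1 q2 q3; lra.
Qed.

Definition segment2 (z w : phase) (s : R) : phase :=
  ((z.1.1 + s * (w.1.1 - z.1.1), z.1.2 + s * (w.1.2 - z.1.2)),
   (z.2.1 + s * (w.2.1 - z.2.1), z.2.2 + s * (w.2.2 - z.2.2))).

(** By the last hypothesis only position or only momentum moves on an edge, so [p dq] is constant
    there and the action is a finite sum. *)
Lemma EHZ_le_polygon (C : set phase) n (z : nat -> phase) :
  (0 < n)%N -> z n = z 0%N -> (exists2 i, (i <= n)%N & z i <> z 0%N) ->
  (forall i (s : R), (i < n)%N -> 0 <= s <= 1 ->
    bdry C (segment2 (z i) (z i.+1) s) /\
    exists nu, normal_cone C (segment2 (z i) (z i.+1) s) nu /\
      sub4 (z i.+1) (z i) = Jmap nu) ->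
  (forall i, (i < n)%N -> (z i.+1).1 = (z i).1 \/ (z i.+1).2 = (z i).2) ->
  EHZ C <= `|\sum_(i < n) dot2 (z i).2 (sub2 (z i.+1).1 (z i).1)|.
Proof.
move=> n0 zn [m mn zm] seg alt.
pose diff (f : phase -> R) j : R := f (z j.+1) - f (z j).
pose gc (f : phase -> R) (t : R) : R := f (z 0%N) + ramp n (diff f) t.
pose f1 (w : phase) : R := w.1.1. pose f2 (w : phase) : R := w.1.2.
pose f3 (w : phase) : R := w.2.1. pose f4 (w : phase) : R := w.2.2.
pose g t : phase := ((gc f1 t, gc f2 t), (gc f3 t, gc f4 t)).
pose v t : phase := ((step n (diff f1) t, step n (diff f2) t),
  (step n (diff f3) t, step n (diff f4) t)).
have gE i (t : R) : (i < n)%N -> i%:R <= t <= i.+1%:R ->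
    g t = segment2 (z i) (z i.+1) (t - i%:R).
  move=> il it; have H f : gc f t = f (z i) + (t - i%:R) * (f (z i.+1) - f (z i)).
    exact: (ramp_eq (fun j => f (z j))).
  by rewrite /g !H.
have gnat i : (i <= n)%N -> g i%:R = z i.
  move=> il; have H f : gc f i%:R = f (z i) by exact: (ramp_nat (fun j => f (z j))).
  by rewrite /g !H /f1 /f2 /f3 /f4 -!surjective_pairing.
have vE i (t : R) : (i < n)%N -> i%:R <= t < i.+1%:R -> v t = sub4 (z i.+1) (z i).
  by move=> il it; rewrite /v !(step_eq _ il it).
have locate (t : R) : 0 <= t <= n%:R ->
    t = n%:R \/ exists2 i, (i < n)%N & i%:R <= t < i.+1%:R.
  move=> /andP[t0]; rewrite le_eqVlt => /predU1P[->|tn]; first by left.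
  right; have it := truncn_itv t0; exists (Num.truncn t) => //.
  by rewrite -(ltr_nat R); case/andP: it => it _; exact: le_lt_trans it tn.
have place (t : R) : 0 <= t <= n%:R ->
    exists2 i, (i < n)%N & i%:R <= t <= i.+1%:R.
  move=> /locate[->|[i il /andP[it ti]]]; last by exists i => //; rewrite it ltW.
  by exists n.-1; rewrite prednK// ler_nat leq_pred/=.
have unit i (t : R) : i%:R <= t <= i.+1%:R -> 0 <= t - i%:R <= 1.
  by move=> /andP[it ti]; rewrite subr_ge0 it lerBlDl natr1.
have CC : closed_characteristic C n%:R g v.
  split; first by rewrite ltr0n.
  split; first by rewrite (gnat 0%N)// gnat// zn.
  split.
    move=> t /place[i il it]; rewrite (gE i)//.
    by have [] := seg i _ il (unit _ _ it).
  split.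
    by exists m%:R; rewrite ler0n ler_nat mn (gnat 0%N)// gnat.
  split.
    move=> i; case: i => -[|[|[|[|//]]]] lti; rewrite /comp4/=;
    exact: integrable_step.
  split.
    move=> i t /andP[t0 tn].
    by case: i => -[|[|[|[|//]]]] lti; rewrite /comp4/= integral_step// /gc ramp0 addr0.
  apply: aeW => t; rewrite /= in_itv/= => tn.
  have [->|[i il it]] := locate _ tn.
    exists ((0, 0), (0, 0)); split.
      by move=> y _; rewrite /dot4 /dot2/= !mul0r !addr0.
    by rewrite /v !step_last /Jmap/= oppr0.
  have it' : i%:R <= t <= i.+1%:R by case/andP: it => -> /ltW.
  have [_ [nu [Nnu Enu]]] := seg i _ il (unit _ _ it').
  by exists nu; rewrite (gE i)// (vE i).
have aE : action n%:R g v = \sum_(i < n) dot2 (z i).2 (sub2 (z i.+1).1 (z i).1).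
  pose c j : R := dot2 (z j).2 (sub2 (z j.+1).1 (z j).1).
  transitivity (\int[leb]_(t in `[0, n%:R]%classic) step n c t).
    apply: eq_Rintegral => t; rewrite inE/= in_itv/= => tn.
    have [->|[i il it]] := locate _ tn; first by rewrite !step_last !mulr0 addr0.
    have it' : i%:R <= t <= i.+1%:R by case/andP: it => -> /ltW.
    rewrite (step_eq c il it).
    change ((g t).2.1 * (v t).1.1 + (g t).2.2 * (v t).1.2 = c i).
    rewrite (vE i)// (gE i)//.
    rewrite /c /dot2 /sub4 /sub2 /segment2/=.
    by have [->|->] := alt i il; ring.
  rewrite integral_step ?ler0n// /ramp; apply: eq_bigr => i _.
  by rewrite clamp_eq1 ?mulr1// lerBrDl natr1 ler_nat.
rewrite /EHZ; apply: ge_inf; first by exists 0 => _ [? [? [? [_ ->]]]].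
by exists n%:R, g, v; rewrite aE.
Qed.

End PolygonalCharacteristics.

(** * Closed characteristics from a pair of triangles *)

Section TriangularCharacteristics.
Variable R : realType.
Local Notation pt := (R * R)%type.
Local Notation phase := ((R * R) * (R * R))%type.
Implicit Types (K Q : set pt) (k y n m : pt).

Definition normal2 K k n : Prop := forall x, K x -> dot2 n (sub2 x k) <= 0.

Lemma sub2_eq0 (p q : pt) : sub2 p q = (0, 0) -> p = q.
Proof.
by case: p q => [a b] [c d] []/= /eqP; rewrite subr_eq0 => /eqP -> /eqP; rewrite subr_eq0 => /eqP ->.
Qed.

Definition segment_ok (C : set phase) (z w : phase) : Prop := forall s : R, 0 <= s <= 1 ->
  bdry C (segment2 z w s) /\
  exists nu, normal_cone C (segment2 z w s) nu /\ sub4 w z = Jmap nu.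

Lemma normal_prod K Q k y n m : normal2 K k n -> normal2 Q y m ->
  normal_cone (K `*` Q) (k, y) (n, m).
Proof.
move=> Nn Nm [x u] [/= /Nn h1 /Nm h2]; by rewrite /dot4 /=; have := lerD h1 h2; rewrite addr0.
Qed.

Lemma normal2_0 K k : normal2 K k (0, 0).
Proof. by move=> x _; rewrite /dot2/= !mul0r addr0. Qed.

Lemma convex2_segment K k k' (s : R) : convex2 K -> K k -> K k' -> 0 <= s <= 1 ->
  K (k.1 + s * (k'.1 - k.1), k.2 + s * (k'.2 - k.2)).
Proof.
move=> cK Kk Kk' /andP[s0 s1]; have := cK _ _ Kk' Kk s s0 s1.
by congr K; congr pair; ring.
Qed.

(* A constant piece of the path satisfies the inclusion trivially, but its point must
   still lie on the boundary: hence the nonzero normal [m]. *)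
Lemma segment_ok_momentum K Q k y y' : convex2 Q -> K k -> Q y -> Q y' ->
  normal2 K k (sub2 y' y) ->
  (y' = y -> exists m, normal2 Q y m /\ m != (0, 0)) -> segment_ok (K `*` Q) (k, y) (k, y').
Proof.
move=> cQ Kk Qy Qy' Nn nz s s01; pose x : pt := (y.1 + s * (y'.1 - y.1), y.2 + s * (y'.2 - y.2)).
have Qx : Q x by exact: convex2_segment.
have -> : segment2 (k, y) (k, y') s = (k, x).
  by rewrite /segment2/= !subrr !mulr0 !addr0 -surjective_pairing.
have Nk : normal_cone (K `*` Q) (k, x) (sub2 y' y, (0, 0)).
  by apply: normal_prod => //; exact: normal2_0.
split; last first.
  by exists (sub2 y' y, (0, 0)); split => //; rewrite /sub4 /Jmap /sub2/= !subrr oppr0.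
have [/sub2_eq0 yy|yy] := eqVneq (sub2 y' y) (0, 0).
  have [m [Nm m0]] := nz yy.
  have xy : x = y by rewrite /x yy !subrr !mulr0 !addr0 -surjective_pairing.
  rewrite xy; apply: (@bdry_of_normal _ _ _ ((0, 0), m)) => //.
    by apply: normal_prod => //; exact: normal2_0.
  by apply: contra m0 => /eqP -[->].
by apply: (bdry_of_normal _ Nk) => //; apply: contra yy => /eqP -[y1 y2]; rewrite /sub2 y1 y2.
Qed.

Lemma segment_ok_position K Q k k' y : convex2 K -> K k -> K k' -> Q y ->
  normal2 Q y (sub2 k k') ->
  (k = k' -> exists n, normal2 K k n /\ n != (0, 0)) -> segment_ok (K `*` Q) (k, y) (k', y).
Proof.
move=> cK Kk Kk' Qy Nm nz s s01; pose x : pt := (k.1 + s * (k'.1 - k.1), k.2 + s * (k'.2 - k.2)).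
have Kx : K x by exact: convex2_segment.
have -> : segment2 (k, y) (k', y) s = (x, y).
  by rewrite /segment2/= !subrr !mulr0 !addr0 -surjective_pairing.
have Ny : normal_cone (K `*` Q) (x, y) ((0, 0), sub2 k k').
  by apply: normal_prod => //; exact: normal2_0.
split; last first.
  exists ((0, 0), sub2 k k'); split => //.
  by rewrite /sub4 /Jmap /sub2/= !subrr !opprB.
have [/sub2_eq0 kk|kk] := eqVneq (sub2 k k') (0, 0).
  have [n [Nn n0]] := nz kk.
  have xk : x = k by rewrite /x -kk !subrr !mulr0 !addr0 -surjective_pairing.
  rewrite xk; apply: (@bdry_of_normal _ _ _ (n, (0, 0))) => //.
    by apply: normal_prod => //; exact: normal2_0.
  by apply: contra n0 => /eqP -[->].
by apply: (bdry_of_normal _ Ny) => //; apply: contra kk => /eqP -[k1 k2]; rewrite /sub2 k1 k2.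
Qed.

(** The path alternates between bounces, where the momentum moves along a normal of [K], and
    flights, where the position moves against a normal of [Q]; the signs are those of [Jmap].
    Corners may coincide: a constant piece borrows a nonzero normal from an adjacent piece, and one
    exists unless all three corners agree. *)
Lemma capacity_le_triangle K Q k1 k2 k3 y1 y2 y3 : convex2 K -> convex2 Q ->
  [/\ K k1, K k2 & K k3] -> [/\ Q y1, Q y2 & Q y3] ->
  [/\ normal2 K k1 (sub2 y2 y1), normal2 K k2 (sub2 y3 y2) & normal2 K k3 (sub2 y1 y3)] ->
  [/\ normal2 Q y2 (sub2 k1 k2), normal2 Q y3 (sub2 k2 k3) & normal2 Q y1 (sub2 k3 k1)] ->
  ~ (y1 = y2 /\ y2 = y3) -> ~ (k1 = k2 /\ k2 = k3) ->
  lagr_capacity K Q <=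
    `|dot2 y2 (sub2 k2 k1) + dot2 y3 (sub2 k3 k2) + dot2 y1 (sub2 k1 k3)|.
Proof.
move=> cK cQ [K1 K2 K3] [Q1 Q2 Q3] [N1 N2 N3] [M2 M3 M1] yne kne.
pose z i : phase := nth (k1, y1)
  [:: (k1, y1); (k1, y2); (k2, y2); (k2, y3); (k3, y3); (k3, y1); (k1, y1)] i.
have sub0 (p : pt) : sub2 p p = (0, 0) by rewrite /sub2 !subrr.
have d0 (p q : pt) : dot2 p (sub2 q q) = 0 by rewrite sub0 /dot2/= !mulr0 addr0.
have key K' q p1 p2 p3 : normal2 K' q (sub2 p1 p2) -> normal2 K' q (sub2 p2 p3) ->
    ~ (p1 = p2 /\ p2 = p3) -> exists m, normal2 K' q m /\ m != (0, 0).
  move=> h1 h2 ne; have [/sub2_eq0 e1|e1] := eqVneq (sub2 p1 p2) (0, 0).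
    exists (sub2 p2 p3); split => //; apply/eqP => /sub2_eq0 e2; exact: ne.
  by exists (sub2 p1 p2).
have yne' : ~ (y3 = y2 /\ y2 = y1) by move=> [e1 e2]; apply: yne.
have := @EHZ_le_polygon R (K `*` Q) 6 z.
rewrite !big_ord_recl big_ord0 /= !d0 !add0r !addr0 addrA; apply => //.
- have [e|ne1] := eqVneq y2 y1; last by exists 1%N => // -[] /eqP; apply/negP.
  exists 3 => // -[_ e3]; apply: yne; split; congruence.
- move=> [|[|[|[|[|[|//]]]]]] s _ s01.
  + apply: segment_ok_momentum => // e; apply: (key _ _ k3 k1 k2) => //; first by rewrite -e.
    by move=> [e1 e2]; apply: kne; split; congruence.
  + apply: segment_ok_position => // e; apply: (key _ _ y3 y2 y1) => //; by rewrite e.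
  + apply: segment_ok_momentum => // e; apply: (key _ _ k1 k2 k3) => //; by rewrite -e.
  + apply: segment_ok_position => // e; apply: (key _ _ y1 y3 y2) => //; first by rewrite e.
    by move=> [e1 e2]; apply: yne; split; congruence.
  + apply: segment_ok_momentum => // e; apply: (key _ _ k2 k3 k1) => //; first by rewrite -e.
    by move=> [e1 e2]; apply: kne; split; congruence.
  + apply: segment_ok_position => // e; apply: (key _ _ y2 y1 y3) => //; first by rewrite e.
    by move=> [e1 e2]; apply: yne; split; congruence.
- by move=> [|[|[|[|[|[|//]]]]]] _; [left|right|left|right|left|right].
Qed.

End TriangularCharacteristics.

Section ContinuityRules.
Variables (R : realType) (T : topologicalType).
Implicit Types (f g : T -> R).

Lemma continuous_add f g : continuous f -> continuous g -> continuous (fun x => f x + g x).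
Proof. by move=> cf cg x; apply: cvgD; [exact: cf|exact: cg]. Qed.

Lemma continuous_sub f g : continuous f -> continuous g -> continuous (fun x => f x - g x).
Proof. by move=> cf cg x; apply: cvgB; [exact: cf|exact: cg]. Qed.

Lemma continuous_mul f g : continuous f -> continuous g -> continuous (fun x => f x * g x).
Proof. by move=> cf cg x; apply: cvgM; [exact: cf|exact: cg]. Qed.

Lemma continuous_fst (U V : topologicalType) (h : T -> U * V) :
  continuous h -> continuous (fun x => (h x).1).
Proof. by move=> ch x; apply: (cvg_comp _ _ (ch x)); exact: cvg_fst. Qed.

Lemma continuous_snd (U V : topologicalType) (h : T -> U * V) :
  continuous h -> continuous (fun x => (h x).2).
Proof. by move=> ch x; apply: (cvg_comp _ _ (ch x)); exact: cvg_snd. Qed.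

Lemma continuous_const (U : topologicalType) (c : U) : continuous (fun _ : T => c).
Proof. by move=> x; exact: cvg_cst. Qed.

Lemma continuous_idfun : continuous (fun x : T => x).
Proof. by move=> x; exact: cvg_id. Qed.

End ContinuityRules.

Ltac solve_continuous := repeat lazymatch goal with
  | |- continuous (fun x => x) => exact: continuous_idfun
  | |- continuous (fun _ => ?c) => exact: continuous_const
  | |- continuous (fun x => @?f x + - @?g x) => apply: (@continuous_sub _ _ f g)
  | |- continuous (fun x => @?f x + @?g x) => apply: (@continuous_add _ _ f g)
  | |- continuous (fun x => @?f x * @?g x) => apply: (@continuous_mul _ _ f g)
  | |- continuous (fun x => (@?f x, @?g x)) => apply: (@continuous_mkpair _ _ _ f g)
  | |- continuous (fun x => fst (@?h x)) => apply: (@continuous_fst _ _ _ h)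
  | |- continuous (fun x => snd (@?h x)) => apply: (@continuous_snd _ _ _ h)
  end.

(** * Separation for inscribed triangles *)

Section Separation.
Variable R : realType.
Local Notation pt := (R * R)%type.
Implicit Types (K : set pt) (v w t : pt).

Definition fits K v1 v2 v3 (mu : R) : Prop := exists t,
  [/\ K (t.1 + mu * v1.1, t.2 + mu * v1.2), K (t.1 + mu * v2.1, t.2 + mu * v2.2) &
      K (t.1 + mu * v3.1, t.2 + mu * v3.2)].

Lemma quadratic_min (L E : R) : 0 <= E ->
  (forall s : R, 0 < s -> s <= 1 -> 0 <= s * (2 * L + s * E)) -> 0 <= L.
Proof.
move=> E0 h; rewrite leNgt; apply/negP => L0.
have D0 : 0 < E - L by lra.
(* For this [s] one has [2 * L + s * E = L + s * L], which is negative. *)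
have s0 : 0 < - L / (E - L) by rewrite divr_gt0//; lra.
have s1 : - L / (E - L) <= 1 by rewrite ler_pdivrMr// mul1r; lra.
have := h _ s0 s1; rewrite pmulr_rge0// => h1.
have : - L / (E - L) * (E - L) = - L by rewrite divfK// gt_eqF.
by have : - L / (E - L) * L < 0 by [rewrite pmulr_rlt0]; lra.
Qed.

(** Differences with the third corner remove the translation: [fits] says that a point of four-space
    lies in the compact convex set of pairs [(k1 - k3, k2 - k3)]. The nearest point of that set
    gives a separating functional; since the triangle fits at scale [mu], it is positive on the
    triangle and can be normalized to 1. *)
Lemma separate_at K v1 v2 v3 t (mu e : R) : compact K -> convex2 K ->
  K (t.1 + mu * v1.1, t.2 + mu * v1.2) -> K (t.1 + mu * v2.1, t.2 + mu * v2.2) ->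
  K (t.1 + mu * v3.1, t.2 + mu * v3.2) -> 0 < e -> ~ fits K v1 v2 v3 (mu + e) ->
  exists n1 n2 : pt, dot2 n1 (sub2 v1 v3) + dot2 n2 (sub2 v2 v3) = 1 /\
    forall k1 k2 k3, K k1 -> K k2 -> K k3 ->
      dot2 n1 (sub2 k1 k3) + dot2 n2 (sub2 k2 k3) <= mu + e.
Proof.
move=> kK cK K1 K2 K3 e0 nf; pose M := mu + e.
pose A : set (pt * pt * pt) := K `*` K `*` K.
have kA : compact A by apply: compact_setX => //; exact: compact_setX.
have A0 : A !=set0.
  by exists ((t.1 + mu * v1.1, t.2 + mu * v1.2), (t.1 + mu * v2.1, t.2 + mu * v2.2),
    (t.1 + mu * v3.1, t.2 + mu * v3.2)).
pose a (k1 k3 : pt) : pt := (k1.1 - k3.1 - M * (v1.1 - v3.1), k1.2 - k3.2 - M * (v1.2 - v3.2)).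
pose b (k2 k3 : pt) : pt := (k2.1 - k3.1 - M * (v2.1 - v3.1), k2.2 - k3.2 - M * (v2.2 - v3.2)).
pose F (k : pt * pt * pt) : R := dot2 (a k.1.1 k.2) (a k.1.1 k.2) + dot2 (b k.1.2 k.2) (b k.1.2 k.2).
have cF : {within A, continuous F}.
  by apply: continuous_subspaceT; rewrite /F /a /b /dot2/=; solve_continuous.
have [[[x y] z] + Fmin] := compact_EVT_min A0 kA cF.
rewrite inE => -[[/= Kx Ky] Kz].
set p := a x z; set q := b y z.
have S0 : 0 < dot2 p p + dot2 q q.
  have sq (u : pt) : dot2 u u = u.1 ^+ 2 + u.2 ^+ 2 by rewrite /dot2 !expr2.
  have := sqr_ge0 p.1; have := sqr_ge0 p.2; have := sqr_ge0 q.1; have := sqr_ge0 q.2.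
  move=> h1 h2 h3 h4; rewrite ltNge; apply/negP; rewrite !sq => S0; apply: nf.
  have z1 (c : R) : c ^+ 2 <= 0 -> c = 0.
    by move=> c0; apply/eqP; rewrite -sqrf_eq0 eq_le c0 sqr_ge0.
  have p1 : p.1 = 0 by apply: z1; clear -S0 h1 h2 h3 h4; lra.
  have p2 : p.2 = 0 by apply: z1; clear -S0 h1 h2 h3 h4; lra.
  have q1 : q.1 = 0 by apply: z1; clear -S0 h1 h2 h3 h4; lra.
  have q2 : q.2 = 0 by apply: z1; clear -S0 h1 h2 h3 h4; lra.
  exists (z.1 - M * v3.1, z.2 - M * v3.2); split => /=; rewrite -/M.
  - move: Kx; rewrite [x]surjective_pairing; congr K; congr pair; [move: p1|move: p2];
      rewrite /p /a/=; clear; lra.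
  - move: Ky; rewrite [y]surjective_pairing; congr K; congr pair; [move: q1|move: q2];
      rewrite /q /b/=; clear; lra.
  - by move: Kz; rewrite {1}[z]surjective_pairing; congr K; congr pair; ring.
have opt k1 k2 k3 : K k1 -> K k2 -> K k3 ->
    0 <= dot2 p (sub2 (sub2 k1 x) (sub2 k3 z)) + dot2 q (sub2 (sub2 k2 y) (sub2 k3 z)).
  move=> H1 H2 H3.
  set d1 := sub2 _ _; set d2 := sub2 (sub2 k2 y) _.
  apply: (@quadratic_min _ (dot2 d1 d1 + dot2 d2 d2)).
    by rewrite /dot2 -!expr2; rewrite !addr_ge0// sqr_ge0.
  move=> s s0 s1.
  have := Fmin ((s * k1.1 + (1 - s) * x.1, s * k1.2 + (1 - s) * x.2),
    (s * k2.1 + (1 - s) * y.1, s * k2.2 + (1 - s) * y.2),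
    (s * k3.1 + (1 - s) * z.1, s * k3.2 + (1 - s) * z.2)).
  rewrite inE /A /= => /(_ _)/wrap[].
    by split; [split|]; apply: cK => //; exact: ltW.
  rewrite -subr_ge0; congr (0 <= _).
  by rewrite /F /p /q /d1 /d2 /a /b /dot2 /sub2/=; ring.
pose s := - (dot2 p (sub2 v1 v3) + dot2 q (sub2 v2 v3)).
have bound k1 k2 k3 : K k1 -> K k2 -> K k3 ->
    - (dot2 p (sub2 k1 k3) + dot2 q (sub2 k2 k3)) <= M * s - (dot2 p p + dot2 q q).
  move=> H1 H2 H3; have := opt _ _ _ H1 H2 H3; rewrite -subr_ge0 => h.
  by rewrite -subr_ge0; move: h; congr (0 <= _); rewrite /s /p /q /a /b /dot2 /sub2/=; ring.
have s0 : 0 < s.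
  have := bound _ _ _ K1 K2 K3; rewrite (_ : - _ = mu * s); last first.
    by rewrite /s /dot2 /sub2/=; ring.
  rewrite /M => h; have : 0 < e * s by clear -h S0; lra.
  by rewrite pmulr_rgt0.
have sn : s != 0 by rewrite gt_eqF.
have sE : s = - (dot2 p (sub2 v1 v3) + dot2 q (sub2 v2 v3)) by [].
clearbody s p q.
exists (- p.1 / s, - p.2 / s), (- q.1 / s, - q.2 / s); split.
  rewrite (_ : _ + _ = - (dot2 p (sub2 v1 v3) + dot2 q (sub2 v2 v3)) / s).
    by rewrite -sE divff.
  by rewrite /dot2 /sub2/=; field.
move=> k1 k2 k3 H1 H2 H3; have := bound _ _ _ H1 H2 H3 => h.
rewrite (_ : _ + _ = - (dot2 p (sub2 k1 k3) + dot2 q (sub2 k2 k3)) / s); last first.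
  by rewrite /dot2 /sub2/=; field.
by rewrite ler_pdivrMr//; apply: (le_trans h); rewrite gerBl ltW.
Qed.

Lemma interior_square K : interior K !=set0 -> exists (o : pt) (r : R), 0 < r /\
  forall x y : R, `|x| <= r -> `|y| <= r -> K (o.1 + x, o.2 + y).
Proof.
move=> [ o /nbhs_ballP[r /= r0 oK]]; exists o, (r / 2); split; first by rewrite divr_gt0.
have step0 (a x : R) : `|x| <= r / 2 -> ball a r (a + x).
  by rewrite /ball/= opprD addNKr normrN => /le_lt_trans; apply; lra.
by move=> x y xr yr; apply: oK; split; exact: step0.
Qed.

Lemma cluster_le (T : topologicalType) (F : set_system T) (f : T -> R) x (M : R) :
  continuous f -> cluster F x -> F [set y | f y <= M] -> f x <= M.
Proof.
move=> cf clx FM; rewrite leNgt; apply/negP => Mx.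
have : nbhs x [set y | M < f y].
  by apply: (cf x [set y | M < y]); apply: open_nbhs_nbhs; split => //; exact: open_gt.
by move=> /(clx _ _ FM)[y [/= h1 h2]]; move: (lt_le_trans h2 h1); rewrite ltxx.
Qed.

(** At scale [mu] the triangle still fits and cannot be strictly separated, so the functionals for
    [mu + e] are followed as [e] tends to 0. They are bounded because [K] contains a square, and a
    cluster point takes its maximum [mu] at the contact points. The third normal is minus the sum of
    the other two. *)
Lemma separating_normals K v1 v2 v3 t (mu d : R) : convex_shape K -> 0 <= mu ->
  K (t.1 + mu * v1.1, t.2 + mu * v1.2) -> K (t.1 + mu * v2.1, t.2 + mu * v2.2) ->
  K (t.1 + mu * v3.1, t.2 + mu * v3.2) ->
  0 < d -> (forall e, 0 < e -> e <= d -> ~ fits K v1 v2 v3 (mu + e)) ->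
  exists n1 n2 n3 : pt, [/\ n1.1 + n2.1 + n3.1 = 0, n1.2 + n2.2 + n3.2 = 0,
    dot2 n1 v1 + dot2 n2 v2 + dot2 n3 v3 = 1 &
    [/\ normal2 K (t.1 + mu * v1.1, t.2 + mu * v1.2) n1,
        normal2 K (t.1 + mu * v2.1, t.2 + mu * v2.2) n2 &
        normal2 K (t.1 + mu * v3.1, t.2 + mu * v3.2) n3]].
Proof.
move=> [kK [cK iK]] mu0 K1 K2 K3 d0 nf.
pose val (n : pt * pt) (x y z : pt) : R := dot2 n.1 (sub2 x z) + dot2 n.2 (sub2 y z).
pose G (e : R) : set (pt * pt) := [set n | val n v1 v2 v3 = 1 /\
  forall x y z, K x -> K y -> K z -> val n x y z <= mu + e].
have G0 e : 0 < e -> e <= d -> G e !=set0.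
  move=> e0 ed; have [n1 [n2 [h1 h2]]] := separate_at kK cK K1 K2 K3 e0 (nf e e0 ed).
  by exists (n1, n2).
have Gle e e' : e <= e' -> G e `<=` G e'.
  move=> ee n [h1 h2]; split => // x y z Kx Ky Kz; apply: (le_trans (h2 _ _ _ Kx Ky Kz)).
  by rewrite lerD2l.
pose F := filter_from [set e : R | 0 < e /\ e <= d] G.
have FF : ProperFilter F.
  apply: filter_from_proper; last by move=> e [e0 ed]; exact: G0.
  apply: filter_from_filter; first by exists d => /=; rewrite lexx.
  move=> i j [i0 id] [j0 jd]; exists (Num.min i j).
    by rewrite /= lt_min i0 j0 ge_min id.
  by move=> n Gn; split; apply: Gle Gn; rewrite ge_min lexx ?orbT.
have [ o [r [r0 oK]]] := interior_square iK.
pose M := (mu + d) / r.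
pose I : set R := `[- M, M]%classic.
pose B : set (pt * pt) := (I `*` I) `*` (I `*` I).
have kB : compact B.
  by do 2 apply: compact_setX; exact: segment_compact.
have FB : F B.
  exists d; first by rewrite /= lexx.
  move=> [n1 n2] [_ h].
  have coord (c : R) : (forall x : R, `|x| <= r -> x * c <= mu + d) -> I c.
    move=> hc; rewrite /I/= in_itv/= -ler_norml /M ler_pdivlMr//.
    have [c0|c0] := leP 0 c.
      by rewrite ger0_norm// mulrC hc// gtr0_norm.
    by rewrite ltr0_norm// mulNr -mulrN mulrC hc// normrN gtr0_norm.
  have Ko (x y : R) : `|x| <= r -> `|y| <= r -> K (o.1 + x, o.2 + y) by exact: oK.
  have Koo : K (o.1 + 0, o.2 + 0) by apply: oK; rewrite normr0 ltW.
  have n0 : `|0 : R| <= r by rewrite normr0 ltW.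
  split; split; apply: coord => x xr.
  - have := h _ _ _ (oK _ _ xr n0) Koo Koo; rewrite /val /dot2 /sub2/=; lra.
  - have := h _ _ _ (oK _ _ n0 xr) Koo Koo; rewrite /val /dot2 /sub2/=; lra.
  - have := h _ _ _ Koo (oK _ _ xr n0) Koo; rewrite /val /dot2 /sub2/=; lra.
  - have := h _ _ _ Koo (oK _ _ n0 xr) Koo; rewrite /val /dot2 /sub2/=; lra.
have [n [_ cn]] := kB _ FF FB.
have cval x y z : continuous (fun m => val m x y z).
  by rewrite /val /dot2; solve_continuous.
have Fd (P : set (pt * pt)) : (forall e, 0 < e -> e <= d -> G e `<=` P) -> F P.
  by move=> h; exists d; [rewrite /= lexx|exact: h].
have n1E : val n v1 v2 v3 = 1.
  apply/eqP; rewrite eq_le; apply/andP; split.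
    apply: (@cluster_le _ F (fun m => val m v1 v2 v3)) => //.
    by apply: Fd => e _ _ m [/= -> _].
  rewrite -[_ <= _]lerN2 -[X in X <= _]sub0r.
  apply: (@cluster_le _ F (fun m => 0 - val m v1 v2 v3)) => //.
    by apply: continuous_sub; [exact: continuous_const|exact: cval].
  by apply: Fd => e _ _ m [/= -> _]; rewrite sub0r.
have nle x y z : K x -> K y -> K z -> val n x y z <= mu.
  move=> Kx Ky Kz; rewrite leNgt; apply/negP => hlt.
  pose e := Num.min d ((val n x y z - mu) / 2).
  have e0 : 0 < e by rewrite lt_min d0/= divr_gt0// subr_gt0.
  have ed : e <= d by rewrite ge_min lexx.
  have ev : e <= (val n x y z - mu) / 2 by rewrite ge_min lexx orbT.
  have : val n x y z <= mu + e.
    apply: (@cluster_le _ F (fun m => val m x y z)) => //.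
    by exists e => // m [_ /= h]; exact: h.
  by clear -ev hlt; lra.
clear G G0 Gle F FF FB cn Fd kB cval.
set p1 := (t.1 + mu * v1.1, _) in K1 *; set p2 := (t.1 + mu * v2.1, _) in K2 *.
set p3 := (t.1 + mu * v3.1, _) in K3 *.
have vp : val n p1 p2 p3 = mu.
  by rewrite -[RHS]mulr1 -n1E /val /dot2 /sub2/=; ring.
exists n.1, n.2, (- n.1.1 - n.2.1, - n.1.2 - n.2.2); split => /=; [ring|ring| |].
  by rewrite -n1E /val /dot2 /sub2/=; ring.
split=> x Kx.
- have := nle _ _ _ Kx K2 K3; rewrite -vp /val /dot2 /sub2/=; lra.
- have := nle _ _ _ K1 Kx K3; rewrite -vp /val /dot2 /sub2/=; lra.
- have := nle _ _ _ K1 K2 Kx; rewrite -vp /val /dot2 /sub2/=; lra.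
Qed.

End Separation.

(** * Scales at which triangles fit *)

Section CapacityFits.
Variable R : realType.
Local Notation pt := (R * R)%type.
Local Notation triple := ((R * R) * (R * R) * (R * R))%type.
Implicit Types (K Q : set pt) (v w : triple).

(* Equals [<y2 - y1, w1> + <y3 - y2, w2> + <y1 - y3, w3>] by summation by parts. *)
Definition edge_pairing w (y1 y2 y3 : pt) : R :=
  dot2 y1 (sub2 w.2 w.1.1) + dot2 y2 (sub2 w.1.1 w.1.2) + dot2 y3 (sub2 w.1.2 w.2).

Definition fits3 K w mu := fits K w.1.1 w.1.2 w.2 mu.

(** The reversed order of the corners makes [edge_pairing] merely exchange two arguments, so the
    negative of an admissible triangle is admissible. *)
Definition opp3 w : triple :=
  ((- w.2.1, - w.2.2), (- w.1.2.1, - w.1.2.2), (- w.1.1.1, - w.1.1.2)).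

Lemma edge_pairing_opp3 w y1 y2 y3 : edge_pairing (opp3 w) y1 y2 y3 = edge_pairing w y1 y3 y2.
Proof. by rewrite /edge_pairing /opp3 /dot2 /sub2/=; ring. Qed.

Lemma fits_le K w (mu mu' : R) : convex2 K -> 0 <= mu' -> mu' <= mu ->
  fits3 K w mu -> fits3 K w mu'.
Proof.
move=> cK mu0 le_mu [t [K1 K2 K3]].
have [mu00|mun] := eqVneq mu 0; first by exists t; rewrite (_ : mu' = mu)//; lra.
have mup : 0 < mu by rewrite lt_neqAle eq_sym mun/=; lra.
pose s := mu' / mu; have s0 : 0 <= s by rewrite divr_ge0// ltW.
have s1 : s <= 1 by rewrite ler_pdivrMr// mul1r.
have sE : s * mu = mu' by rewrite divfK.
pose a := t.1 + mu * w.1.1.1; pose b := t.2 + mu * w.1.1.2.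
exists (s * t.1 + (1 - s) * a, s * t.2 + (1 - s) * b); rewrite -sE.
by split; [have := cK _ _ K1 K1 s s0 s1|have := cK _ _ K2 K1 s s0 s1|have := cK _ _ K3 K1 s s0 s1];
  congr K; congr pair; rewrite /= /a /b; ring.
Qed.

Lemma fits_small K w : interior K !=set0 -> exists2 mu : R, 0 < mu & fits3 K w mu.
Proof.
move=> /interior_square[ o [r [r0 oK]]].
pose M := 1 + `|w.1.1.1| + `|w.1.1.2| + `|w.1.2.1| + `|w.1.2.2| + `|w.2.1| + `|w.2.2|.
have M0 : 0 < M by rewrite /M !ltr_wpDr// ltr01.
exists (r / M); first exact: divr_gt0.
have small (a : R) : `|a| <= M -> `|r / M * a| <= r.
  by move=> aM; rewrite normrM gtr0_norm ?divr_gt0// mulrAC ler_pdivrMr// ler_pM2l.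
have := normr_ge0 w.1.1.1; have := normr_ge0 w.1.1.2; have := normr_ge0 w.1.2.1.
have := normr_ge0 w.1.2.2; have := normr_ge0 w.2.1; have := normr_ge0 w.2.2 => *.
by exists o; split; apply: oK; apply: small; rewrite /M; lra.
Qed.

(** The cap [c], and the first corner instead of the translation as a parameter, place the
    candidates in the compact set [[0, c] x K]; scale 0 is always among them. *)
Lemma fits_max K w (c : R) : compact K -> K !=set0 -> 0 <= c ->
  exists mu, [/\ 0 <= mu, mu <= c, fits3 K w mu &
    forall nu, 0 <= nu -> nu <= c -> fits3 K w nu -> nu <= mu].
Proof.
move=> kK [k0 Kk0] c0.
pose f (u : pt) (z : R * pt) : pt := (z.2.1 + z.1 * (u.1 - w.1.1.1), z.2.2 + z.1 * (u.2 - w.1.1.2)).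
pose A : set (R * pt) := (`[0, c]%classic `*` K) `&` (f w.1.2 @^-1` K `&` f w.2 @^-1` K).
have cf u : continuous (f u) by rewrite /f; solve_continuous.
have clK : closed K by apply: compact_closed => //; exact: norm_hausdorff.
have kA : compact A.
  apply: compact_closedI; first by apply: compact_setX => //; exact: segment_compact.
  by apply: closedI; apply: preimage_closed.
have A0 : A !=set0.
  exists (0, k0); split; first by split => //=; rewrite in_itv/= lexx.
  by split; rewrite /f/= !mul0r !addr0 -surjective_pairing.
have c1 : {within A, continuous (fun z : R * pt => z.1)}.
  by apply: continuous_subspaceT; solve_continuous.
have [[mu k]] := compact_EVT_max A0 kA c1; rewrite inE /A/= in_itv/=.
move=> [[/andP[mu0 muc] Kk] [Kk2 Kk3]] mx; exists mu; split => //.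
  exists (k.1 - mu * w.1.1.1, k.2 - mu * w.1.1.2); split => /=.
  - by move: Kk; rewrite {1}[k]surjective_pairing; congr K; congr pair; ring.
  - by move: Kk2; congr K; rewrite /f/=; congr pair; ring.
  - by move: Kk3; congr K; rewrite /f/=; congr pair; ring.
move=> nu nu0 nuc [t [K1 K2 K3]].
apply: (mx (nu, (t.1 + nu * w.1.1.1, t.2 + nu * w.1.1.2))); rewrite inE; split.
  by split => //=; rewrite in_itv/= nu0.
by split; [move: K2|move: K3]; congr K; rewrite /f/=; congr pair; ring.
Qed.

Lemma seq_argmin (T : eqType) (s : seq T) (f : T -> R) x : x \in s ->
  exists2 y, y \in s & forall z, z \in s -> f y <= f z.
Proof.
elim: s x => // a [|b s] IH x _.
  by exists a; rewrite ?inE// => z; rewrite inE => /eqP ->.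
have [y ys hy] := IH b (mem_head _ _).
have [ay|ya] := leP (f a) (f y).
  exists a; first exact: mem_head.
  by move=> z; rewrite inE => /predU1P[->//|/hy]; exact: le_trans.
exists y; first by rewrite inE ys orbT.
by move=> z; rewrite inE => /predU1P[->|/hy//]; exact: ltW.
Qed.

(** An infimum over the empty set takes the default value 0. *)
Lemma lagr_capacity_ge0 K Q : 0 <= lagr_capacity K Q.
Proof.
rewrite /lagr_capacity /EHZ; set S := [set a | _].
have [[a Sa]|] := pselect (S !=set0).
  by apply: lb_le_inf; [exists a|move=> _ [? [? [? [_ ->]]]]].
by move=> /set0P/negP; rewrite negbK => /eqP ->; rewrite inf0.
Qed.

(* [T1], [T2] and [T1'], [T2'] come from the translations fitting [mu w] and [- mu w]
   into [K], [P1], [P2], [P3] from the contact points.  Every selection of three corners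
   out of [0], [n1], [n1 + n2] runs through the normals [n1], [n2], [- n1 - n2] once, in
   one of the two orientations. *)
Lemma selection_le (n1 n2 : pt) w (mu T1 T2 T1' T2' P1 P2 P3 : R) :
  0 < mu -> P1 + P2 + P3 = mu ->
  (forall u, u \in [:: w.1.1; w.1.2; w.2] ->
    [/\ T1 + mu * dot2 n1 u <= P1, T2 + mu * dot2 n2 u <= P2 &
      - (T1 + mu * dot2 n1 u) - (T2 + mu * dot2 n2 u) <= P3]) ->
  (forall u, u \in [:: w.1.1; w.1.2; w.2] ->
    [/\ T1' - mu * dot2 n1 u <= P1, T2' - mu * dot2 n2 u <= P2 &
      - (T1' - mu * dot2 n1 u) - (T2' - mu * dot2 n2 u) <= P3]) ->
  let q := [:: (0, 0); n1; (n1.1 + n2.1, n1.2 + n2.2)] in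
  forall a b c, a \in q -> b \in q -> c \in q -> edge_pairing w a b c <= 1.
Proof.
move=> mu0 Pmu Hp Hm q.
have [] := Hp w.1.1; rewrite ?inE ?eqxx ?orbT//; have [] := Hp w.1.2; rewrite ?inE ?eqxx ?orbT//.
have [] := Hp w.2; rewrite ?inE ?eqxx ?orbT//; have [] := Hm w.1.1; rewrite ?inE ?eqxx ?orbT//.
have [] := Hm w.1.2; rewrite ?inE ?eqxx ?orbT//; have [] := Hm w.2; rewrite ?inE ?eqxx ?orbT//.
set x1 := mu * dot2 n1 w.1.1; set x2 := mu * dot2 n1 w.1.2; set x3 := mu * dot2 n1 w.2.
set y1 := mu * dot2 n2 w.1.1; set y2 := mu * dot2 n2 w.1.2; set y3 := mu * dot2 n2 w.2.
move=> h1 h2 h3 h4 h5 h6 h7 h8 h9 h10 h11 h12 h13 h14 h15 h16 h17 h18 a b c qa qb qc.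
pose X u := mu * dot2 u w.1.1; pose Y u := mu * dot2 u w.1.2; pose Z u := mu * dot2 u w.2.
have val u : u \in q -> [\/ [/\ X u = 0, Y u = 0 & Z u = 0],
   [/\ X u = x1, Y u = x2 & Z u = x3] | [/\ X u = x1 + y1, Y u = x2 + y2 & Z u = x3 + y3]].
  rewrite !inE => /or3P[] /eqP ->.
  - by constructor 1; rewrite /X /Y /Z /dot2/= !mul0r !addr0 !mulr0.
  - by constructor 2.
  - by constructor 3; rewrite /X /Y /Z /x1 /x2 /x3 /y1 /y2 /y3 /dot2/=; split; ring.
rewrite -(ler_pM2l mu0) mulr1.
have -> : mu * edge_pairing w a b c = Z a - X a + X b - Y b + Y c - Z c.
  by rewrite /edge_pairing /X /Y /Z /dot2 /sub2/=; ring.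
rewrite -Pmu; move: (val _ qa) (val _ qb) (val _ qc); clear -h1 h2 h3 h4 h5 h6 h7 h8 h9 h10
  h11 h12 h13 h14 h15 h16 h17 h18.
by case=> -[-> _ ->]; case=> -[-> -> _]; case=> -[_ -> ->]; lra.
Qed.

Lemma translate_normal_le K k n t (mu : R) (u : pt) : normal2 K k n ->
  K (t.1 + mu * u.1, t.2 + mu * u.2) -> dot2 n t + mu * dot2 n u <= dot2 n k.
Proof. by move=> Nn /Nn; rewrite /dot2 /sub2/=; lra. Qed.

(* The minimal scale [mu] at which some triangle of the family stops fitting in [K]
   yields normals [n_i] at its corners; the triangle with sides [n_i] fits in [Q] because
   the other members of the family still fit in [K], and both triangles together
   form a closed characteristic of action [mu]. *)
Lemma capacity_fits K Q (W : seq triple) : convex_shape K -> convex2 Q ->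
  (forall w y1 y2 y3, w \in W -> Q y1 -> Q y2 -> Q y3 -> edge_pairing w y1 y2 y3 <= 1) ->
  (forall q1 q2 q3 : pt,
    (forall w a b c, w \in W -> a \in [:: q1; q2; q3] -> b \in [:: q1; q2; q3] ->
       c \in [:: q1; q2; q3] -> edge_pairing w a b c <= 1) ->
    exists s : pt, [/\ Q (q1.1 + s.1, q1.2 + s.2), Q (q2.1 + s.1, q2.2 + s.2) &
      Q (q3.1 + s.1, q3.2 + s.2)]) ->
  forall w, w \in W ->
    fits3 K w (lagr_capacity K Q) /\ fits3 K (opp3 w) (lagr_capacity K Q).
Proof.
move=> shK cQ Qnorm Qfit.
have [kK [cK iK]] := shK; set c := lagr_capacity K Q.
have K0 : K !=set0.
  have [ o [r [r0 oK]]] := interior_square iK.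
  by exists (o.1 + 0, o.2 + 0); apply: oK; rewrite normr0 ltW.
have c0 : 0 <= c := lagr_capacity_ge0 K Q.
pose V := W ++ map opp3 W.
suff all_fit v : v \in V -> fits3 K v c.
  by move=> w wW; split; apply: all_fit; rewrite mem_cat ?wW// (map_f opp3 wW) orbT.
have Vnorm u y1 y2 y3 : u \in V -> Q y1 -> Q y2 -> Q y3 -> edge_pairing u y1 y2 y3 <= 1.
  rewrite mem_cat => /orP[uW|/mapP[w wW ->]] Q1 Q2 Q3; first exact: Qnorm.
  by rewrite edge_pairing_opp3; exact: Qnorm.
have [m mP] := boolp.choice (fun u => fits_max u kK K0 c0).
move=> vV; have [v0 v0V hmin] := seq_argmin m vV.
suff mc : c <= m v0.
  have [m0 mvc fv _] := mP v; rewrite (_ : c = m v)//; apply/eqP; rewrite eq_le mvc andbT.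
  exact: le_trans mc (hmin _ vV).
rewrite leNgt; apply/negP => mc; set mu := m v0 in mc.
have [mu0 _ fv0 mx] := mP v0; rewrite -/mu in mu0 fv0 mx.
have fitmu u : u \in V -> fits3 K u mu.
  by move=> uV; have [_ _ + _] := mP u; apply: fits_le => //; exact: hmin.
have mup : 0 < mu.
  have [e e0 fe] := fits_small v0 iK.
  have h : 0 < Num.min e c by rewrite lt_min e0 (le_lt_trans mu0 mc).
  apply: (lt_le_trans h); apply: mx; [exact: ltW|by rewrite ge_min lexx orbT|].
  by apply: fits_le fe => //; [exact: ltW|rewrite ge_min lexx].
have [t [K1 K2 K3]] := fv0.
have d0 : 0 < c - mu by rewrite subr_gt0.
have nf e : 0 < e -> e <= c - mu -> ~ fits K v0.1.1 v0.1.2 v0.2 (mu + e).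
  move=> e0 ed fe; have : mu + e <= mu by apply: mx => //; clear -mu0 e0 ed; lra.
  by clear -e0; lra.
have [n1 [n2 [n3 [s1 s2 nv [N1 N2 N3]]]]] := separating_normals shK mu0 K1 K2 K3 d0 nf.
set p1 := (_, _) in K1 N1; set p2 := (_, _) in K2 N2; set p3 := (_, _) in K3 N3.
have n3E (u : pt) : dot2 n3 u = - dot2 n1 u - dot2 n2 u.
  rewrite /dot2 (_ : n3.1 = - n1.1 - n2.1); last by clear -s1; lra.
  by rewrite (_ : n3.2 = - n1.2 - n2.2); [ring|clear -s2; lra].
have pE : dot2 n1 p1 + dot2 n2 p2 + dot2 n3 p3 = mu.
  by rewrite -[RHS]mulr1 -nv !n3E /dot2/=; ring.
(* The corners are partial sums of the normals, so the sides are [n1], [n2] and [n3]. *)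
have [|s [Q1 Q2 Q3]] := Qfit (0, 0) n1 (n1.1 + n2.1, n1.2 + n2.2).
  move=> w a b e wW; have [t' [T1 T2 T3]] : fits3 K w mu.
    by apply: fitmu; rewrite mem_cat wW.
  have [t'' [T1' T2' T3']] : fits3 K (opp3 w) mu.
    by apply: fitmu; rewrite mem_cat (map_f opp3 wW) orbT.
  apply: (@selection_le n1 n2 w mu (dot2 n1 t') (dot2 n2 t') (dot2 n1 t'') (dot2 n2 t'')
    _ _ _ mup pE).
    move=> u uw.
    have Ku : K (t'.1 + mu * u.1, t'.2 + mu * u.2).
      by move: uw; rewrite !inE => /or3P[] /eqP ->.
    split; [exact: translate_normal_le N1 Ku|exact: translate_normal_le N2 Ku|].
    by have := translate_normal_le N3 Ku; rewrite [X in X + _]n3E [X in _ * X]n3E; clear; lra.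
  move=> u uw; pose u' : pt := (- u.1, - u.2).
  have Ku : K (t''.1 + mu * u'.1, t''.2 + mu * u'.2).
    by rewrite /u'; move: uw; rewrite !inE => /or3P[] /eqP ->.
  have dN n : dot2 n u' = - dot2 n u by rewrite /dot2/=; ring.
  have := translate_normal_le N1 Ku; have := translate_normal_le N2 Ku.
  have := translate_normal_le N3 Ku; rewrite [X in X + _]n3E [X in _ * X]n3E !dN.
  by clear; split; lra.
move: Q1 Q2 Q3; set y1 := (_, _) => Q1; set y2 := (_, _) => Q2; set y3 := (_, _) => Q3.
have y21 : sub2 y2 y1 = n1 by rewrite [RHS]surjective_pairing /sub2/=; congr pair; ring.
have y32 : sub2 y3 y2 = n2 by rewrite [RHS]surjective_pairing /sub2/=; congr pair; ring.
have y13 : sub2 y1 y3 = n3.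
  by rewrite [RHS]surjective_pairing /sub2/=; congr pair; [clear -s1|clear -s2]; lra.
have yv : edge_pairing v0 y1 y2 y3 = 1.
  by rewrite -nv n3E /edge_pairing /dot2 /sub2/=; ring.
(* [edge_pairing v0] is at most 1 on [Q] and equals 1 at [(y1, y2, y3)]; varying one argument at a
   time shows that each point maximizes its linear term. *)
have [M1 M2 M3] : [/\ normal2 Q y1 (sub2 p3 p1), normal2 Q y2 (sub2 p1 p2) &
    normal2 Q y3 (sub2 p2 p3)].
  have pp (a b : pt) y y' : dot2 y (sub2 a b) <= dot2 y' (sub2 a b) ->
      dot2 (sub2 (t.1 + mu * a.1, t.2 + mu * a.2) (t.1 + mu * b.1, t.2 + mu * b.2))
        (sub2 y y') <= 0.
    move=> h; have : 0 <= mu * (dot2 y' (sub2 a b) - dot2 y (sub2 a b)).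
      by rewrite mulr_ge0// subr_ge0.
    by rewrite /dot2 /sub2/=; clear; lra.
  split=> y Qy; apply: pp.
  - have := Vnorm _ _ _ _ v0V Qy Q2 Q3; rewrite -yv /edge_pairing; lra.
  - have := Vnorm _ _ _ _ v0V Q1 Qy Q3; rewrite -yv /edge_pairing; lra.
  - have := Vnorm _ _ _ _ v0V Q1 Q2 Qy; rewrite -yv /edge_pairing; lra.
have := @capacity_le_triangle R K Q p1 p2 p3 y1 y2 y3 cK cQ.
rewrite y21 y32 y13 => /(_ _ _ _ _ _ _)/wrap[] //.
- move=> [e1 e2]; have : edge_pairing v0 y1 y2 y3 = 0.
    by rewrite e1 e2 /edge_pairing /dot2 /sub2/=; ring.
  by rewrite yv => /eqP; rewrite oner_eq0.
- move=> [e1 e2]; have : dot2 n1 p1 + dot2 n2 p2 + dot2 n3 p3 = 0.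
    by rewrite e1 e2 !n3E; ring.
  by rewrite pE => /eqP; rewrite gt_eqF.
apply/negP; rewrite -ltNge; apply: le_lt_trans mc.
rewrite (_ : _ + _ = - (mu * edge_pairing v0 y1 y2 y3)); last first.
  by rewrite /edge_pairing /dot2 /sub2 /p1 /p2 /p3/=; ring.
by rewrite yv mulr1 normrN ger0_norm.
Qed.

End CapacityFits.

(** * Affine normalization *)

Section AffineTransfer.
Variable R : realType.
Local Notation pt := (R * R)%type.
Local Notation triple := ((R * R) * (R * R) * (R * R))%type.
Implicit Types (K Q P : set pt) (w : triple).

(* [P] is [Q] in affine coordinates; the triangles live in the dual coordinates. *)
Lemma normal_form_inequality K Q P (p q r s e f : R) (W : seq triple) :
  convex_shape K -> p * s - q * r != 0 -> Q = aff p q r s e f @^-1` P ->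
  compact P -> convex2 P ->
  (forall w y1 y2 y3, w \in W -> P y1 -> P y2 -> P y3 -> edge_pairing w y1 y2 y3 <= 1) ->
  (forall q1 q2 q3 : pt,
    (forall w a b c, w \in W -> a \in [:: q1; q2; q3] -> b \in [:: q1; q2; q3] ->
       c \in [:: q1; q2; q3] -> edge_pairing w a b c <= 1) ->
    exists s : pt, [/\ P (q1.1 + s.1, q1.2 + s.2), P (q2.1 + s.1, q2.2 + s.2) &
      P (q3.1 + s.1, q3.2 + s.2)]) ->
  (forall K', compact K' -> convex2 K' ->
    (forall w, w \in W -> fits3 K' w 1 /\ fits3 K' (opp3 w) 1) ->
    1 / 2 <= area K' * area P) ->
  lagr_capacity K Q ^+ 2 / 2 <= area K * area Q.
Proof.
move=> shK D0 QE kP cP Pnorm Pfit bound; have [kK [cK _]] := shK.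
set c := lagr_capacity K Q.
have [c0|cn] := eqVneq c 0.
  by rewrite c0 expr0n/= mul0r mulr_ge0// area_ge0.
have c0 : 0 < c by rewrite lt_neqAle eq_sym cn lagr_capacity_ge0.
pose A := aff p q r s e f.
(* The transpose of the linear part of [A]; the translation part drops out since the coefficients of
   [edge_pairing] sum to zero. *)
pose lin (u : pt) : pt := (p * u.1 + r * u.2, q * u.1 + s * u.2).
pose lin3 w : triple := (lin w.1.1, lin w.1.2, lin w.2).
have pairE w y1 y2 y3 : edge_pairing (lin3 w) y1 y2 y3 = edge_pairing w (A y1) (A y2) (A y3).
  by rewrite /edge_pairing /lin3 /lin /A /aff /dot2 /sub2/=; ring.
have cQ : convex2 Q by rewrite QE; exact: convex_preaff.
have fitK : forall w, w \in map lin3 W -> fits3 K w c /\ fits3 K (opp3 w) c.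
  apply: capacity_fits => //.
    move=> _ y1 y2 y3 /mapP[w wW ->]; rewrite QE => Q1 Q2 Q3; rewrite pairE; exact: Pnorm.
  move=> q1 q2 q3 hq; have [|t [T1 T2 T3]] := Pfit (A q1) (A q2) (A q3).
    move=> w a b g wW; rewrite -[[:: A q1; _; _]]/(map A [:: q1; q2; q3]).
    move=> /mapP[a' a'q ->] /mapP[b' b'q ->] /mapP[g' g'q ->]; rewrite -pairE.
    by apply: hq => //; exact: map_f.
  exists ((s * t.1 - q * t.2) / (p * s - q * r), (- r * t.1 + p * t.2) / (p * s - q * r)).
  by rewrite QE; split; [move: T1|move: T2|move: T3]; rewrite /A /aff/=; congr P; congr pair;
    field.
have D1 : c * p * (c * s) - c * r * (c * q) != 0.
  by rewrite (_ : _ - _ = c * c * (p * s - q * r)) ?mulf_neq0//; ring.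
(* The determinants of the two substitutions cancel in the product of the areas and leave the factor
   [c ^+ 2]. *)
pose K' := aff (c * p) (c * r) (c * q) (c * s) 0 0 @^-1` K.
have [_ aK] := area_aff 0 0 D1 (compact_finarea kK).
have [_ aQ] := area_aff e f D0 (compact_finarea kP).
have fitK' w : fits3 K (lin3 w) c -> fits3 K' w 1.
  move=> [t [T1 T2 T3]].
  exists ((s * t.1 - r * t.2) / (c * (p * s - q * r)),
    (- q * t.1 + p * t.2) / (c * (p * s - q * r))).
  by split; [move: T1|move: T2|move: T3]; rewrite /K' /aff/=; congr K; congr pair; field;
    rewrite cn D0.
have oppE w : opp3 (lin3 w) = lin3 (opp3 w).
  by rewrite /opp3 /lin3 /lin/=; congr pair; [congr pair|]; congr pair; ring.
have kK' : compact K' by exact: compact_preaff.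
have cK' : convex2 K' by exact: convex_preaff.
have [|h] := lerP (1 / 2) (area K' * area P); last first.
  move: h; rewrite ltNge bound// => w wW; have [h1 h2] := fitK _ (map_f lin3 wW).
  by split; apply: fitK' => //; rewrite -oppE.
rewrite -aQ -QE -aK -/K' -(@ler_pM2l _ (c ^+ 2)) ?exprn_gt0// div1r.
congr (_ <= _).
have -> : c * p * (c * s) - c * r * (c * q) = c ^+ 2 * (p * s - q * r) by ring.
by rewrite normrM (ger0_norm (sqr_ge0 c)); ring.
Qed.

End AffineTransfer.

(** * Hexagons and quadrilaterals *)

Section Hulls.
Variable R : realType.
Local Notation pt := (R * R)%type.
Implicit Types (s : seq pt) (C P : set pt).

Lemma hull_mem s z : z \in s -> hull s z.
Proof.
move=> zs; have ls : (index z s < size s)%N by rewrite index_mem.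
exists (fun i => (i == index z s)%:R); split; first by move=> i; rewrite ler0n.
have pick (f : nat -> R) : \sum_(i < size s) (i == index z s :> nat)%:R * f i = f (index z s).
  rewrite (bigD1 (Ordinal ls))//= eqxx mul1r big1 ?addr0// => i.
  by rewrite -val_eqE/= => /negbTE ->; rewrite mul0r.
split; first by have := pick (fun=> 1); under eq_bigr do rewrite mulr1.
rewrite (pick (fun i => (nth (0, 0) s i).1)) (pick (fun i => (nth (0, 0) s i).2)).
by rewrite nth_index// -surjective_pairing.
Qed.

Lemma hull_convex s : convex2 (hull s).
Proof.
move=> _ _ [u [u0 [u1 ->]]] [v [v0 [v1 ->]]] t t0 t1 /=.
have t1' : 0 <= 1 - t by rewrite subr_ge0.
exists (fun i => t * u i + (1 - t) * v i); split.
  by move=> i; rewrite addr_ge0// mulr_ge0.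
split; first by rewrite big_split/= -!mulr_sumr u1 v1; ring.
by congr pair; rewrite !mulr_sumr -big_split/=; apply: eq_bigr => i _; ring.
Qed.

(** The induction on the list uses unnormalized weights divided by their total; a tail of total
    weight 0 is treated apart. *)
Lemma hull_sub s C : convex2 C -> (forall z, z \in s -> C z) -> hull s `<=` C.
Proof.
move=> cC sC _ [u [u0 [u1 ->]]].
suff H : forall (s : seq pt) (u : nat -> R), (forall i, 0 <= u i) -> (forall z, z \in s -> C z) ->
    0 < \sum_(i < size s) u i ->
    C ((\sum_(i < size s) u i * (nth (0, 0) s i).1) / \sum_(i < size s) u i,
       (\sum_(i < size s) u i * (nth (0, 0) s i).2) / \sum_(i < size s) u i).
  have := H s u u0 sC; rewrite u1 !divr1; apply; exact: ltr01.
clear s sC u u0 u1; elim=> [|a s IH] u u0 sC; first by rewrite big_ord0 ltxx.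
have Ca : C a by apply: sC; exact: mem_head.
rewrite /= !big_ord_recl/= => T0.
set S := \sum_(i < size s) _ in T0 *.
set X := \sum_(i < size s) _; set Y := \sum_(i < size s) _.
have S0 : 0 <= S by apply: sumr_ge0.
have [Sz|Sn] := eqVneq S 0.
  have uz (i : 'I_(size s)) : u (bump 0 i) = 0.
    have /eqP := Sz; rewrite psumr_eq0; last by move=> j _; exact: u0.
    by move=> /allP/(_ i); rewrite mem_index_enum => /(_ isT)/eqP.
  have -> : X = 0 by rewrite /X big1// => i _; rewrite uz mul0r.
  have -> : Y = 0 by rewrite /Y big1// => i _; rewrite uz mul0r.
  move: T0; rewrite Sz !addr0 => T0.
  by rewrite ![_ * _ / _]mulrAC divff ?gt_eqF// !mul1r -surjective_pairing.
have Sp : 0 < S by rewrite lt_neqAle eq_sym Sn.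
have := IH (fun i => u i.+1) (fun i => u0 i.+1).
move=> /(_ _ Sp)/wrap[]; first by move=> z zs; apply: sC; rewrite inE zs orbT.
rewrite -[\sum_(i < size s) u i.+1]/S.
rewrite -[\sum_(i < size s) (u i.+1 * _.1)]/X -[\sum_(i < size s) (u i.+1 * _.2)]/Y.
move=> CS; have u00 := u0 0%N.
have h0 : 0 <= u 0%N / (u 0%N + S) by rewrite divr_ge0// ltW.
have h1 : u 0%N / (u 0%N + S) <= 1 by rewrite ler_pdivrMr// mul1r lerDl.
have := cC _ _ Ca CS _ h0 h1; congr C; congr pair; rewrite /=; field; rewrite Sn gt_eqF//.
Qed.

Lemma image_affine_map (g11 g12 g21 g22 e f : R) P : g11 * g22 - g12 * g21 != 0 ->
  exists p q r u e' f' : R, p * u - q * r != 0 /\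
    affine_map g11 g12 g21 g22 e f @` P = aff p q r u e' f' @^-1` P.
Proof.
move=> D0; pose D := g11 * g22 - g12 * g21.
exists (g22 / D), (- g12 / D), (- g21 / D), (g11 / D), ((g12 * f - g22 * e) / D),
  ((g21 * e - g11 * f) / D); split.
  by rewrite (_ : _ - _ = D^-1) ?invr_neq0// /D; field.
apply/seteqP; split => z.
  move=> [x Px <-]; rewrite /= (_ : aff _ _ _ _ _ _ _ = x)//.
  by rewrite /aff/= [RHS]surjective_pairing; congr pair; rewrite /D; field.
move=> Pz; exists (aff (g22 / D) (- g12 / D) (- g21 / D) (g11 / D) ((g12 * f - g22 * e) / D)
  ((g21 * e - g11 * f) / D) z) => //.
by rewrite /affine_map/= [RHS]surjective_pairing; congr pair; rewrite /D; field.
Qed.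

End Hulls.

(** * The affinely regular hexagon *)

Section Hexagon.
Variable R : realType.
Local Notation pt := (R * R)%type.
Local Notation triple := ((R * R) * (R * R) * (R * R))%type.

(** Affine coordinates in which the vertices are [(1, 0)], [(0, 1)], [(- 1, 1)] and their
    negatives. *)
Definition hexagon : set pt :=
  [set z | [/\ - 1 <= z.1 <= 1, - 1 <= z.2 <= 1 & - 1 <= z.1 + z.2 <= 1]].

Lemma convex_comb_itv (a b l u t : R) : l <= a <= u -> l <= b <= u -> 0 <= t -> t <= 1 ->
  l <= t * a + (1 - t) * b <= u.
Proof.
move=> /andP[la au] /andP[lb bu] t0 t1.
have := mulr_ge0 t0 (_ : 0 <= a - l); have := mulr_ge0 t0 (_ : 0 <= u - a).
have s0 : 0 <= 1 - t by lra.
have := mulr_ge0 s0 (_ : 0 <= b - l); have := mulr_ge0 s0 (_ : 0 <= u - b).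
move=> /(_ ltac:(lra)) h1 /(_ ltac:(lra)) h2 /(_ ltac:(lra)) h3 /(_ ltac:(lra)) h4.
by apply/andP; split; lra.
Qed.

Lemma hexagon_convex : convex2 hexagon.
Proof.
move=> x y [x1 x2 x3] [y1 y2 y3] t t0 t1; split; [exact: convex_comb_itv..|].
rewrite [X in _ <= X <= _](_ : _ = t * (x.1 + x.2) + (1 - t) * (y.1 + y.2)); last by rewrite /=; ring.
exact: convex_comb_itv.
Qed.

Lemma closed_strip (p q l u : R) : closed [set z : pt | l <= p * z.1 + q * z.2 <= u].
Proof.
have c : continuous (fun z : pt => p * z.1 + q * z.2) by solve_continuous.
rewrite (_ : [set z | _] = (fun z : pt => p * z.1 + q * z.2) @^-1` `[l, u]).
  by apply: preimage_closed => //; exact: itv_closed.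
by apply/seteqP; split => z; rewrite /= in_itv.
Qed.

Lemma compact_sub_square (A : set pt) (M : R) : closed A ->
  (forall z, A z -> - M <= z.1 <= M /\ - M <= z.2 <= M) -> compact A.
Proof.
move=> cA AM; rewrite (_ : A = (`[- M, M]%classic `*` `[- M, M]%classic) `&` A).
  by apply: compact_closedI => //; apply: compact_setX; exact: segment_compact.
apply/seteqP; split => z; last by case.
by move=> Az; split => //; split; rewrite /= in_itv/=; have [] := AM z Az.
Qed.

Lemma hexagon_compact : compact hexagon.
Proof.
apply: (@compact_sub_square _ 1); last by move=> z [].
rewrite (_ : hexagon = [set z | - 1 <= 1 * z.1 + 0 * z.2 <= 1] `&`
  [set z | - 1 <= 0 * z.1 + 1 * z.2 <= 1] `&` [set z | - 1 <= 1 * z.1 + 1 * z.2 <= 1]).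
  by apply: closedI; [apply: closedI|]; exact: closed_strip.
apply/seteqP; split => z; rewrite /hexagon/= !mul1r !mul0r addr0 add0r.
  by case.
by case=> -[].
Qed.

Lemma hexagon_area : 3 <= area hexagon.
Proof.
have f0 : (0 != 0 :> R) || (1 != 0 :> R) by rewrite oner_neq0 orbT.
have := @unimodal_shoelace_le R hexagon 0 1 hexagon_convex (compact_finarea hexagon_compact)
  f0 (0, - 1) [:: (- 1, 0); (- 1, 1); (0, 1)] [:: (1, - 1); (1, 0); (0, 1)].
rewrite /chain /cross/= => H; rewrite -(@ler_pM2l _ 2)//; apply: le_trans (H _ _ _ _ _ _).
- lra.
- by rewrite /hexagon/=; split; apply/andP; split; lra.
- by move=> z; rewrite !inE => /or3P[] /eqP ->; rewrite /hexagon/=; split; apply/andP; split; lra.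
- by move=> z; rewrite !inE => /or3P[] /eqP ->; rewrite /hexagon/=; split; apply/andP; split; lra.
- by repeat (apply/andP; split); first [done|lra].
- by repeat (apply/andP; split); first [done|lra].
- by [].
Qed.

Lemma interval_sum (a1 b1 a2 b2 a3 b3 : R) : a1 <= b1 -> a2 <= b2 -> a3 <= b3 ->
  a1 + a2 <= b3 -> a3 <= b1 + b2 ->
  exists x y, [/\ a1 <= x <= b1, a2 <= y <= b2 & a3 <= x + y <= b3].
Proof.
move=> h1 h2 h3 h4 h5; have [c|c] := leP a3 (a1 + a2).
  by exists a1, a2; rewrite !lexx h1 h2 c h4.
have [d|d] := leP (a3 - b2) a1.
  by exists a1, (a3 - a1); split; apply/andP; split; lra.
by exists (a3 - b2), b2; split; apply/andP; split; lra.
Qed.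

(** The segments, written as degenerate triangles, measure the widths across the pairs of parallel
    sides; the triangles measure sums of three alternate support values. The factors [1 / 2] and
    [1 / 3] make 1 the maximum over [hexagon]. *)
Definition hexagon_triangles : seq triple :=
  [:: ((0, 0), (0, - (1 / 3)), (1 / 3, 0)); ((0, 0), (0, 1 / 3), (- (1 / 3), 0));
      ((0, 0), (1 / 2, 0), (1 / 2, 0)); ((0, 0), (0, 1 / 2), (0, 1 / 2));
      ((0, 0), (1 / 2, 1 / 2), (1 / 2, 1 / 2))].

Lemma hexagon_norm w (y1 y2 y3 : pt) : w \in hexagon_triangles ->
  hexagon y1 -> hexagon y2 -> hexagon y3 -> edge_pairing w y1 y2 y3 <= 1.
Proof.
move=> wW [/andP[h1 h2] /andP[h3 h4] /andP[h5 h6]] [/andP[k1 k2] /andP[k3 k4] /andP[k5 k6]]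
  [/andP[l1 l2] /andP[l3 l4] /andP[l5 l6]].
move: wW; rewrite /hexagon_triangles !inE => /or4P[|||/orP[]] /eqP ->;
  rewrite /edge_pairing /dot2 /sub2/=; lra.
Qed.

(** A translation [s] works when [s.1], [s.2] and [s.1 + s.2] lie in intervals given by extreme
    values over the corners. The segments make these intervals nonempty; the triangles are the two
    compatibility conditions of [interval_sum]. *)
Lemma hexagon_fit (q1 q2 q3 : pt) :
  (forall w a b c, w \in hexagon_triangles -> a \in [:: q1; q2; q3] -> b \in [:: q1; q2; q3] ->
     c \in [:: q1; q2; q3] -> edge_pairing w a b c <= 1) ->
  exists s : pt, [/\ hexagon (q1.1 + s.1, q1.2 + s.2), hexagon (q2.1 + s.1, q2.2 + s.2) &
    hexagon (q3.1 + s.1, q3.2 + s.2)].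
Proof.
set q := [:: _; _; _] => H.
have q1q : q1 \in q by rewrite mem_head.
have q2q : q2 \in q by rewrite !inE eqxx orbT.
have q3q : q3 \in q by rewrite !inE eqxx !orbT.
have pick (f : pt -> R) : exists2 m, m \in q & forall z, z \in q -> f m <= f z.
  exact: seq_argmin q1q.
have [x0 x0q hx0] := pick (fun z => z.1); have [x1 x1q hx1] := pick (fun z => - z.1).
have [y0 y0q hy0] := pick (fun z => z.2); have [y1 y1q hy1] := pick (fun z => - z.2).
have [z0 z0q hz0] := pick (fun z => z.1 + z.2).
have [z1 z1q hz1] := pick (fun z => - (z.1 + z.2)).
have mem i : (i < 5)%N -> nth ((0, 0), (0, 0), (0, 0)) hexagon_triangles i \in hexagon_triangles.
  by move=> h; apply: mem_nth.
have := H _ _ _ _ (mem 0%N isT) x1q y1q z0q; have := H _ _ _ _ (mem 1%N isT) x0q y0q z1q.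
have := H _ _ _ _ (mem 2%N isT) x1q x0q x0q; have := H _ _ _ _ (mem 3%N isT) y1q y0q x0q.
have := H _ _ _ _ (mem 4%N isT) z1q z0q x0q.
rewrite /edge_pairing /dot2 /sub2/= => g1 g2 g3 g4 g5.
have [|||||x [y [rx ry rz]]] := @interval_sum (- 1 - x0.1) (1 - x1.1) (- 1 - y0.2) (1 - y1.2)
  (- 1 - (z0.1 + z0.2)) (1 - (z1.1 + z1.2)); try (clear -g1 g2 g3 g4 g5; lra).
exists (x, y).
have fit z : z \in q -> hexagon (z.1 + x, z.2 + y).
  move=> zq; have := hx0 z zq; have := hx1 z zq; have := hy0 z zq; have := hy1 z zq.
  have := hz0 z zq; have := hz1 z zq; case/andP: rx; case/andP: ry; case/andP: rz.
  by clear; move=> *; split; rewrite /=; apply/andP; split; lra.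
by split; exact: fit.
Qed.

(** Doubling lengths and reflecting the second coordinate gives unit chords and legs [2 / 3] in the
    directions of [triangles_and_chords_area]. The area grows by the factor 4, so [2 / 3] means
    [1 / 6] for [K]. *)
Lemma hexagon_bound (K : set pt) : compact K -> convex2 K ->
  (forall w, w \in hexagon_triangles -> fits3 K w 1 /\ fits3 K (opp3 w) 1) ->
  1 / 2 <= area K * area hexagon.
Proof.
move=> kK cK fK.
have D0 : 1 / 2 * - (1 / 2) - 0 * 0 != 0 :> R.
  by rewrite mulr0 subr0 mulrN oppr_eq0 mulf_neq0.
have [_ aE] := area_aff 0 0 D0 (compact_finarea kK).
have mem i : (i < 5)%N -> nth ((0, 0), (0, 0), (0, 0)) hexagon_triangles i \in hexagon_triangles.
  by move=> h; apply: mem_nth.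
have [[t0 /= T0] _] := fK _ (mem 0%N isT); have [[t1 /= T1] _] := fK _ (mem 1%N isT).
have [[t2 /= T2] _] := fK _ (mem 2%N isT); have [[t3 /= T3] _] := fK _ (mem 3%N isT).
have [[t4 /= T4] _] := fK _ (mem 4%N isT).
have : 2 / 3 <= area (aff (1 / 2) 0 0 (- (1 / 2)) 0 0 @^-1` K).
  apply: (@triangles_and_chords_area R _ (2 * t0.1, - 2 * t0.2) (2 * t1.1, - 2 * t1.2)
    (2 * t2.1, - 2 * t2.2) (2 * t4.1 + 1, - 2 * t4.2 - 1) (2 * t3.1, - 2 * t3.2 - 1)).
  - exact: compact_preaff.
  - exact: convex_preaff.
  - case: T0 => h1 h2 h3; split; [move: h1|move: h3|move: h2];
      congr K; rewrite /aff/=; congr pair; by field.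
  - case: T1 => h1 h2 h3; split; [move: h1|move: h3|move: h2];
      congr K; rewrite /aff/=; congr pair; by field.
  - case: T2 => h1 h2 h3; split; [move: h1|move: h2];
      congr K; rewrite /aff/=; congr pair; by field.
  - case: T4 => h1 h2 h3; split; [move: h2|move: h1];
      congr K; rewrite /aff/=; congr pair; by field.
  - case: T3 => h1 h2 h3; split; [move: h2|move: h1];
      congr K; rewrite /aff/=; congr pair; by field.
move=> h; have {}h : 1 / 6 <= area K.
  rewrite -aE mulr0 subr0 mulrN normrN gtr0_norm; last by rewrite mulr_gt0.
  by lra.
have h3 := hexagon_area.
apply: (@le_trans _ _ (1 / 6 * 3)); first lra.
by apply: ler_pM => //; lra.
Qed.

Lemma cos_third : cos (pi / 3) = 1 / 2 :> R.
Proof.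
have pi0 := @pi_gt0 R.
have c0 : 0 < cos (pi / 3) :> R by apply: cos_gt0_pihalf; apply/andP; split; lra.
have := cospi R; rewrite {1}(_ : pi = pi / 3 + pi / 3 + pi / 3 :> R); last by field.
rewrite cosD (cosD (pi / 3) (pi / 3)) sinD.
have := cos2Dsin2 (pi / 3 : R); move: (cos _) (sin _) c0 => c s c0 e1 e2.
(* The triple angle formula for [cos pi = - 1]. *)
have : (c + 1) * (2 * c - 1) ^+ 2 = 0.
  have {}e1 : s ^+ 2 = 1 - c ^+ 2 by rewrite -e1; ring.
  by move: e2; rewrite (_ : _ - _ = c ^+ 3 - 3 * c * s ^+ 2); [rewrite e1 => e2|ring]; lra.
move=> /eqP; rewrite mulf_eq0 sqrf_eq0 => /orP[] /eqP; lra.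
Qed.

Definition sin_third : R := sin (pi / 3).

Lemma sin_third_gt0 : 0 < sin_third.
Proof. by have pi0 := @pi_gt0 R; apply: sin_gt0_pi; apply/andP; split; lra. Qed.

(** The coordinate vectors go to the vertices at angles 0 and [pi / 3]. For the inclusion into the
    hull, the signs of [x], [y] and [x + y] split [hexagon] into six triangles at the centre. *)
Lemma regular_hexagonE :
  @regular_hexagon R = affine_map 1 (1 / 2) 0 sin_third 0 0 @` hexagon.
Proof.
have h0 := sin_third_gt0; set h := sin_third in h0 *.
have c1 := cos_third; have s1 : sin (pi / 3) = h by [].
have c2 : cos (pi / 3 + pi / 3) = - (1 / 2) :> R.
  have := cos2Dsin2 (pi / 3 : R); rewrite cosD c1 => e.
  have : sin (pi / 3) * sin (pi / 3) = 3 / 4 :> R by rewrite -expr2; move: e; lra.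
  by move=> ->; lra.
have s2 : sin (pi / 3 + pi / 3) = h by rewrite sinD c1 s1; lra.
pose v : seq pt := [:: (1, 0); (1 / 2, h); (- (1 / 2), h); (- 1, 0); (- (1 / 2), - h);
  (1 / 2, - h)].
have HE : @regular_hexagon R = hull v.
  rewrite /regular_hexagon/=; congr hull; rewrite /v.
  rewrite (_ : 0 * pi / 3 = 0); last by ring.
  rewrite (_ : 1 * pi / 3 = pi / 3); last by ring.
  rewrite (_ : 2 * pi / 3 = pi / 3 + pi / 3); last by ring.
  rewrite (_ : 3 * pi / 3 = 0 + pi); last by field.
  rewrite (_ : 4 * pi / 3 = pi / 3 + pi); last by field.
  rewrite (_ : 5 * pi / 3 = pi / 3 + pi / 3 + pi); last by field.
  by rewrite !cosDpi !sinDpi c1 s1 c2 s2 cos0 sin0 oppr0 opprK.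
rewrite HE; have hn : h != 0 by rewrite gt_eqF.
have D0 : 1 * h - 1 / 2 * 0 != 0 by rewrite mul1r mulr0 subr0.
apply/seteqP; split.
  have [p [q [r [s [e [f [D1 E]]]]]]] := image_affine_map 0 0 hexagon D0.
  apply: hull_sub; first by rewrite E; apply: convex_preaff; exact: hexagon_convex.
  have pt_in z x y : z = affine_map 1 (1 / 2) 0 h 0 0 (x, y) -> hexagon (x, y) ->
      (affine_map 1 (1 / 2) 0 h 0 0 @` hexagon) z by move=> -> ?; exists (x, y).
  move=> z; rewrite !inE => /orP[/eqP ->|/orP[/eqP ->|/orP[/eqP ->|/orP[/eqP ->|/orP[]/eqP ->]]]];
    [apply: (@pt_in _ 1 0)|apply: (@pt_in _ 0 1)|apply: (@pt_in _ (- 1) 1)|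
     apply: (@pt_in _ (- 1) 0)|apply: (@pt_in _ 0 (- 1))|apply: (@pt_in _ 1 (- 1))];
    try (rewrite /affine_map/=; congr pair; lra);
    by rewrite /hexagon/=; split; apply/andP; split; lra.
have cH := @hull_convex R v.
have vm z : z \in v -> hull v z by exact: hull_mem.
have v0 : hull v (1, 0) by apply: vm; rewrite !inE eqxx.
have v1 : hull v (1 / 2, h) by apply: vm; rewrite !inE eqxx ?orbT.
have v2 : hull v (- (1 / 2), h) by apply: vm; rewrite !inE eqxx ?orbT.
have v3 : hull v (- 1, 0) by apply: vm; rewrite !inE eqxx ?orbT.
have v4 : hull v (- (1 / 2), - h) by apply: vm; rewrite !inE eqxx ?orbT.
have v5 : hull v (1 / 2, - h) by apply: vm; rewrite !inE eqxx ?orbT.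
have vc : hull v (0, 0).
  have l0 : 0 <= 1 / 2 :> R by lra. have l1 : 1 / 2 <= 1 :> R by lra.
  by have := cH _ _ v0 v3 (1 / 2) l0 l1; congr (hull v); congr pair; rewrite /=; lra.
move=> _ [[x y] [/=/andP[x0 x1] /andP[y0 y1] /andP[z0 z1]] <-].
rewrite /affine_map/=.
have comb (a b g : R) P1 P2 : 0 <= a -> 0 <= b -> a + b <= 1 -> hull v P1 -> hull v P2 ->
    hull v (a * P1.1 + b * P2.1, a * P1.2 + b * P2.2).
  move=> a0 b0 ab h1 h2; have g0 : 0 <= 1 - a - b by lra.
  have := convex3 cH h1 h2 vc a0 b0 g0 => /(_ _)/wrap[]; first by lra.
  by congr (hull v); congr pair; rewrite /=; ring.
have fin (a b : R) P1 P2 : 0 <= a -> 0 <= b -> a + b <= 1 -> hull v P1 -> hull v P2 ->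
   1 * x + 1 / 2 * y + 0 = a * P1.1 + b * P2.1 -> 0 * x + h * y + 0 = a * P1.2 + b * P2.2 ->
   hull v (1 * x + 1 / 2 * y + 0, 0 * x + h * y + 0).
  by move=> a0 b0 ab h1 h2 -> ->; exact: comb.
have [sx|sx] := leP 0 x; have [sy|sy] := leP 0 y.
- apply: (fin x y _ _ _ _ _ v0 v1) => //=; lra.
- have [sz|sz] := leP 0 (x + y).
    apply: (fin (x + y) (- y) _ _ _ _ _ v0 v5) => //=; lra.
  apply: (fin x (- (x + y)) _ _ _ _ _ v5 v4) => //=; lra.
- have [sz|sz] := leP 0 (x + y).
    apply: (fin (x + y) (- x) _ _ _ _ _ v1 v2) => //=; lra.
  apply: (fin y (- (x + y)) _ _ _ _ _ v2 v3) => //=; lra.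
- apply: (fin (- x) (- y) _ _ _ _ _ v3 v4) => //=; lra.
Qed.

Lemma affinely_regular_hexagonE (Q : set pt) : affinely_regular_hexagon Q ->
  exists p q r s e f : R, p * s - q * r != 0 /\ Q = aff p q r s e f @^-1` hexagon.
Proof.
move=> [a11 [a12 [a21 [a22 [b1 [b2 [D0 ->]]]]]]].
rewrite regular_hexagonE.
have h0 := sin_third_gt0; set h := sin_third in h0 *.
have D1 : a11 * (a21 / 2 + a22 * h) - (a11 / 2 + a12 * h) * a21 != 0.
  by rewrite (_ : _ - _ = (a11 * a22 - a12 * a21) * h); [rewrite mulf_neq0// gt_eqF|ring].
have [p [q [r [s [e [f [D2 E]]]]]]] := image_affine_map b1 b2 hexagon D1.
exists p, q, r, s, e, f; split => //; rewrite -E image_comp.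
by apply: eq_imagel => z _; rewrite /affine_map/=; congr pair; field.
Qed.

Lemma hexagon_inequality (K Q : set pt) : convex_shape K -> affinely_regular_hexagon Q ->
  lagr_capacity K Q ^+ 2 / 2 <= area K * area Q.
Proof.
move=> shK /affinely_regular_hexagonE[p [q [r [s [e [f [D0 QE]]]]]]].
apply: (normal_form_inequality shK D0 QE hexagon_compact hexagon_convex).
- exact: hexagon_norm.
- exact: hexagon_fit.
- exact: hexagon_bound.
Qed.

End Hexagon.

(** * Quadrilaterals *)

Section Quadrilateral.
Variable R : realType.
Local Notation pt := (R * R)%type.
Local Notation triple := ((R * R) * (R * R) * (R * R))%type.

Lemma closed_halfplane (p q m : R) : closed [set z : pt | p * z.1 + q * z.2 <= m].
Proof.
have c : continuous (fun z : pt => p * z.1 + q * z.2) by solve_continuous.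
by apply: (@preimage_closed _ _ (fun z : pt => p * z.1 + q * z.2) [set x | x <= m]) => //;
  exact: closed_le.
Qed.

Section NormalForm.
Variables al be : R.

(** For [al = (1 - y) / x] and [be = (1 - x) / y] the corners are [(0, 0)], [(1, 0)], [(x, y)] and
    [(0, 1)]. *)
Definition kite : set pt :=
  [set z | [/\ 0 <= z.1, 0 <= z.2, al * z.1 + z.2 <= 1 & z.1 + be * z.2 <= 1]].

Lemma kite_convex : convex2 kite.
Proof.
move=> x y [x1 x2 x3 x4] [y1 y2 y3 y4] t t0 t1.
have s0 : 0 <= 1 - t by rewrite subr_ge0.
split; rewrite /=.
- by rewrite addr_ge0// mulr_ge0.
- by rewrite addr_ge0// mulr_ge0.
- by have := ler_wpM2l t0 x3; have := ler_wpM2l s0 y3; lra.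
- by have := ler_wpM2l t0 x4; have := ler_wpM2l s0 y4; lra.
Qed.

Hypotheses (al0 : 0 <= al) (be0 : 0 <= be).

Lemma kite_compact : compact kite.
Proof.
apply: (@compact_sub_square _ _ 1); last first.
  move=> z [z1 z2 z3 z4].
  have h1 : 0 <= al * z.1 by rewrite mulr_ge0. have h2 : 0 <= be * z.2 by rewrite mulr_ge0.
  by split; apply/andP; split; lra.
rewrite (_ : kite = [set z | -1 * z.1 + 0 * z.2 <= 0] `&` [set z | 0 * z.1 + -1 * z.2 <= 0] `&`
  [set z | al * z.1 + 1 * z.2 <= 1] `&` [set z | 1 * z.1 + be * z.2 <= 1]).
  by do 3?[apply: closedI]; exact: closed_halfplane.
apply/seteqP; split => z; rewrite /kite/= !mul0r !mul1r addr0 add0r !mulN1r !oppr_le0.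
  by case.
by move=> [[[]]].
Qed.

(** The sides of each triangle are outward normals of the two coordinate edges and of one edge at
    [(x, y)], scaled so that the support values add up to 1. *)
Definition kite_triangles : seq triple :=
  [:: ((0, 0), (0, 1), (- al, 0)); ((0, 0), (0, be), (- 1, 0))].

Lemma kite_norm w (y1 y2 y3 : pt) : w \in kite_triangles ->
  kite y1 -> kite y2 -> kite y3 -> edge_pairing w y1 y2 y3 <= 1.
Proof.
have A0 := al0; have B0 := be0.
move=> wW [h1 h2 h3 h4] [k1 k2 k3 k4] [l1 l2 l3 l4].
have h5 := mulr_ge0 A0 h1; have k5 := mulr_ge0 B0 k2.
by move: wW; rewrite !inE => /orP[] /eqP ->; rewrite /edge_pairing /dot2 /sub2/=; lra.
Qed.

(** The corners are pushed against both coordinate edges; the two remaining inequalities of [kite]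
    are then those of the family. *)
Lemma kite_fit (q1 q2 q3 : pt) :
  (forall w a b c, w \in kite_triangles -> a \in [:: q1; q2; q3] -> b \in [:: q1; q2; q3] ->
     c \in [:: q1; q2; q3] -> edge_pairing w a b c <= 1) ->
  exists s : pt, [/\ kite (q1.1 + s.1, q1.2 + s.2), kite (q2.1 + s.1, q2.2 + s.2) &
    kite (q3.1 + s.1, q3.2 + s.2)].
Proof.
set q := [:: _; _; _] => H.
have q1q : q1 \in q by rewrite mem_head.
have [x xq hx] := seq_argmin (fun z : pt => z.1) q1q.
have [y yq hy] := seq_argmin (fun z : pt => z.2) q1q.
exists (- x.1, - y.2).
have fit z : z \in q -> kite (z.1 - x.1, z.2 - y.2).
  move=> zq; split; rewrite /= ?subr_ge0; [exact: hx|exact: hy| |].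
    have := H ((0, 0), (0, 1), (- al, 0)) x y z (mem_head _ _) xq yq zq.
    by rewrite /edge_pairing /dot2 /sub2/=; lra.
  have := H ((0, 0), (0, be), (- 1, 0)) x y z _ xq yq zq; rewrite !inE eqxx orbT.
  by move=> /(_ isT); rewrite /edge_pairing /dot2 /sub2/=; lra.
by split; apply: fit; rewrite !inE eqxx ?orbT.
Qed.

End NormalForm.

Lemma kite_area (x y : R) : 0 < x -> 0 < y -> x <= 1 -> y <= 1 -> 1 < x + y ->
  x + y <= 2 * area (kite ((1 - y) / x) ((1 - x) / y)).
Proof.
move=> x0 y0 x1 y1 xy.
have al0 : 0 <= (1 - y) / x by rewrite divr_ge0; lra.
have be0 : 0 <= (1 - x) / y by rewrite divr_ge0; lra.
have al1 : (1 - y) / x <= 1 by rewrite ler_pdivrMr//; lra.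
have be1 : (1 - x) / y <= 1 by rewrite ler_pdivrMr//; lra.
have alx : (1 - y) / x * x = 1 - y by rewrite divfK// gt_eqF.
have bey : (1 - x) / y * y = 1 - x by rewrite divfK// gt_eqF.
set al := (1 - y) / x in al0 al1 alx *; set be := (1 - x) / y in be0 be1 bey *.
have f0 : (1 != 0 :> R) || (1 != 0 :> R) by rewrite oner_neq0.
have := @unimodal_shoelace_le R (kite al be) 1 1 (@kite_convex al be)
  (compact_finarea (kite_compact al0 be0)) f0 (0, 0) [:: (0, 1); (x, y)] [:: (1, 0); (x, y)].
rewrite /chain /cross/= => H; apply: le_trans (H _ _ _ _ _ _).
- by lra.
- by rewrite /kite/=; split; lra.
- by move=> z; rewrite !inE => /orP[] /eqP ->; rewrite /kite/=; split; lra.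
- by move=> z; rewrite !inE => /orP[] /eqP ->; rewrite /kite/=; split; lra.
- by repeat (apply/andP; split); first [done|lra].
- by repeat (apply/andP; split); first [done|lra].
- by [].
Qed.

(** A quarter turn brings the triangles into the position of [four_triangles_area], whose bound
    equals [1 / (x + y)] for these [al] and [be]. *)
Lemma kite_bound (x y : R) (K : set pt) : 0 < x -> 0 < y -> x <= 1 -> y <= 1 -> 1 < x + y ->
  let al := (1 - y) / x in let be := (1 - x) / y in
  compact K -> convex2 K ->
  (forall w, w \in kite_triangles al be -> fits3 K w 1 /\ fits3 K (opp3 w) 1) ->
  1 / 2 <= area K * area (kite al be).
Proof.
move=> x0 y0 x1 y1 xy al be kK cK fK.
have al0 : 0 <= al by rewrite divr_ge0; lra.
have be0 : 0 <= be by rewrite divr_ge0; lra.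
have al1 : al < 1 by rewrite ltr_pdivrMr//; lra.
have be1 : be < 1 by rewrite ltr_pdivrMr//; lra.
have D1 : 0 * 0 - -1 * 1 = 1 :> R by ring.
have D0 : 0 * 0 - -1 * 1 != 0 :> R by rewrite D1 oner_neq0.
have [_ aE] := area_aff 0 0 D0 (compact_finarea kK).
have [[t1 /= T1] [t2 /= T2]] := fK _ (mem_head _ _).
have [[t3 /= T3] [t4 /= T4]] : fits3 K ((0, 0), (0, be), (- 1, 0)) 1 /\
    fits3 K (opp3 ((0, 0), (0, be), (- 1, 0))) 1.
  by apply: fK; rewrite !inE eqxx orbT.
have kK' : compact (aff 0 (-1) 1 0 0 0 @^-1` K) by exact: compact_preaff.
have cK' : convex2 (aff 0 (-1) 1 0 0 0 @^-1` K) by exact: convex_preaff.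
have := @four_triangles_area R _ al be (t1.2, - t1.1) (t2.2, - t2.1) (t3.2, - t3.1)
  (t4.2, - t4.1) kK' cK' al0 al1 be0 be1.
move=> /(_ _ _ _ _)/wrap[].
- case: T1 => h1 h2 h3; split; [move: h1|move: h2|move: h3];
    congr K; rewrite /aff/=; congr pair; ring.
- case: T2 => h1 h2 h3; split; [move: h3|move: h2|move: h1];
    congr K; rewrite /aff/=; congr pair; ring.
- case: T3 => h1 h2 h3; split; [move: h1|move: h2|move: h3];
    congr K; rewrite /aff/=; congr pair; ring.
- case: T4 => h1 h2 h3; split; [move: h3|move: h2|move: h1];
    congr K; rewrite /aff/=; congr pair; ring.
rewrite D1 normr1 mul1r in aE; rewrite aE.
rewrite (_ : _ / _ = (x + y)^-1); last first.
  have d0 : 0 < (x + y) * (x + y - 1) by apply: mulr_gt0; lra.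
  rewrite /al /be; field; apply/and4P; split; rewrite gt_eqF//; lra.
have s0 : 0 < x + y by lra.
move=> h; have kA := kite_area x0 y0 x1 y1 xy.
have : (x + y)^-1 * (x + y) <= area K * (2 * area (kite al be)).
  by apply: ler_pM => //; [rewrite invr_ge0|]; exact: ltW.
by rewrite mulVf ?gt_eqF//; lra.
Qed.

Lemma hull_perm (s s' : seq pt) : s =i s' -> hull s = hull s'.
Proof.
move=> ss; apply/seteqP; split; apply: hull_sub; try exact: hull_convex;
  by move=> z zs; apply: hull_mem; rewrite -?ss// ss.
Qed.

Lemma hull_comb3 (s : seq pt) (p q r : pt) (a b c : R) : p \in s -> q \in s -> r \in s ->
  0 <= a -> 0 <= b -> 0 <= c -> a + b + c = 1 ->
  hull s (a * p.1 + b * q.1 + c * r.1, a * p.2 + b * q.2 + c * r.2).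
Proof.
by move=> ps qs rs; apply: convex3; [exact: hull_convex|exact: hull_mem..].
Qed.

(* [C] is the corner opposite to [A]; its coordinates in the frame [A; B, D] are the
   areas of the corner triangles at [D] and [B] relative to the one at [A]. *)
Definition framed (Q : set pt) (A B C D : pt) (x y : R) : Prop :=
  [/\ Q = hull [:: A; B; C; D], area2 A B D != 0, 0 < x, 0 < y & 1 < x + y] /\
  C = (A.1 + x * (B.1 - A.1) + y * (D.1 - A.1), A.2 + x * (B.2 - A.2) + y * (D.2 - A.2)).

(** Relative to the corner triangle at [A], those at [A], [B], [C], [D] have areas 1, [y],
    [x + y - 1], [x]. The frame is moved to a corner where this is largest. *)
Lemma framed_max Q A B C D x y : framed Q A B C D x y ->
  exists A' B' C' D' x' y', framed Q A' B' C' D' x' y' /\ x' <= 1 /\ y' <= 1.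
Proof.
move=> [[QE S0 x0 y0 xy] CE].
have d0 : 0 < x + y - 1 by lra.
have [xn [yn dn]] : x != 0 /\ y != 0 /\ x + y - 1 != 0 by rewrite !gt_eqF.
have [x1|x1] := leP x 1; have [y1|y1] := leP y 1.
- by exists A, B, C, D, x, y.
- exists B, C, D, A, (1 / y), ((x + y - 1) / y); split; [split; [split|]|split].
  + by rewrite QE; apply: hull_perm => z; rewrite !inE; do 4!case: (_ == _).
  + by rewrite (_ : area2 _ _ _ = y * area2 A B D) ?mulf_neq0// CE /area2/=; ring.
  + exact: divr_gt0.
  + exact: divr_gt0.
  + by rewrite -mulrDl ltr_pdivlMr//; lra.
  + by rewrite CE [D in LHS]surjective_pairing/=; congr pair; field.
  + by rewrite ler_pdivrMr//; lra.
  + by rewrite ler_pdivrMr//; lra.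
- exists D, A, B, C, ((x + y - 1) / x), (1 / x); split; [split; [split|]|split].
  + by rewrite QE; apply: hull_perm => z; rewrite !inE; do 4!case: (_ == _).
  + by rewrite (_ : area2 _ _ _ = x * area2 A B D) ?mulf_neq0// CE /area2/=; ring.
  + exact: divr_gt0.
  + exact: divr_gt0.
  + by rewrite -mulrDl ltr_pdivlMr//; lra.
  + by rewrite CE [B in LHS]surjective_pairing/=; congr pair; field.
  + by rewrite ler_pdivrMr//; lra.
  + by rewrite ler_pdivrMr//; lra.
- exists C, D, A, B, (y / (x + y - 1)), (x / (x + y - 1)); split; [split; [split|]|split].
  + by rewrite QE; apply: hull_perm => z; rewrite !inE; do 4!case: (_ == _).
  + by rewrite (_ : area2 _ _ _ = (x + y - 1) * area2 A B D) ?mulf_neq0// CE /area2/=; ring.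
  + exact: divr_gt0.
  + exact: divr_gt0.
  + by rewrite -mulrDl ltr_pdivlMr//; lra.
  + by rewrite CE [A in LHS]surjective_pairing/=; congr pair; field.
  + by rewrite ler_pdivrMr//; lra.
  + by rewrite ler_pdivrMr//; lra.
Qed.

Lemma framed_kite Q A B C D (x y : R) : framed Q A B C D x y -> x <= 1 -> y <= 1 ->
  Q = affine_map (B.1 - A.1) (D.1 - A.1) (B.2 - A.2) (D.2 - A.2) A.1 A.2
    @` kite ((1 - y) / x) ((1 - x) / y).
Proof.
move=> [[QE S0 x0 y0 xy] CE] x1 y1; rewrite QE.
have al0 : 0 <= (1 - y) / x by rewrite divr_ge0//; lra.
have be0 : 0 <= (1 - x) / y by rewrite divr_ge0//; lra.
have al1 : (1 - y) / x <= 1 by rewrite ler_pdivrMr//; lra.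
have be1 : (1 - x) / y <= 1 by rewrite ler_pdivrMr//; lra.
have alx : (1 - y) / x * x = 1 - y by rewrite divfK// gt_eqF.
have bey : (1 - x) / y * y = 1 - x by rewrite divfK// gt_eqF.
set al := (1 - y) / x in al0 al1 alx *; set be := (1 - x) / y in be0 be1 bey *.
set g := affine_map _ _ _ _ _ _.
have D0 : (B.1 - A.1) * (D.2 - A.2) - (D.1 - A.1) * (B.2 - A.2) != 0.
  by move: S0; congr (_ != _); rewrite /area2; ring.
apply/seteqP; split.
  have [p [q [r [s [e [f [_ E]]]]]]] := image_affine_map A.1 A.2 (kite al be) D0.
  apply: hull_sub; first by rewrite E; apply: convex_preaff; exact: kite_convex.
  move=> z; rewrite !inE => /or4P[] /eqP ->.
  - exists (0, 0); first by rewrite /kite/=; split; lra.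
    by rewrite /g /affine_map/= [RHS]surjective_pairing; congr pair; ring.
  - exists (1, 0); first by rewrite /kite/=; split; lra.
    by rewrite /g /affine_map/= [RHS]surjective_pairing; congr pair; ring.
  - exists (x, y); first by rewrite /kite/=; split; lra.
    by rewrite CE /g /affine_map/=; congr pair; ring.
  - exists (0, 1); first by rewrite /kite/=; split; lra.
    by rewrite /g /affine_map/= [RHS]surjective_pairing; congr pair; ring.
move=> _ [[u v] [/= u0 v0 h1 h2]] <-.
have [As Bs Cs Ds] : [/\ A \in [:: A; B; C; D], B \in [:: A; B; C; D],
    C \in [:: A; B; C; D] & D \in [:: A; B; C; D]].
  by rewrite !inE !eqxx !orbT.
(* The diagonal from [A] to [C] splits the quadrilateral into two triangles. *)
have [c|c] := leP (v * x) (u * y).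
  have a0 : 0 <= v / y by rewrite divr_ge0// ltW.
  have b0 : 0 <= u - x * (v / y) by rewrite subr_ge0 mulrA ler_pdivrMr// mulrC.
  have e : be * v = (1 - x) * (v / y) by rewrite /be mulrAC mulrA.
  have c0 : 0 <= 1 - v / y - (u - x * (v / y)) by clear -h2 e; lra.
  have := hull_comb3 As Bs Cs c0 b0 a0 => /(_ _)/wrap[]; first by ring.
  congr (hull _); rewrite CE /g /affine_map/=; congr pair; field; rewrite gt_eqF//.
have a0 : 0 <= u / x by rewrite divr_ge0// ltW.
have b0 : 0 <= v - y * (u / x) by rewrite subr_ge0 mulrA ler_pdivrMr// mulrC ltW.
have e : al * u = (1 - y) * (u / x) by rewrite /al mulrAC mulrA.
have c0 : 0 <= 1 - u / x - (v - y * (u / x)) by clear -h1 e; lra.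
have := hull_comb3 As Ds Cs c0 b0 a0 => /(_ _)/wrap[]; first by ring.
congr (hull _); rewrite CE /g /affine_map/=; congr pair; field; rewrite gt_eqF//.
Qed.

Lemma line_param (a b c : pt) : a != b -> area2 a b c = 0 ->
  exists t : R, c = (a.1 + t * (b.1 - a.1), a.2 + t * (b.2 - a.2)).
Proof.
move=> ab S0.
have [e1|n1] := eqVneq a.1 b.1.
  have n2 : b.2 - a.2 != 0.
    rewrite subr_eq0 eq_sym; apply: contra ab => /eqP e2.
    by rewrite [a]surjective_pairing e1 e2 -surjective_pairing.
  exists ((c.2 - a.2) / (b.2 - a.2)); rewrite [LHS]surjective_pairing; congr pair.
    move: S0; rewrite /area2 e1 subrr mul0r sub0r mulr0 addr0 => /eqP.
    by rewrite oppr_eq0 mulf_eq0 (negbTE n2)/= subr_eq0 => /eqP.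
  by field.
have {}n1 : b.1 - a.1 != 0 by rewrite subr_eq0 eq_sym.
exists ((c.1 - a.1) / (b.1 - a.1)); rewrite [LHS]surjective_pairing; congr pair; first by field.
apply: (mulfI n1); rewrite mulrDr mulrA (mulrC (b.1 - a.1) (_ / _)) divfK//.
by apply/eqP; rewrite -subr_eq0 -S0 /area2; apply/eqP; ring.
Qed.

Lemma hull_comb2 (s : seq pt) (p q : pt) (t : R) : p \in s -> q \in s -> 0 <= t -> t <= 1 ->
  hull s (t * p.1 + (1 - t) * q.1, t * p.2 + (1 - t) * q.2).
Proof. by move=> ps qs; apply: hull_convex; exact: hull_mem. Qed.

(** One of three collinear points lies between the other two; the parameter of [c] on the line
    through [a] and [b] tells which. *)
Lemma collinear_hull (a b c : pt) (s1 s2 s3 : seq pt) : area2 a b c = 0 ->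
  b \in s1 -> c \in s1 -> a \in s2 -> c \in s2 -> a \in s3 -> b \in s3 ->
  [\/ hull s1 a, hull s2 b | hull s3 c].
Proof.
move=> S0 b1 c1 a2 c2 a3 b3.
have [ab|ab] := eqVneq a b; first by constructor 1; rewrite ab; exact: hull_mem.
have [t cE] := line_param ab S0.
have [t0|t0] := leP t 0.
  have d0 : 0 < 1 - t by lra.
  have dn : 1 - t != 0 by rewrite gt_eqF.
  have l0 : 0 <= - t / (1 - t) by rewrite divr_ge0//; lra.
  have l1 : - t / (1 - t) <= 1 by rewrite ler_pdivrMr//; lra.
  constructor 1; have := hull_comb2 b1 c1 l0 l1; congr (hull _).
  by rewrite cE [RHS]surjective_pairing/=; congr pair; field.
have [t1|t1] := leP t 1.
  constructor 3; have := hull_comb2 b3 a3 (ltW t0) t1; congr (hull _).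
  by rewrite cE; congr pair; ring.
have tn : t != 0 by rewrite gt_eqF.
have l0 : 0 <= t^-1 by rewrite invr_ge0 ltW.
have l1 : t^-1 <= 1 by rewrite invf_le1// ltW.
constructor 2; have := hull_comb2 c2 a2 l0 l1; congr (hull _).
by rewrite cE [RHS]surjective_pairing/=; congr pair; field.
Qed.

(** Of the barycentric coordinates of [d] with respect to [a], [b], [c], exactly one is negative and
    the others are positive; its vertex is opposite to [d]. Every other sign pattern puts [d] into
    the triangle or one of [a], [b], [c] into the hull of the remaining points. *)
Lemma quadrilateral_framed (Q : set pt) : quadrilateral Q ->
  exists A B C D x y, framed Q A B C D x y.
Proof.
move=> [a [b [c [d [-> [na [nb [nc nd]]]]]]]].
have S0 : area2 a b c != 0.
  apply/eqP => S0.
  have [||||||//|//|//] := @collinear_hull a b c [:: b; c; d] [:: a; c; d] [:: a; b; d] S0;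
    by rewrite !inE eqxx ?orbT.
pose S := area2 a b c; pose al := area2 d b c / S; pose be := area2 a d c / S.
pose ga := area2 a b d / S.
have alS : al * S = area2 d b c by rewrite divfK.
have beS : be * S = area2 a d c by rewrite divfK.
have gaS : ga * S = area2 a b d by rewrite divfK.
have abg : al + be + ga = 1.
  by apply: (mulIf S0); rewrite -/S !mulrDl alS beS gaS /S /area2; ring.
have dE : d = (al * a.1 + be * b.1 + ga * c.1, al * a.2 + be * b.2 + ga * c.2).
  rewrite [LHS]surjective_pairing; congr pair; apply: (mulIf S0); rewrite -/S.
    transitivity (al * S * a.1 + be * S * b.1 + ga * S * c.1); last by ring.
    by rewrite alS beS gaS /S /area2; ring.
  transitivity (al * S * a.2 + be * S * b.2 + ga * S * c.2); last by ring.
  by rewrite alS beS gaS /S /area2; ring.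
clear alS beS gaS.
clearbody al be ga.
have comb (p q r z : pt) (s : seq pt) (u v w : R) : p \in s -> q \in s -> r \in s ->
    0 <= u -> 0 <= v -> 0 < w ->
    w = u + v + 1 ->
    z = ((p.1 + u * q.1 + v * r.1) / w, (p.2 + u * q.2 + v * r.2) / w) -> hull s z.
  move=> ps qs rs u0 v0 w0 wE ->; have wn : w != 0 by rewrite gt_eqF.
  have h1 : 0 <= w^-1 by rewrite invr_ge0 ltW.
  have h2 : 0 <= u / w by rewrite divr_ge0// ltW.
  have h3 : 0 <= v / w by rewrite divr_ge0// ltW.
  have h : w^-1 + u / w + v / w = 1.
    by transitivity ((u + v + 1) / w); [field|rewrite -wE divff].
  have := hull_comb3 ps qs rs h1 h2 h3 h.
  by congr (hull _); congr pair; field.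
have [a0|a0] := leP al 0; have [b0|b0] := leP be 0; have [c0|c0] := leP ga 0.
- lra.
- case: nc; apply: (comb d a b c _ (- al) (- be) ga); rewrite ?inE ?eqxx ?orbT//;
    [lra|lra|lra|].
  by rewrite dE [LHS]surjective_pairing/=; congr pair; field; rewrite gt_eqF.
- case: nb; apply: (comb d a c b _ (- al) (- ga) be); rewrite ?inE ?eqxx ?orbT//;
    [lra|lra|lra|].
  by rewrite dE [LHS]surjective_pairing/=; congr pair; field; rewrite gt_eqF.
- have [az|an] := eqVneq al 0.
    case: nd; rewrite dE; apply: hull_comb3; rewrite ?inE ?eqxx ?orbT//; lra.
  have {}a0 : al < 0 by rewrite lt_neqAle an.
  exists a, b, d, c, be, ga; split; last first.
    by rewrite dE (_ : al = 1 - be - ga); [congr pair; ring|lra].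
  split => //; last lra.
  by apply: hull_perm => z; rewrite !inE; do 4!case: (_ == _).
- case: na; apply: (comb d b c a _ (- be) (- ga) al); rewrite ?inE ?eqxx ?orbT//;
    [lra|lra|lra|].
  by rewrite dE [LHS]surjective_pairing/=; congr pair; field; rewrite gt_eqF.
- have [bz|bn] := eqVneq be 0.
    case: nd; rewrite dE; apply: hull_comb3; rewrite ?inE ?eqxx ?orbT//; lra.
  have {}b0 : be < 0 by rewrite lt_neqAle bn.
  exists b, a, d, c, al, ga; split.
    split => //; last lra.
      by apply: hull_perm => z; rewrite !inE; do 4!case: (_ == _).
    by rewrite (_ : area2 _ _ _ = - area2 a b c) ?oppr_eq0// /area2; ring.
  by rewrite dE (_ : be = 1 - al - ga); [congr pair; ring|lra].
- have [cz|cn] := eqVneq ga 0.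
    case: nd; rewrite dE; apply: hull_comb3; rewrite ?inE ?eqxx ?orbT//; lra.
  have {}c0 : ga < 0 by rewrite lt_neqAle cn.
  exists c, a, d, b, al, be; split.
    split => //; last lra.
      by apply: hull_perm => z; rewrite !inE; do 4!case: (_ == _).
    by rewrite (_ : area2 _ _ _ = area2 a b c)// /area2; ring.
  by rewrite dE (_ : ga = 1 - al - be); [congr pair; ring|lra].
- by case: nd; rewrite dE; apply: hull_comb3; rewrite ?inE ?eqxx ?orbT//; lra.
Qed.

Lemma quadrilateral_inequality (K Q : set pt) : convex_shape K -> quadrilateral Q ->
  lagr_capacity K Q ^+ 2 / 2 <= area K * area Q.
Proof.
move=> shK /quadrilateral_framed[A0 [B0 [C0 [D0 [x0 [y0 /framed_max]]]]]].
move=> [A [B [C [D [x [y [F [x1 y1]]]]]]]].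
have QE := framed_kite F x1 y1; have [[_ S0 xp yp xy] _] := F.
have det0 : (B.1 - A.1) * (D.2 - A.2) - (D.1 - A.1) * (B.2 - A.2) != 0.
  by move: S0; congr (_ != _); rewrite /area2; ring.
have al0 : 0 <= (1 - y) / x by apply: divr_ge0; [rewrite subr_ge0|exact: ltW].
have be0 : 0 <= (1 - x) / y by apply: divr_ge0; [rewrite subr_ge0|exact: ltW].
have [p [q [r [s [e [f [D1 E]]]]]]] :=
  image_affine_map A.1 A.2 (kite ((1 - y) / x) ((1 - x) / y)) det0.
rewrite E in QE.
apply: (normal_form_inequality shK D1 QE (kite_compact al0 be0) (@kite_convex _ _)).
- exact: (kite_norm al0 be0).
- exact: kite_fit.
- by move=> K'; exact: kite_bound.
Qed.

End Quadrilateral.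

Theorem theorem1p2 (R : realType) (K Q : set (R * R)) :
  convex_shape K ->
  (quadrilateral Q \/ affinely_regular_hexagon Q) ->
  area K * area Q >= (lagr_capacity K Q) ^+ 2 / 2.
Proof.
move=> shK [qQ|hQ]; [exact: quadrilateral_inequality|exact: hexagon_inequality].
Qed.
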